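(* Let $\alpha\le 1$ and let $f_0\in L^\infty_{x,p}(\omega^\alpha)$. Then the inhomogeneous kinetic FPU equation $\partial_t f+\omega'(p)\,\partial_x f=\mathcal C[f]$ with initial datum $f_0$ admits a unique mild solution $$f\in C\big([0,T],\,L^\infty_xL^\infty_p(\omega^\alpha)\big),$$ and the time of existence satisfies $$T\sim \|f_0\|_{L^\infty_{x,p}(\omega^\alpha)}^{-2}.$$
   Context: Variables: $t\ge 0$, $x\in\mathbb R$, $p\in\mathbb T=\mathbb R/2\pi\mathbb Z$. Dispersion relation $\omega(p)=|\sin(p/2)|$, group velocity $v(p)=\omega'(p)$ (for $p\in(0,2\pi)$, $v(p)=\tfrac12\cos(p/2)$). Weighted norm: $\|f\|_{L^\infty_{x,p}(\omega^\alpha)}=\|f\|_{L^\infty_xL^\infty_p(\omega^\alpha)}=\sup_{x\in\mathbb R,\,p\in\mathbb T}\omega(p)^\alpha|f(x,p)|$ (essential supremum). Collision operator (acting in $p$ only, for each fixed $(t,x)$, restricted to the nontrivial resonant manifold): for $p_0\in[0,2\pi]$, $$\mathcal C[f](p_0)=\int_0^{2\pi}\frac{\omega_0\omega_1\omega_2\omega_3}{\sqrt{F_+(p_0,p_2)}}\,\big(f_1f_2f_3+f_0f_2f_3-f_0f_1f_3-f_0f_1f_2\big)\,dp_2,$$ where $\omega_j=\omega(p_j)$, $f_j=f(p_j)$, $p_1=h(p_0,p_2)$ and $p_3=p_0+p_1-p_2$ (both modulo $2\pi$), $$h(x,z)=\frac{z-x}{2}+2\arcsin\!\Big(\tan\big(\tfrac{|z-x|}{4}\big)\cos\big(\tfrac{z+x}{4}\big)\Big),$$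 $$F_+(p_0,p_2)=\Big[\cos\tfrac{p_0}{2}+\cos\tfrac{p_2}{2}\Big]^2+4\sin\tfrac{p_0}{2}\sin\tfrac{p_2}{2}.$$ Transport semigroup: $\mathcal S(t)f(x,p)=f(x-v(p)t,p)$. A mild solution on $[0,T]$ is a function satisfying $f(t)=\mathcal S(t)f_0+\int_0^t\mathcal S(t-s)\,\mathcal C[f](s)\,ds$ for $t\in[0,T]$. The notation $T\sim A$ means that $T$ and $A$ are comparable up to positive multiplicative constants independent of $f_0$.
   Formalization: Continuity in C([0,T], L^∞_xL^∞_p(ω^α)) is taken in the weak-* topology, since norm continuity fails e.g. for f_0=ω^{-α}1_{x>0}; norm continuity on [0,T] is asserted whenever t↦S(t)f_0 is norm continuous. *)

(* Defs.v *)
From HB Require Import structures.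
From mathcomp Require Import all_boot all_order all_algebra.
From mathcomp Require Import all_classical all_reals all_analysis.
Set Implicit Arguments.
Unset Strict Implicit.
Unset Printing Implicit Defensive.
Import Order.TTheory GRing.Theory Num.Theory.
Import numFieldNormedType.Exports.
Local Open Scope classical_set_scope.
Local Open Scope ring_scope.

(* Functions on the torus T = R/2piZ are 2pi-periodic functions on R; the
   reduction modulo 2pi of momenta is then implicit.  A function on R x T is a
   function of z = (x, p) : R * R, 2pi-periodic in p. *)

(* R * R, with the sigma-algebra on which [lebesgue_measure] is defined. *)
Notation phase R := (measurableTypeR R * measurableTypeR R)%type.

Section dispersion.
Context {R : realType}.
Implicit Types (p x z t : R).

Definition omega p : R := `|sin (p / 2)|.

(* omega is not differentiable on 2piZ, where the value of [derive1] is
   irrelevant since this set is negligible. *)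
Definition velocity p : R := (omega^`())%classic p.

Definition hres x z : R :=
  (z - x) / 2 + 2 * asin (tan (`|z - x| / 4) * cos ((z + x) / 4)).

Definition Fplus p0 p2 : R :=
  (cos (p0 / 2) + cos (p2 / 2)) ^+ 2 + 4 * sin (p0 / 2) * sin (p2 / 2).

(* For 2pi-periodic [g] and [p0] in [0, 2pi]: the formulas for [hres] and
   [Fplus] are not periodic in [p0], [p2]. *)
Definition collision (g : R -> R) (p0 : R) : R :=
  \int[lebesgue_measure]_(p2 in `[0, 2 * pi])
    (let p1 := hres p0 p2 in
     let p3 := p0 + p1 - p2 in
     omega p0 * omega p1 * omega p2 * omega p3 / Num.sqrt (Fplus p0 p2) *
     (g p1 * g p2 * g p3 + g p0 * g p2 * g p3
      - g p0 * g p1 * g p3 - g p0 * g p1 * g p2)).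

Definition collision_xp (f : phase R -> R) (z : phase R) : R :=
  collision (fun p => f (z.1, p)) z.2.

Definition transport t (f : phase R -> R) (z : phase R) : R :=
  f (z.1 - velocity z.2 * t, z.2).

End dispersion.

Section phase_space.
Context {R : realType}.

Lemma measurable_period :
  measurable (`[0, 2 * pi]%classic : set (measurableTypeR R)).
Proof. exact: measurable_itv. Qed.

Lemma lebesgue_period_fin :
  (@lebesgue_measure R `[0%R, (2 * pi)%R]%classic < +oo%E)%E.
Proof. by rewrite lebesgue_measure_itv /=; case: ifP; rewrite ltry. Qed.

Definition torus_measure : {finite_measure set (measurableTypeR R) -> \bar R} :=
  mfrestr measurable_period lebesgue_period_fin.

Definition phase_measure :
    {measure set (phase R) -> \bar R} :=
  (@lebesgue_measure R \x torus_measure)%E.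

End phase_space.

Section weighted_Linfty.
Context {R : realType}.
Variable alpha : R.
Implicit Types (f : phase R -> R) (F : R -> phase R -> R).

Definition weighted f (z : phase R) : R := omega z.2 `^ alpha * f z.

(* The norm of L^oo_{x,p}(omega^alpha), with an essential supremum. *)
Definition Linfty_norm f : \bar R :=
  'N[phase_measure]_+oo[EFin \o weighted f].

Definition periodic_p f := forall x p, f (x, p + 2 * pi) = f (x, p).

Definition in_Linfty f :=
  [/\ measurable_fun setT f, periodic_p f & (Linfty_norm f < +oo)%E].

Definition Linfty_norm_continuous (T : R) F :=
  forall t, t \in `[0, T] ->
    Linfty_norm (F s \- F t) @[s --> within `[0, T] (nbhs t)] --> 0%E.

(* [f |-> weighted f] identifies L^oo(omega^alpha) with L^oo = (L^1)^*. *)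
Definition weak_star_continuous (T : R) F :=
  forall psi : phase R -> R,
    phase_measure.-integrable setT (EFin \o psi) ->
    {within `[0, T], continuous
      (fun t => \int[phase_measure]_z (weighted (F t) z * psi z))}.

(* C([0, T], L^oo(omega^alpha)).  The transport semigroup is not strongly
   continuous on L^oo (if f0 is the indicator of {x > 0}, the free evolution
   t |-> transport t f0 is not norm-continuous), so L^oo carries its weak-*
   topology.  Weak-* continuity on [0, T] entails the norm bound; measurability
   concerns the choice of representatives, and gives sense to the time integral
   in [mild_solution]. *)
Definition C_Linfty (T : R) F :=
  [/\ measurable_fun
        ((`[0, T]%classic : set (measurableTypeR R)) `*` [set: phase R])
        (fun u => F u.1 u.2),
      forall t, t \in `[0, T] -> in_Linfty (F t),
      exists M : R, forall t, t \in `[0, T] -> (Linfty_norm (F t) <= M%:E)%E &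
      weak_star_continuous T F].

(* For alpha <= 1 and F in [C_Linfty], the integrals here and in [collision]
   converge absolutely for almost every z. *)
Definition mild_solution (f0 : phase R -> R) (T : R) F :=
  forall t, t \in `[0, T] ->
    {ae phase_measure, forall z,
      F t z = transport t f0 z +
        \int[lebesgue_measure]_(s in `[0, t])
           transport (t - s) (collision_xp (F s)) z}.

(* Existence and uniqueness of the mild solution on [0, T].  The last clause is
   continuity for the norm topology for every datum whose free evolution has
   it; for other data no mild solution is norm-continuous. *)
Definition unique_mild_solution (f0 : phase R -> R) (T : R) :=
  exists F,
    [/\ C_Linfty T F,
        mild_solution f0 T F,
        (forall G, C_Linfty T G -> mild_solution f0 T G ->
           forall t, t \in `[0, T] ->
             {ae phase_measure, forall z, G t z = F t z}) &
        Linfty_norm_continuous T (fun t => transport t f0) ->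
          Linfty_norm_continuous T F].

End weighted_Linfty.

(* Main.v *)
Require Import Defs.
From HB Require Import structures.
From mathcomp Require Import all_boot all_order all_algebra.
From mathcomp Require Import all_classical all_reals all_analysis.
From mathcomp Require Import measurable_realfun ring lra.
Import Order.TTheory GRing.Theory Num.Theory.
Import numFieldNormedType.Exports.
Local Open Scope classical_set_scope.
Local Open Scope ring_scope.
Set Implicit Arguments.
Unset Strict Implicit.
Unset Printing Implicit Defensive.

(* On the resonant manifold, the frequencies and sqrt F_+ are explicit in terms of
   the half sum and half difference of p0 / 2 and p2 / 2. This gives
   w1 w2 w3 <= 4 w0 and w0^2, w0 w1, w0 w2, w0 w3 <= 2 sqrt F_+, so that for
   alpha <= 1 the collision operator is locally Lipschitz on the set |f| <= M omega^-alpha,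
   with a constant O(M^2): Picard iteration converges on a time of order M^-2.
   Since p2 |-> p1 is expanding along the lines p2 - p0 = const, almost everywhere
   bounds survive the collision, and a Gronwall argument gives stability in the
   weighted norm, hence uniqueness.
   The solution is Lipschitz in time along the free flow, so its weak-* continuity
   reduces to the continuity of translations in L^1. For continuity in norm, the
   datum is averaged along the free flow over a short time. The averaged datum is
   Lipschitz along the flow, a property which the equation propagates as a modulus
   of continuity because resonances involving a slow momentum are rare; by
   stability, the corresponding solutions converge uniformly. *)

(** Existence is free of exceptional sets: the datum has a representative bounded at every point,
    and Picard iteration preserves pointwise bounds. A competing solution is bounded only almost
    everywhere, and possibly by a larger constant than the constructed one, so its uniqueness cannot
    rest on the contraction. It rests on a Gronwall iteration through explicit continuous majorants,
    which avoids any measurability in time of the essential norm. The condition alpha <= 1 enters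
    because w w^-alpha = w^(1 - alpha) must be nondecreasing in w. The smallness condition
    [T * lip (2 * M) <= 2^-1] serves both the invariance of the ball of radius 2 M and the
    contraction by 1/2. The obstacle to continuity in norm is that translations in x commute with
    the collision but the free flow does not, as its displacement depends on p. A displacement due
    to the flow at p0 must be reinterpreted as one due to the flow at p1, p2 and p3, over other
    times; these are small unless one of the velocities is. *)

(** * Algebraic inequalities between the resonant frequencies *)

(* The squares of the following relations only involve [s, c] = sin, cos of
   D = (p2 - p0) / 4 and [S, C] = sin, cos of (p2 + p0) / 4; [u] is the argument
   of asin in [hres], and [e] = sqrt (1 - u^2). *)
Section resonance_algebra.
Context {R : realType}.
Variables (s c S C u e : R).
Hypotheses (hsc : s ^+ 2 + c ^+ 2 = 1) (hSC : S ^+ 2 + C ^+ 2 = 1).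
Hypotheses (c0 : 0 < c) (S0 : 0 <= S) (huc : u ^+ 2 * c ^+ 2 = s ^+ 2 * C ^+ 2).
Hypotheses (e0 : 0 <= e) (he : e ^+ 2 = 1 - u ^+ 2) (hCc : C ^+ 2 <= c ^+ 2).

Let w0 := S * c - C * s.
Let w2 := S * c + C * s.
Hypotheses (w0_ge0 : 0 <= w0) (w2_ge0 : 0 <= w2).

Lemma res_u_le_s : u ^+ 2 <= s ^+ 2.
Proof.
rewrite -(ler_pM2r (_ : 0 < c ^+ 2)) ?exprn_gt0// huc.
by apply: ler_wpM2l => //; exact: sqr_ge0.
Qed.

Lemma res_c_le_e : c <= e.
Proof.
rewrite -(@ler_sqr _ c e) ?nnegrE ?(ltW c0)// he.
by move: he res_u_le_s hsc; lra.
Qed.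

Lemma res_w_le : w0 <= 2 * c /\ w2 <= 2 * c.
Proof.
have S1 : S <= 1 by have := sqr_ge0 C; move: hSC S0; nra.
have : S * c <= c by rewrite ler_piMl// ltW.
by move: w0_ge0 w2_ge0; rewrite /w0 /w2; split; lra.
Qed.

Lemma res_w0_sqr : w0 ^+ 2 <= 2 * (2 * c * e).
Proof.
have [h _] := res_w_le; have ce := res_c_le_e.
have h2 : w0 * w0 <= (2 * c) * (2 * c) by apply: ler_pM.
have h3 : c * c <= c * e by apply: ler_wpM2l => //; exact: ltW.
rewrite expr2; move: h2 h3; lra.
Qed.

Lemma res_le1 : c <= 1 /\ e <= 1.
Proof.
have := sqr_ge0 s; have := sqr_ge0 u; move: hsc he; rewrite !expr2 => h1 h2 h3 h4.
split.
  by rewrite leNgt; apply/negP => h; have := c0; nra.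
by rewrite leNgt; apply/negP => h; have := e0; nra.
Qed.

(** By [huc], (c e)^2 = c^2 - s^2 C^2, which exceeds w0 w2 by C^2 c^2; moreover (c e)^2 <= c e since
    c e <= 1. *)
Lemma res_w0w2 : w0 * w2 <= 2 * c * e.
Proof.
have [c1 e1] := res_le1.
have k1 : w0 * w2 = S ^+ 2 * c ^+ 2 - C ^+ 2 * s ^+ 2 by rewrite /w0 /w2; ring.
have k2 : S ^+ 2 = 1 - C ^+ 2 by move: hSC; lra.
have k3 : (c * e) ^+ 2 = c ^+ 2 - s ^+ 2 * C ^+ 2.
  by rewrite exprMn he mulrBr mulr1 (mulrC (c ^+ 2)) huc.
have ce0 : 0 <= c * e by rewrite mulr_ge0// ltW.
have k4 : w0 * w2 <= (c * e) ^+ 2.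
  rewrite k1 k3 k2; have : 0 <= C ^+ 2 * c ^+ 2 by rewrite mulr_ge0 ?sqr_ge0.
  lra.
have k5 : c * e <= 1 by rewrite mulr_ile1// ltW.
have k6 : (c * e) ^+ 2 <= c * e by rewrite expr2 ler_piMr.
lra.
Qed.

(** Here x stands for the sine of p1 / 2 or p3 / 2. The two factors are at most 2 c and e + c <= 2
    e. *)
Lemma res_w0wi (x : R) : x = s * e + c * u \/ x = c * u - s * e ->
  w0 * `|x| <= 2 * (2 * c * e).
Proof.
move=> hx; have [h _] := res_w_le; have ce := res_c_le_e.
have s1 : `|s| <= 1.
  by rewrite -(@ler_sqr _ _ 1) ?nnegrE// -normrX ger0_norm ?sqr_ge0// expr1n; have := sqr_ge0 c; move: hsc; lra.
have u1 : `|u| <= 1.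
  by rewrite -(@ler_sqr _ _ 1) ?nnegrE// -normrX ger0_norm ?sqr_ge0// expr1n; have := sqr_ge0 e; move: he; lra.
have k : `|x| <= `|s| * e + c * `|u|.
  have -> : `|s| * e + c * `|u| = `|s * e| + `|c * u|.
    by rewrite !normrM (ger0_norm e0) (gtr0_norm c0).
  by case: hx => ->; [exact: ler_normD|rewrite (addrC `|s * e|); exact: ler_normB].
have k1 : `|s| * e <= e by rewrite ler_piMl.
have k2 : c * `|u| <= c by rewrite ler_piMr// ltW.
have k3 : `|x| <= 2 * e by lra.
have -> : 2 * (2 * c * e) = (2 * c) * (2 * e) by ring.
by apply: ler_pM.
Qed.

(** The product w1 w3 equals s^2 - u^2. Multiplied by c^2 it becomes s^2 (c^2 - C^2) = s^2 w0 w2, so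
    c^2 w1 w2 w3 = s^2 w2^2 w0, and w2 <= 2 c. *)
Lemma res_w1w2w3 : `|s * e + c * u| * w2 * `|c * u - s * e| <= 4 * w0.
Proof.
have [_ h] := res_w_le.
have -> : `|s * e + c * u| * w2 * `|c * u - s * e| =
    w2 * `|u ^+ 2 - s ^+ 2|.
  rewrite mulrAC mulrC -normrM; congr (_ * `|_|).
  have -> : (s * e + c * u) * (c * u - s * e) = c ^+ 2 * u ^+ 2 - s ^+ 2 * e ^+ 2 by ring.
  rewrite he; have -> : c ^+ 2 = 1 - s ^+ 2 by move: hsc; lra.
  by ring.
rewrite ler0_norm; last by have := res_u_le_s; lra.
rewrite -(ler_pM2r (_ : 0 < c ^+ 2)) ?exprn_gt0//.
have -> : w2 * - (u ^+ 2 - s ^+ 2) * c ^+ 2 = w2 * (s ^+ 2 * c ^+ 2 - u ^+ 2 * c ^+ 2) by ring.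
rewrite huc.
have -> : w2 * (s ^+ 2 * c ^+ 2 - s ^+ 2 * C ^+ 2) = s ^+ 2 * (w2 ^+ 2 * w0).
  rewrite [w2 ^+ 2]expr2 -mulrA.
  have -> : w2 * w0 = c ^+ 2 - C ^+ 2.
    rewrite /w0 /w2.
    transitivity (c ^+ 2 * (S ^+ 2 + C ^+ 2) - C ^+ 2 * (s ^+ 2 + c ^+ 2)); first by ring.
    by rewrite hSC hsc !mulr1.
  by ring.
have -> : 4 * w0 * c ^+ 2 = 1 * ((2 * c) ^+ 2 * w0) by ring.
apply: ler_pM.
- exact: sqr_ge0.
- by rewrite mulr_ge0 ?sqr_ge0.
- by have := sqr_ge0 c; move: hsc; lra.
apply: ler_wpM2r => //; by rewrite ler_sqr ?nnegrE ?mulr_ge0 ?(ltW c0).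
Qed.

End resonance_algebra.

(** * Explicit form of the resonant manifold *)

Section resonance.
Context {R : realType}.
Implicit Types (p : R).

Definition p3of p0 p2 : R := p0 + hres p0 p2 - p2.

Definition kern p0 p2 : R :=
  omega p0 * omega (hres p0 p2) * omega p2 * omega (p3of p0 p2) /
  Num.sqrt (Fplus p0 p2).

(** Exchanging p0 and p2 exchanges p1 and p3; null-set results about p1 thereby transfer to p3. *)
Lemma p3of_hres p0 p2 : p3of p0 p2 = hres p2 p0.
Proof. by rewrite /p3of /hres distrC (addrC p2 p0); field. Qed.

Lemma omega_ge0 p : 0 <= omega p. Proof. exact: normr_ge0. Qed.

Lemma omega_period p : 0 <= p <= 2 * pi -> omega p = sin (p / 2).
Proof.
move=> hp; rewrite /omega ger0_norm// sin_ge0_pi//.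
move: hp; move: (pi : R) => P; lra.
Qed.

Lemma omega_sum p0 p2 : 0 <= p0 <= 2 * pi -> 0 <= p2 <= 2 * pi ->
  let s := sin ((p2 - p0) / 4) in let c := cos ((p2 - p0) / 4) in
  let S := sin ((p2 + p0) / 4) in let C := cos ((p2 + p0) / 4) in
  [/\ omega p0 = S * c - C * s, omega p2 = S * c + C * s, 0 <= c & 0 <= S] /\
  s ^+ 2 + c ^+ 2 = 1 /\ S ^+ 2 + C ^+ 2 = 1.
Proof.
move=> h0 h2 s c S C.
split; last by split; rewrite addrC cos2Dsin2.
split.
- by rewrite omega_period// -sinB; congr sin; field.
- by rewrite omega_period// -sinD; congr sin; field.
- by apply: cos_ge0_pihalf; move: h0 h2; move: (pi : R) => P; lra.
- by apply: sin_ge0_pi; move: h0 h2; move: (pi : R) => P; lra.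
Qed.

(** Degenerate case |p2 - p0| = 2 pi, where the tangent in [hres] divides by zero. The frequencies
    are then -C s and C s, both nonnegative, hence zero, and the kernel vanishes. *)
Lemma omega_cos0 p0 p2 : 0 <= p0 <= 2 * pi -> 0 <= p2 <= 2 * pi ->
  cos ((p2 - p0) / 4) = 0 -> omega p0 = 0.
Proof.
move=> h0 h2 c0; have [[e0 e2 _ _] _] := omega_sum h0 h2.
move: (omega_ge0 p0) (omega_ge0 p2); rewrite e0 e2 c0; lra.
Qed.

(** The half momenta are p1 / 2 = D + asin u and p3 / 2 = asin u - D with D = (p2 - p0) / 4, so
    addition formulas give everything once |u| <= 1. That bound follows from c^2 - C^2 = w0 w2 >=
    0. *)
Lemma resonance p0 p2 : 0 <= p0 <= 2 * pi -> 0 <= p2 <= 2 * pi ->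
  cos ((p2 - p0) / 4) != 0 ->
  let s := sin ((p2 - p0) / 4) in let c := cos ((p2 - p0) / 4) in
  let S := sin ((p2 + p0) / 4) in let C := cos ((p2 + p0) / 4) in
  let u := tan (`|p2 - p0| / 4) * C in let e := Num.sqrt (1 - u ^+ 2) in
  [/\ 0 < c, u ^+ 2 * c ^+ 2 = s ^+ 2 * C ^+ 2, -1 <= u <= 1,
      e ^+ 2 = 1 - u ^+ 2 & C ^+ 2 <= c ^+ 2] /\
  [/\ omega (hres p0 p2) = `|s * e + c * u|,
      omega (p3of p0 p2) = `|c * u - s * e|,
      Num.sqrt (Fplus p0 p2) = 2 * c * e,
      cos (hres p0 p2 / 2) = c * e - s * u &
      cos (p3of p0 p2 / 2) = c * e + s * u].
Proof.
move=> h0 h2 cN0 s c S C u e.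
have [[e0 e2 c_ge0 S0] [hsc hSC]] := omega_sum h0 h2.
rewrite -/s -/c -/S -/C in e0 e2 c_ge0 S0 hsc hSC.
have c0 : 0 < c by rewrite lt_neqAle eq_sym cN0.
have w0 := omega_ge0 p0; have w2 := omega_ge0 p2; rewrite e0 in w0; rewrite e2 in w2.
have huc : u ^+ 2 * c ^+ 2 = s ^+ 2 * C ^+ 2.
  have -> : u = `|s| / c * C.
    rewrite /u /tan; congr (_ / _ * _).
      rewrite /s; have [h|h] := leP p0 p2.
        rewrite ger0_norm ?subr_ge0// ger0_norm// sin_ge0_pi//.
        by move: h0 h2 h; move: (pi : R) => P; lra.
      rewrite ltr0_norm ?subr_lt0// mulNr sinN ler0_norm// -oppr_ge0 -sinN sin_ge0_pi//.
      by move: h0 h2 h; move: (pi : R) => P; lra.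
    rewrite /c -[in RHS]cos_norm normrM; congr (cos (_ * _)).
    by rewrite gtr0_norm.
  rewrite !exprMn -normrX ger0_norm ?sqr_ge0// exprVn [LHS]mulrAC mulfVK//.
  by rewrite expf_neq0.
have hCc : C ^+ 2 <= c ^+ 2.
  rewrite -subr_ge0; have -> : c ^+ 2 - C ^+ 2 = (S * c - C * s) * (S * c + C * s); last exact: mulr_ge0.
  apply: esym.
  transitivity (c ^+ 2 * (S ^+ 2 + C ^+ 2) - C ^+ 2 * (s ^+ 2 + c ^+ 2)); first by ring.
  by rewrite hSC hsc !mulr1.
have us : u ^+ 2 <= s ^+ 2 by exact: (res_u_le_s c0 huc hCc).
have u2 : u ^+ 2 <= 1 by move: us hsc (sqr_ge0 c); lra.
have u1 : -1 <= u <= 1 by rewrite -ler_norml -(@ler_sqr _ _ 1) ?nnegrE// -normrX ger0_norm ?sqr_ge0// expr1n.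
have he : e ^+ 2 = 1 - u ^+ 2 by rewrite sqr_sqrtr// subr_ge0.
have su : sin (asin u) = u by rewrite asinK.
have cu : cos (asin u) = e by rewrite cos_asin.
have h1 : hres p0 p2 / 2 = (p2 - p0) / 4 + asin u.
  by rewrite /hres -/C -/u; field.
have h3 : p3of p0 p2 / 2 = asin u - (p2 - p0) / 4.
  by rewrite /p3of /hres -/C -/u; field.
split; first by [].
split.
- by rewrite /omega h1 sinD su cu.
- by rewrite /omega h3 sinB su cu (mulrC u) (mulrC e).
- have -> : Fplus p0 p2 = (2 * c * e) ^+ 2.
    rewrite [RHS]exprMn he.
    have -> : (2 * c) ^+ 2 * (1 - u ^+ 2) = 4 * c ^+ 2 - 4 * (u ^+ 2 * c ^+ 2) by ring.
    rewrite huc /Fplus.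
    have -> : sin (p0 / 2) = S * c - C * s by rewrite -e0 omega_period.
    have -> : sin (p2 / 2) = S * c + C * s by rewrite -e2 omega_period.
    have -> : cos (p0 / 2) = C * c + S * s.
      by rewrite -cosB; congr cos; field.
    have -> : cos (p2 / 2) = C * c - S * s.
      by rewrite -cosD; congr cos; field.
    transitivity (4 * c ^+ 2 * (S ^+ 2 + C ^+ 2) - 4 * (s ^+ 2 * C ^+ 2)); first by ring.
    by rewrite hSC mulr1.
  by rewrite sqrtr_sqr ger0_norm// !mulr_ge0 ?sqrtr_ge0.
- by rewrite h1 cosD su cu.
- by rewrite h3 cosB su cu (mulrC u) (mulrC e).
Qed.

End resonance.

(** * Weighted bounds on the kernel and Lipschitz estimate of the collision integrand *)

Section kernel_bounds.
Context {R : realType} (alpha : R).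
Hypothesis alpha1 : alpha <= 1.
Implicit Types (p : R).

(* omega^-alpha with the value 0 at omega = 0: membership in L^oo(omega^alpha)
   reads |f| <= M wt, and the kernel bounds below hold without exceptional set. *)
Definition wt p : R := if omega p == 0 then 0 else omega p `^ (- alpha).

Lemma wt_ge0 p : 0 <= wt p.
Proof. by rewrite /wt; case: ifP => // _; exact: powR_ge0. Qed.

(** The first summand comes from the term f1 f2 f3 ([kern_ineq0]), the second from the three terms
    containing f0 ([kern_ineq1]). *)
Definition kconst : R := 2 * 4 `^ (1 - alpha) + 2.

Lemma kconst_gt0 : 0 < kconst.
Proof. by rewrite /kconst; have := powR_ge0 4 (1 - alpha); lra. Qed.

Section ineq.
Variables (w0 w1 w2 w3 F : R).
Hypotheses (h0 : 0 < w0) (h1 : 0 < w1) (h2 : 0 < w2) (h3 : 0 < w3) (F0 : 0 < F).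
Let p w := w `^ (- alpha).

Let powE w : 0 < w -> w * p w = w `^ (1 - alpha).
Proof.
move=> w_gt0; rewrite powRD ?powRr1 ?(ltW w_gt0)//.
by rewrite (gt_eqF w_gt0) implybT.
Qed.

(** The left side is (w0 / F) (w1 w2 w3)^(1 - alpha), at most (w0 / F) (4 w0)^(1 - alpha).
    Extracting w0 from w0^(1 - alpha) leaves w0^2 / F <= 2. *)
Lemma kern_ineq0 : w1 * w2 * w3 <= 4 * w0 -> w0 ^+ 2 <= 2 * F ->
  w0 * w1 * w2 * w3 / F * p w1 * p w2 * p w3 <= kconst * p w0.
Proof.
move=> hw hF.
have -> : w0 * w1 * w2 * w3 / F * p w1 * p w2 * p w3 =
   w0 / F * ((w1 * p w1) * (w2 * p w2) * (w3 * p w3)) by ring.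
rewrite !powE// -!powRM ?mulr_ge0 ?(ltW h1) ?(ltW h2) ?(ltW h3)//.
have k1 : (w1 * w2 * w3) `^ (1 - alpha) <= 4 `^ (1 - alpha) * w0 `^ (1 - alpha).
  rewrite -powRM ?(ltW h0)//; apply: ge0_ler_powR; rewrite ?nnegrE ?subr_ge0//.
  - by rewrite !mulr_ge0 ?ltW.
  - by rewrite mulr_ge0 ?ltW.
have k2 : w0 / F * (w1 * w2 * w3) `^ (1 - alpha) <= w0 / F * (4 `^ (1 - alpha) * w0 `^ (1 - alpha)).
  by rewrite ler_wpM2l// divr_ge0// ltW.
apply: (le_trans k2).
rewrite -(powE h0).
have -> : w0 / F * (4 `^ (1 - alpha) * (w0 * p w0)) = (w0 ^+ 2 / F * 4 `^ (1 - alpha)) * p w0 by ring.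
apply: ler_wpM2r; first exact: powR_ge0.
have : w0 ^+ 2 / F * 4 `^ (1 - alpha) <= 2 * 4 `^ (1 - alpha).
  by apply: ler_wpM2r; [exact: powR_ge0|rewrite ler_pdivrMr].
by rewrite /kconst; lra.
Qed.

(** For the terms containing f0: [w1] is the frequency of the momentum missing from the product, x
    and y are the other two. The weight at [w0] is kept aside, and (x y)^(1 - alpha) <= 1. *)
Lemma kern_ineq1 (x y : R) : 0 < x -> x <= 1 -> 0 < y -> y <= 1 -> w0 * w1 <= 2 * F ->
  w0 * w1 * x * y / F * p w0 * p x * p y <= kconst * p w0.
Proof.
move=> x0 x1 y0 y1 hF.
have -> : w0 * w1 * x * y / F * p w0 * p x * p y =
   w0 * w1 / F * ((x * p x) * (y * p y)) * p w0 by ring.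
apply: ler_wpM2r; first exact: powR_ge0.
rewrite !powE// -powRM ?(ltW x0) ?(ltW y0)//.
have k1 : (x * y) `^ (1 - alpha) <= 1.
  have E1 : 1 `^ (1 - alpha) = 1 :> R by rewrite powR1.
  rewrite -[leRHS]E1; apply: ge0_ler_powR; rewrite ?nnegrE ?subr_ge0//.
  - by rewrite mulr_ge0 ?ltW.
  - by rewrite mulr_ile1 ?(ltW x0) ?(ltW y0).
have k2 : w0 * w1 / F <= 2 by rewrite ler_pdivrMr.
have k3 : w0 * w1 / F * (x * y) `^ (1 - alpha) <= 2 * 1.
  by apply: ler_pM => //; [rewrite divr_ge0// ?mulr_ge0 ?ltW|exact: powR_ge0].
by rewrite /kconst; have := powR_ge0 4 (1 - alpha); lra.
Qed.

End ineq.

Lemma kern_ge0 p0 p2 : 0 <= kern p0 p2.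
Proof. by rewrite divr_ge0 ?sqrtr_ge0// !mulr_ge0 ?omega_ge0. Qed.

Lemma omega_le1 p : omega p <= 1. Proof. exact: sin_max. Qed.

Lemma kern_bounds p0 p2 : 0 <= p0 <= 2 * pi -> 0 <= p2 <= 2 * pi ->
  [/\ kern p0 p2 * wt (hres p0 p2) * wt p2 * wt (p3of p0 p2) <= kconst * wt p0,
      kern p0 p2 * wt p0 * wt p2 * wt (p3of p0 p2) <= kconst * wt p0,
      kern p0 p2 * wt p0 * wt (hres p0 p2) * wt (p3of p0 p2) <= kconst * wt p0 &
      kern p0 p2 * wt p0 * wt (hres p0 p2) * wt p2 <= kconst * wt p0].
Proof.
move=> h0 h2.
have rhs0 : 0 <= kconst * wt p0 by rewrite mulr_ge0 ?wt_ge0 ?(ltW kconst_gt0).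
have [k0|kN0] := eqVneq (kern p0 p2) 0; first by rewrite k0 !mul0r.
have cN0 : cos ((p2 - p0) / 4) != 0.
  apply/eqP => /(omega_cos0 h0 h2) o0; move: kN0.
  by rewrite /kern o0 !mul0r eqxx.
have [[c0 huc u1 he hCc] [e1 e3 eF _ _]] := resonance h0 h2 cN0.
have [[e0 e2 _ S0] [hsc hSC]] := omega_sum h0 h2.
have w0 := omega_ge0 p0; have w2 := omega_ge0 p2; rewrite e0 in w0; rewrite e2 in w2.
have e_ge0 := sqrtr_ge0 (1 - (tan (`|p2 - p0| / 4) * cos ((p2 + p0) / 4)) ^+ 2).
have B1 := res_w0_sqr hsc hSC c0 S0 huc e_ge0 he hCc w0 w2.
have B2 := res_w0w2 hsc hSC c0 huc e_ge0 he.
have B3 := res_w0wi hsc hSC c0 S0 huc e_ge0 he hCc w0 w2.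
have B4 := res_w1w2w3 hsc hSC c0 S0 huc he hCc w0 w2.
have B5 := B3 _ (or_intror erefl). have B6 := B3 _ (or_introl erefl).
move: B1 B2 B4 B5 B6 => {B3}; rewrite -e1 -e3 -eF -e0 -e2 => B1 B2 B4 B5 B6.
move: kN0; rewrite /kern /wt !mulf_eq0 !negb_or invr_eq0 => /andP[/andP[/andP[/andP[n0 n1] n2] n3] nF].
have pos (x : R) : x != 0 -> 0 <= x -> 0 < x by move=> a b; rewrite lt_neqAle eq_sym a.
rewrite (negbTE n0) (negbTE n1) (negbTE n2) (negbTE n3).
have {}n0 := pos _ n0 (omega_ge0 _); have {}n1 := pos _ n1 (omega_ge0 _).
have {}n2 := pos _ n2 (omega_ge0 _); have {}n3 := pos _ n3 (omega_ge0 _).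
have {}nF := pos _ nF (sqrtr_ge0 _).
split.
- exact: kern_ineq0.
- have := kern_ineq1 n0 n1 nF n2 (omega_le1 _) n3 (omega_le1 _).
  by apply; rewrite // eF in B6 *.
- have := kern_ineq1 n0 n2 nF n1 (omega_le1 _) n3 (omega_le1 _).
  rewrite (mulrAC (omega p0) (omega p2)); apply.
  by move: B2 nF; move: (Num.sqrt _) => ?; lra.
- have := kern_ineq1 n0 n3 nF n1 (omega_le1 _) n2 (omega_le1 _).
  have -> : omega p0 * omega (p3of p0 p2) * omega (hres p0 p2) * omega p2 =
    omega p0 * omega (hres p0 p2) * omega p2 * omega (p3of p0 p2) by ring.
  by apply.
Qed.

Definition cint (g : R -> R) p0 p2 : R :=
  kern p0 p2 *
  (g (hres p0 p2) * g p2 * g (p3of p0 p2) + g p0 * g p2 * g (p3of p0 p2)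
   - g p0 * g (hres p0 p2) * g (p3of p0 p2) - g p0 * g (hres p0 p2) * g p2).

Lemma collisionE g p0 :
  collision g p0 = \int[lebesgue_measure]_(p2 in `[0, 2 * pi]) cint g p0 p2.
Proof. by []. Qed.

Lemma prod3_diff (k M d x y z x' y' z' X Y Z : R) : 0 <= k -> 0 <= M -> 0 <= d ->
  0 <= X -> 0 <= Y -> 0 <= Z ->
  `|y| <= M * Y -> `|z| <= M * Z -> `|x'| <= M * X -> `|y'| <= M * Y ->
  `|x - x'| <= d * X -> `|y - y'| <= d * Y -> `|z - z'| <= d * Z ->
  `|k * (x * y * z) - k * (x' * y' * z')| <= 3 * M ^+ 2 * d * (k * X * Y * Z).
Proof.
move=> k0 M0 d0 X0 Y0 Z0 hy hz hx' hy' dx dy dz.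
have -> : k * (x * y * z) - k * (x' * y' * z') =
  k * ((x - x') * y * z) + k * (x' * (y - y') * z) + k * (x' * y' * (z - z')) by ring.
have t3 a b c A B C m n q : 0 <= A -> 0 <= B -> 0 <= C ->
    `|a| <= m * A -> `|b| <= n * B -> `|c| <= q * C ->
    `|k * (a * b * c)| <= m * n * q * (k * A * B * C).
  move=> A0 B0 C0 ha hb hc.
  rewrite !normrM (ger0_norm k0).
  have -> : m * n * q * (k * A * B * C) = k * ((m * A) * (n * B) * (q * C)) by ring.
  by apply: ler_wpM2l => //; do 2 apply: ler_pM => //; rewrite mulr_ge0.
have t1 := t3 _ _ _ _ _ _ _ _ _ X0 Y0 Z0 dx hy hz.
have t2 := t3 _ _ _ _ _ _ _ _ _ X0 Y0 Z0 hx' dy hz.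
have t4 := t3 _ _ _ _ _ _ _ _ _ X0 Y0 Z0 hx' hy' dz.
apply: (le_trans (ler_normD _ _)); apply: (le_trans (lerD (ler_normD _ _) (lexx _))).
apply: (le_trans (lerD (lerD t1 t2) t4)).
by rewrite -!mulrDl; apply: ler_wpM2r; [rewrite !mulr_ge0|lra].
Qed.

(** The factor 12 counts four cubic terms, each contributing 3 by telescoping. *)
Lemma cint_diff (g g' : R -> R) (M d p0 p2 : R) : 0 <= M -> 0 <= d ->
  0 <= p0 <= 2 * pi -> 0 <= p2 <= 2 * pi ->
  (forall q, q \in [:: p0; hres p0 p2; p2; p3of p0 p2] ->
     [/\ `|g q| <= M * wt q, `|g' q| <= M * wt q & `|g q - g' q| <= d * wt q]) ->
  `|cint g p0 p2 - cint g' p0 p2| <= 12 * kconst * M ^+ 2 * d * wt p0.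
Proof.
move=> M0 d0 h0 h2 hg.
move: (hg p0) (hg (hres p0 p2)) (hg p2) (hg (p3of p0 p2)).
rewrite !inE !eqxx !orbT => /(_ isT)[a0 b0 c0] /(_ isT)[a1 b1 c1] /(_ isT)[a2 b2 c2] /(_ isT)[a3 b3 c3].
have [k1 k2 k3 k4] := kern_bounds h0 h2.
have K0 := kern_ge0 p0 p2.
have W := wt_ge0.
have t1 := prod3_diff K0 M0 d0 (W _) (W _) (W _) a2 a3 b1 b2 c1 c2 c3.
have t2 := prod3_diff K0 M0 d0 (W _) (W _) (W _) a2 a3 b0 b2 c0 c2 c3.
have t3 := prod3_diff K0 M0 d0 (W _) (W _) (W _) a1 a3 b0 b1 c0 c1 c3.
have t4 := prod3_diff K0 M0 d0 (W _) (W _) (W _) a1 a2 b0 b1 c0 c1 c2.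
have H x : 0 <= x -> x <= kconst * wt p0 -> 3 * M ^+ 2 * d * x <= 3 * M ^+ 2 * d * (kconst * wt p0).
  by move=> _ ?; apply: ler_wpM2l => //; rewrite !mulr_ge0// exprn_ge0.
have {k1}t1 := le_trans t1 (ler_wpM2l _ k1).
have {k2}t2 := le_trans t2 (ler_wpM2l _ k2).
have {k3}t3 := le_trans t3 (ler_wpM2l _ k3).
have {k4}t4 := le_trans t4 (ler_wpM2l _ k4).
have C0 : 0 <= 3 * M ^+ 2 * d by rewrite !mulr_ge0.
move: (t1 C0) (t2 C0) (t3 C0) (t4 C0) => {}t1 {}t2 {}t3 {}t4.
clear H; move: kconst t1 t2 t3 t4 => K t1 t2 t3 t4.
rewrite /cint ![kern _ _ * (_ + _)]mulrDr !mulrN.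
set A1 := kern _ _ * _ in t1 *. set A2 := kern _ _ * _ in t1 *.
set B1 := kern _ _ * _ in t2 *. set B2 := kern _ _ * _ in t2 *.
set D1 := kern _ _ * _ in t3 *. set D2 := kern _ _ * _ in t3 *.
set E1 := kern _ _ * _ in t4 *. set E2 := kern _ _ * _ in t4 *.
have -> : A1 + B1 - D1 - E1 - (A2 + B2 - D2 - E2) =
   (A1 - A2) + (B1 - B2) - (D1 - D2) - (E1 - E2) by ring.
apply: (le_trans (ler_normB _ _)); apply: (le_trans (lerD (ler_normB _ _) (lexx _))).
apply: (le_trans (lerD (lerD (ler_normD _ _) (lexx _)) (lexx _))).
apply: (le_trans (lerD (lerD (lerD t1 t2) t3) t4)).
by rewrite le_eqVlt; apply/orP; left; apply/eqP; ring.
Qed.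

End kernel_bounds.

(** * Measurability of the resonance map, the kernel and the collision integrand *)

Section measurability.
Context {R : realType} d (T : measurableType d).
Implicit Types (f g : T -> R).

Lemma measurable_fun_comp (h : R -> R) f : measurable_fun setT h ->
  measurable_fun setT f -> measurable_fun setT (fun x => h (f x)).
Proof. exact: measurableT_comp. Qed.

Lemma measurable_fun_norm f : measurable_fun setT f ->
  measurable_fun setT (fun x => `|f x|).
Proof. by apply: measurable_fun_comp; exact: normr_measurable. Qed.

Lemma measurable_fun_powR f (a : R) : measurable_fun setT f ->
  measurable_fun setT (fun x => f x `^ a).
Proof. by apply: (@measurable_fun_comp (fun y => y `^ a)); exact: measurable_powR. Qed.

(** The identity 1/y = y (|y|^-1)^2 reduces the inverse to [powR]; at y = 0 both sides are 0. *)
Lemma measurable_fun_inv f : measurable_fun setT f ->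
  measurable_fun setT (fun x => (f x)^-1).
Proof.
move=> mf; rewrite (_ : (fun x => _) = (fun x => f x * (`|f x| `^ (-1)) ^+ 2)).
  apply: measurable_funM => //; apply: measurable_funX.
  by apply: measurable_fun_powR; exact: measurable_fun_norm.
apply/funext => x; have [->|h] := eqVneq (f x) 0; first by rewrite invr0 mul0r.
rewrite powR_inv1// exprVn -normrX ger0_norm ?sqr_ge0// expr2 invfM mulrA.
by rewrite divff// mul1r.
Qed.

Lemma measurable_fun_sin f : measurable_fun setT f -> measurable_fun setT (sin \o f).
Proof.
by move=> mf; apply: measurableT_comp mf; apply: continuous_measurable_fun; exact: continuous_sin.
Qed.

Lemma measurable_fun_cos f : measurable_fun setT f -> measurable_fun setT (cos \o f).
Proof.
by move=> mf; apply: measurableT_comp mf; apply: continuous_measurable_fun; exact: continuous_cos.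
Qed.

Lemma measurable_fun_sqrt f : measurable_fun setT f ->
  measurable_fun setT (fun x => Num.sqrt (f x)).
Proof.
by move=> mf; apply: (measurableT_comp _ mf); apply: continuous_measurable_fun; exact: sqrt_continuous.
Qed.

(** [asin] is a choice in a set of solutions that is empty outside [-1, 1], so it takes a single
    default value there, written [asin 2]. *)
Lemma asin_outside (x : R) : ~~ (-1 <= x <= 1) -> asin x = asin 2.
Proof.
move=> h; rewrite unlock.
have e (y : R) : ~~ (-1 <= y <= 1) -> [set z | - (pi / 2) <= z <= pi / 2 /\ sin z = y] = set0.
  move=> /negP hy; apply/seteqP; split => // z [_ sz]; apply: hy.
  by rewrite -sz -ler_norml sin_max.
by rewrite !e//; apply/negP; lra.
Qed.

Lemma asin_le (x y : R) : -1 <= x -> x <= y -> y <= 1 -> asin x <= asin y.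
Proof.
move=> x1 xy y1; have hx : -1 <= x <= 1 by lra.
have hy : -1 <= y <= 1 by lra.
rewrite leNgt; apply/negP => h.
have : sin (asin y) < sin (asin x).
  by rewrite ltr_sin// in_itv/= ?asin_geNpi2 ?asin_lepi2.
by rewrite !asinK//; lra.
Qed.

(** Composed with the clamping to [-1, 1], [asin] is nondecreasing; elsewhere it is constant. *)
Lemma measurable_asin : measurable_fun setT (@asin R).
Proof.
pose cl (x : R) := if x <= -1 then -1 else if x <= 1 then x else 1.
have cl1 x : -1 <= cl x <= 1 by rewrite /cl; case: (leP x (-1)) => ?; case: (leP x 1) => ? /=; lra.
have mcl : measurable_fun setT (fun x => asin (cl x)).
  apply: nondecreasing_measurable => // x y xy.
  apply: asin_le; have /andP[? ?] := cl1 x; have /andP[? ?] := cl1 y => //.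
  by rewrite /cl; case: (leP x (-1)) => ?; case: (leP x 1) => ?; case: (leP y (-1)) => ?; case: (leP y 1) => ? /=; lra.
rewrite (_ : @asin R = fun x => if (-1 <= x) && (x <= 1) then asin (cl x) else asin 2).
  apply: measurable_fun_ifT => //.
  by apply: measurable_and; apply: measurable_fun_ler.
apply/funext => x; case: ifPn => [/andP[x1 x2]|/asin_outside//].
by congr asin; rewrite /cl; case: (leP x (-1)) => ?; case: (leP x 1) => ? /=; lra.
Qed.

Lemma measurable_fun_asin f : measurable_fun setT f -> measurable_fun setT (asin \o f).
Proof. by move=> mf; apply: measurableT_comp mf; exact: measurable_asin. Qed.

Lemma measurable_fun_floor f : measurable_fun setT f ->
  measurable_fun setT (fun x => (Num.floor (f x))%:~R : R).
Proof.
move=> mf; apply: (measurable_fun_comp (h := fun y : R => (Num.floor y)%:~R)) => //.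
by apply: nondecreasing_measurable => // x y xy; rewrite ler_int le_floor.
Qed.

Lemma measurable_fun_divc f (c : R) : measurable_fun setT f ->
  measurable_fun setT (fun x => f x / c).
Proof. by move=> mf; apply: measurable_funM. Qed.

Lemma measurable_fun_omega f : measurable_fun setT f ->
  measurable_fun setT (fun x => omega (f x)).
Proof.
move=> mf; apply: measurable_fun_norm.
exact/measurable_fun_sin/measurable_fun_divc.
Qed.

Lemma measurable_fun_hres f g : measurable_fun setT f -> measurable_fun setT g ->
  measurable_fun setT (fun x => hres (f x) (g x)).
Proof.
move=> mf mg; apply: measurable_funD.
  exact/measurable_fun_divc/measurable_funB.
apply: measurable_funM => //; apply: measurable_fun_asin.
apply: measurable_funM.
  have mD : measurable_fun setT (fun x => `|g x - f x| / 4).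
    apply: measurable_fun_divc; apply: measurable_fun_norm.
    exact: measurable_funB.
  apply: measurable_funM; first exact: measurable_fun_sin.
  by apply: measurable_fun_inv; exact: measurable_fun_cos.
by apply: measurable_fun_cos; apply: measurable_fun_divc; exact: measurable_funD.
Qed.

Lemma measurable_fun_p3of f g : measurable_fun setT f -> measurable_fun setT g ->
  measurable_fun setT (fun x => p3of (f x) (g x)).
Proof.
move=> mf mg; apply: measurable_funB => //; apply: measurable_funD => //.
exact: measurable_fun_hres.
Qed.

Lemma measurable_fun_kern f g : measurable_fun setT f -> measurable_fun setT g ->
  measurable_fun setT (fun x => kern (f x) (g x)).
Proof.
move=> mf mg; apply: measurable_funM.
  repeat apply: measurable_funM; apply: measurable_fun_omega => //.
    exact: measurable_fun_hres.
  exact: measurable_fun_p3of.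
apply: measurable_fun_inv; apply: measurable_fun_sqrt; apply: measurable_funD.
  by apply: measurable_funX; apply: measurable_funD; apply: measurable_fun_cos; exact: measurable_fun_divc.
by apply: measurable_funM; [apply: measurable_funM => //|]; apply: measurable_fun_sin; exact: measurable_fun_divc.
Qed.

Lemma measurable_fun_wt alpha f : measurable_fun setT f ->
  measurable_fun setT (fun x => wt alpha (f x)).
Proof.
move=> mf; have mo := measurable_fun_omega mf.
apply: measurable_fun_ifT => //; first exact: measurable_fun_eqr.
exact: measurable_fun_powR.
Qed.

Lemma measurable_fun_cint (G : T * R -> R) f g :
  measurable_fun setT G -> measurable_fun setT f -> measurable_fun setT g ->
  measurable_fun setT (fun x => cint (fun q => G (x, q)) (f x) (g x)).
Proof.
move=> mG mf mg.
have mGc h : measurable_fun setT h -> measurable_fun setT (fun x => G (x, h x)).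
  by move=> mh; apply: (measurableT_comp mG); exact: measurable_fun_pair.
have m0 := mGc _ mf; have m2 := mGc _ mg.
have m1 := mGc _ (measurable_fun_hres mf mg); have m3 := mGc _ (measurable_fun_p3of mf mg).
apply: measurable_funM; first exact: measurable_fun_kern.
by repeat (first [apply: measurable_funB|apply: measurable_funD|apply: measurable_funM]).
Qed.

End measurability.

(** * Reduction modulo 2 pi and group velocity *)

Section torus.
Context {R : realType}.
Implicit Types (p : R).

Definition red p : R := p - 2 * pi * (Num.floor (p / (2 * pi)))%:~R.

Lemma pi2_gt0 : 0 < 2 * pi :> R. Proof. by rewrite mulr_gt0// pi_gt0. Qed.

Lemma red_itv p : 0 <= red p < 2 * pi.
Proof.
have P := pi2_gt0; rewrite /red subr_ge0 ltrBlDl; apply/andP; split.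
  by rewrite mulrC -ler_pdivlMr// Num.Theory.floor_le.
rewrite -[X in _ < _ + X]mulr1 -mulrDr mulrC -ltr_pdivrMr//.
by have := floorD1_gt (p / (2 * pi)); rewrite intrD.
Qed.

Lemma red_id p : 0 <= p < 2 * pi -> red p = p.
Proof.
move=> /andP[p0 p1]; have P := pi2_gt0; rewrite /red.
suff -> : Num.floor (p / (2 * pi)) = 0 by rewrite mulr0 subr0.
by apply: floor_def; rewrite add0r divr_ge0//= ?ltr_pdivrMr ?mul1r// ltW.
Qed.

Lemma red_period p : red (p + 2 * pi) = red p.
Proof.
have P := pi2_gt0; rewrite /red [(p + 2 * pi) / _]mulrDl [2 * pi / _]divff ?gt_eqF//.
by rewrite floorDrz ?rpred1// floor1 intrD; ring.
Qed.

Lemma periodic_int (f : R -> R) (n : int) p : (forall q, f (q + 2 * pi) = f q) ->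
  f (p + 2 * pi * n%:~R) = f p.
Proof.
move=> hf.
have hn (m : nat) q : f (q + 2 * pi * m%:R) = f q.
  elim: m => [|m IH]; first by rewrite mulr0 addr0.
  by rewrite [m.+1%:R]mulrSr (mulrDr (2 * pi)) mulr1 addrA hf IH.
case: n => n; first exact: hn.
by rewrite -(hn n.+1 (p + _)) NegzE mulrNz -pmulrn; congr f; ring.
Qed.

Lemma periodic_red (f : R -> R) p : (forall q, f (q + 2 * pi) = f q) ->
  f (red p) = f p.
Proof.
by move=> hf; rewrite /red -mulrN -mulrNz periodic_int.
Qed.

Lemma omega_periodic p : omega (p + 2 * pi) = omega p.
Proof.
rewrite /omega (_ : (p + 2 * pi) / 2 = p / 2 + pi); last by field.
by rewrite sinDpi normrN.
Qed.

Lemma omega_red p : omega (red p) = omega p.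
Proof. exact/periodic_red/omega_periodic. Qed.

Lemma wt_periodic alpha p : wt alpha (p + 2 * pi) = wt alpha p.
Proof. by rewrite /wt omega_periodic. Qed.

Lemma wt_red alpha p : wt alpha (red p) = wt alpha p.
Proof. by rewrite /wt omega_red. Qed.

Lemma measurable_fun_red d (T : measurableType d) (f : T -> R) :
  measurable_fun setT f -> measurable_fun setT (fun x => red (f x)).
Proof.
move=> mf; apply: measurable_funB => //; apply: measurable_funM => //.
exact/measurable_fun_floor/measurable_fun_divc.
Qed.

(* [velocity] has a junk value on 2piZ; [vel] agrees with it elsewhere. *)
Definition vel p : R := cos (red p / 2) / 2.

Lemma vel_le1 p : `|vel p| <= 1.
Proof.
rewrite /vel normrM normfV (@ger0_norm _ 2)//; have := cos_max (red p / 2).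
by lra.
Qed.

Lemma measurable_fun_vel d (T : measurableType d) (f : T -> R) :
  measurable_fun setT f -> measurable_fun setT (fun x => vel (f x)).
Proof.
move=> mf; apply: measurable_fun_divc; apply: measurable_fun_cos.
exact/measurable_fun_divc/measurable_fun_red.
Qed.

Lemma velocity_vel p : 0 < p < 2 * pi -> velocity p = vel p.
Proof.
move=> hp; rewrite /vel red_id; last by case/andP: hp => /ltW -> ->.
rewrite /velocity derive1E (@near_eq_derive _ _ _ _ (fun q : R => sin (q / 2))).
  have dd : is_derive p 1 (fun q : R => sin (q / 2)) (cos (p / 2) / 2).
    by apply: is_derive_eq; rewrite /GRing.scale/=; ring.
  by rewrite derive_val.
have : \forall x \near p, x \in `]0, 2 * pi[ by exact: near_in_itvoo.
apply: filterS => x; rewrite in_itv/= => /andP[x0 x1].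
by rewrite omega_period// (ltW x0) (ltW x1).
Qed.

End torus.

(** * Resonances involving a slow momentum have small measure, uniformly in p0 *)

Section slow_set.
Context {R : realType}.
Implicit Types (A B e x y b p q : R).
Local Notation mu := (@lebesgue_measure R).

(** Monotonicity is that of the outer measure, since the lemma is applied to sets whose
    measurability is unknown. *)
Lemma lebesgue_diam (S : set R) e : 0 <= e ->
  (forall x y, S x -> S y -> `|x - y| <= e) -> (mu S <= (2 * e)%:E)%E.
Proof.
move=> e0 hS; have [->|/set0P[x Sx]] := eqVneq S set0.
  by rewrite measure0 lee_fin mulr_ge0.
have sub : S `<=` `[x - e, x + e]%classic.
  by move=> y Sy; have := hS _ _ Sx Sy; rewrite /= in_itv/= ler_norml; lra.
pose I : set R := `[x - e, x + e]%classic.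
have h : (mu S <= mu I)%E by exact: le_outer_measure.
apply: (le_trans h).
rewrite lebesgue_measure_itv/= lte_fin; case: ifP => _; last by rewrite lee_fin mulr_ge0.
by rewrite -EFinD lee_fin; lra.
Qed.

(** Amplitude and phase, which turn B cos + C sin into r cos(. - t). *)
Lemma polar x y : exists r t, [/\ 0 <= r, r ^+ 2 = x ^+ 2 + y ^+ 2, - pi <= t <= pi,
  x = r * cos t & y = r * sin t].
Proof.
pose r := Num.sqrt (x ^+ 2 + y ^+ 2).
have s0 : 0 <= x ^+ 2 + y ^+ 2 by rewrite addr_ge0// sqr_ge0.
have r2 : r ^+ 2 = x ^+ 2 + y ^+ 2 by rewrite sqr_sqrtr.
have r0 : 0 <= r by exact: sqrtr_ge0.
have P : 0 < pi :> R by exact: pi_gt0.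
have [re|rn] := eqVneq r 0.
  exists 0, 0; move: r2; rewrite re expr0n/= => /esym/eqP.
  rewrite paddr_eq0 ?sqr_ge0// !sqrf_eq0 => /andP[/eqP-> /eqP->].
  by split => //; rewrite ?mul0r// ?expr0n/= ?addr0// oppr_le0 !ltW.
have rp : 0 < r by rewrite lt_neqAle eq_sym rn.
have xr : -1 <= x / r <= 1.
  rewrite -ler_norml normrM normfV (gtr0_norm rp) ler_pdivrMr// mul1r.
  rewrite -(@ler_sqr _ _ r) ?nnegrE// -normrX ger0_norm ?sqr_ge0// r2.
  by have := sqr_ge0 y; lra.
have t0 := acos_ge0 xr; have t1 := acos_lepi xr; have ct := acosK (xr : (x / r) \in `[(-1), 1]).
have st : r * sin (acos (x / r)) = `|y|.
  have E z : r * z = Num.sqrt (r ^+ 2) * z by rewrite sqrtr_sqr ger0_norm.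
  rewrite sin_acos// E -sqrtrM ?sqr_ge0// -[RHS]sqrtr_sqr; congr Num.sqrt.
  rewrite mulrBr mulr1 expr_div_n mulrCA divff ?expf_neq0// mulr1 r2.
  by rewrite addrAC subrr add0r.
have [y0|y0] := leP 0 y.
  exists r, (acos (x / r)); split => //.
  - by rewrite t1 andbT (le_trans _ t0)// oppr_le0 ltW.
  - by rewrite ct mulrCA divff// mulr1.
  - by rewrite st ger0_norm.
exists r, (- acos (x / r)); split => //.
- by rewrite lerN2 t1 (le_trans _ (ltW P))// oppr_le0.
- by rewrite cosN ct mulrCA divff// mulr1.
- by rewrite sinN mulrN st ltr0_norm// opprK.
Qed.

Lemma abs_sin_shift (k : int) x : `|sin (x + k%:~R * pi)| = `|sin x|.
Proof.
have hn (m : nat) z : `|sin (z + m%:R * pi)| = `|sin z|.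
  elim: m => [|m IH]; first by rewrite mul0r addr0.
  by rewrite -natr1 mulrDl mul1r addrA sinDpi normrN IH.
case: k => n; first exact: hn.
by rewrite NegzE -[in RHS](subrK (n.+1%:R * pi) x) hn mulrNz mulNr.
Qed.

(** With D the half difference and m the half sum shifted by -k pi, |cos x - cos y| = 2 sin m sin D.
    As x and y lie on one branch, m is at distance at least D from 0 and pi, so sin m >= sin D; D >
    e would give at least 2 sin(e)^2. *)
Lemma cos_branch (k : int) e x y : 0 < e -> e < pi / 2 ->
  k%:~R * pi <= x <= (k%:~R + 1) * pi -> k%:~R * pi <= y <= (k%:~R + 1) * pi ->
  `|cos x - cos y| < 2 * sin e ^+ 2 -> `|x - y| <= 2 * e.
Proof.
move=> e0 e1.
wlog xy : x y / y <= x.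
  move=> H hx hy; have [/H|/ltW/H] := leP y x; first exact.
  by rewrite distrC (distrC x); apply.
move=> hx hy hc; rewrite ger0_norm ?subr_ge0// leNgt; apply/negP => h.
have P : 0 < pi :> R by exact: pi_gt0.
pose D := (x - y) / 2; pose m := (x + y) / 2 - k%:~R * pi.
have cE : `|cos x - cos y| = 2 * `|sin m| * `|sin D|.
  have Ex : x = (x + y) / 2 + D by rewrite /D; field.
  have Ey : y = (x + y) / 2 - D by rewrite /D; field.
  rewrite [X in cos X - _]Ex [X in _ - cos X]Ey.
  rewrite cosD cosB.
  have -> (a b : R) : a - b - (a + b) = - (2 * b) by ring.
  rewrite normrN !normrM mulrA (ger0_norm (_ : 0 <= 2))//.
  by rewrite -[in LHS](subrK (k%:~R * pi) ((x + y) / 2)) abs_sin_shift.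
rewrite mulrDl mul1r in hx hy; move: hx hy h.
have -> : x = D + m + k%:~R * pi by rewrite /D /m; field.
have -> : y = m - D + k%:~R * pi by rewrite /D /m; field.
move: (k%:~R * pi) => K hx hy h.
have D0 : e < D by move: h; lra.
have mD : D <= m <= pi - D by move: (pi : R) P hx hy {e1} => Q; lra.
have D2 : D <= pi / 2 by move: (pi : R) mD {hx hy P e1} => Q; lra.
have sD : sin e <= sin D.
  have /ltW// : sin e < sin D.
  rewrite ltr_sin// in_itv/=; move: (pi : R) P e1 D2 e0 D0 {hx hy mD} => Q; lra.
have se : 0 <= sin e by apply: sin_ge0_pi; move: (pi : R) P e1 e0 {hx hy mD D2} => Q; lra.
have sm : sin D <= sin m.
  have [m2|m2] := leP m (pi / 2).
    have [->//|Dm] := eqVneq D m; apply: ltW.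
    have Dlt : D < m by rewrite lt_neqAle Dm; case/andP: mD.
    rewrite ltr_sin// in_itv/=; move: (pi : R) P e0 D0 D2 mD m2 {hx hy e1} => Q; lra.
  rewrite -[sin m](_ : sin (pi - m) = _); last by rewrite sinB sinpi cospi; ring.
  have [->//|Dm] := eqVneq D (pi - m); apply: ltW.
  have Dlt : D < pi - m by rewrite lt_neqAle Dm; move: mD; move: (pi : R) => Q; lra.
  rewrite ltr_sin// in_itv/=; move: (pi : R) P e0 D0 D2 mD m2 {hx hy e1 Dm Dlt} => Q; lra.
move: hc; rewrite cE ltNge => /negP; apply.
rewrite -mulrA ler_pM2l// expr2; apply: ler_pM => //.
- by rewrite (le_trans _ (ler_norm _))// (le_trans sD).
- by rewrite (le_trans _ (ler_norm _)).
Qed.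

Definition trig_small A B C e : set R :=
  [set p | p \in `[0, 2 * pi] /\ `|A + B * cos (p / 2) + C * sin (p / 2)| < e].

Lemma measurable_trig_small A B C e : measurable (trig_small A B C e).
Proof.
rewrite (_ : trig_small A B C e = `[0, 2 * pi]%classic `&`
  (fun p => `|A + B * cos (p / 2) + C * sin (p / 2)| < e) @^-1` [set true]); last first.
  by apply/seteqP; split => p.
have mh : measurable_fun setT (fun p : R => p / 2) by exact: measurable_fun_divc.
have m : measurable_fun setT (fun p => `|A + B * cos (p / 2) + C * sin (p / 2)| < e).
  apply: measurable_fun_ltr => //; apply: measurable_fun_norm.
  apply: measurable_funD; first apply: measurable_funD => //.
    by apply: measurable_funM => //; exact: measurable_fun_cos.
  by apply: measurable_funM => //; exact: measurable_fun_sin.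
by apply: (measurable_funTS (D := `[0, 2 * pi]%classic) m).
Qed.

(** If the amplitude r is below 1/2, then |A| >= 1 and the set is empty. Otherwise p / 2 - t lies in
    [-pi, 2 pi], covered by three branches of the cosine; on each, the set has diameter at most 4 e
    by [cos_branch], hence measure at most 8 e. *)
Lemma trig_small_measure A B C e : 0 < e -> e < pi / 2 ->
  (2^-1) ^+ 2 <= B ^+ 2 + C ^+ 2 \/ 1 <= `|A| ->
  (mu (trig_small A B C (2^-1 * sin e ^+ 2)) <= (24 * e)%:E)%E.
Proof.
move=> e0 e1 hABC.
have P : 0 < pi :> R by exact: pi_gt0.
have [r [t [r0 r2 ht -> ->]]] := polar B C.
have fE p : A + r * cos t * cos (p / 2) + r * sin t * sin (p / 2) = A + r * cos (p / 2 - t).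
  by rewrite cosB; ring.
set S := trig_small _ _ _ _.
have se : 0 < sin e by apply: sin_gt0_pi; move: (pi : R) P e0 e1 {ht hABC S} => Q; lra.
have [rl|rl] := ltP r (2^-1).
  suff -> : S = set0 by rewrite measure0 lee_fin mulr_ge0// ltW.
  apply/seteqP; split => // p; rewrite /S /trig_small/= fE => -[_].
  have A1 : 1 <= `|A|.
    case: hABC => //; rewrite -r2 ler_sqr ?nnegrE ?invr_ge0//; lra.
  have h1 : `|r * cos (p / 2 - t)| <= r by rewrite normrM ger0_norm// ler_piMr// cos_max.
  have h2 : sin e ^+ 2 <= 1 by rewrite expr_le1// ?sin_le1// ltW.
  have := lerB_normD A (r * cos (p / 2 - t)); lra.
have mS : measurable S by exact: measurable_trig_small.
pose I (k : int) : set R := [set p | (k%:~R * pi <= p / 2 - t <= (k%:~R + 1) * pi)%R].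
have mI k : measurable (I k).
  rewrite (_ : I k = `[2 * (k%:~R * pi + t), 2 * ((k%:~R + 1) * pi + t)]%classic).
    exact: measurable_itv.
  by apply/seteqP; split => p; rewrite /I/= in_itv/=; move: (k%:~R * pi) ((k%:~R + 1) * pi) => ? ?; lra.
have mSk k : (mu (S `&` I k) <= (8 * e)%:E)%E.
  apply: (le_trans (lebesgue_diam (e := 4 * e) _ _)).
  - by rewrite mulr_ge0// ltW.
  - move=> x y [[_]]; rewrite fE => hx Ix [[_]]; rewrite fE => hy Iy.
    have : `|(x / 2 - t) - (y / 2 - t)| <= 2 * e.
      apply: (cos_branch e0 e1 Ix Iy).
      have h : `|r * cos (x / 2 - t) - r * cos (y / 2 - t)| < sin e ^+ 2.
        have -> : r * cos (x / 2 - t) - r * cos (y / 2 - t) = (A + r * cos (x / 2 - t)) - (A + r * cos (y / 2 - t)) by ring.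
        by apply: (le_lt_trans (ler_normB _ _)); lra.
      move: h; rewrite -mulrBr normrM (ger0_norm r0) => h.
      have : 2^-1 * `|cos (x / 2 - t) - cos (y / 2 - t)| <= r * `|cos (x / 2 - t) - cos (y / 2 - t)|.
        exact: ler_wpM2r.
      lra.
    have -> : x / 2 - t - (y / 2 - t) = (x - y) / 2 by field.
    by rewrite normrM normfV (ger0_norm (_ : 0 <= 2))//; lra.
  - by rewrite lee_fin; lra.
have mSI k : measurable (S `&` I k) by apply: measurableI; [exact: mS|exact: mI].
have sub : S `<=` (S `&` I (-1)) `|` ((S `&` I 0) `|` (S `&` I 1)).
  move=> p Sp; have [hp _] := Sp; move: hp; rewrite in_itv/= => hp.
  have : (I (-1) p \/ I 0 p) \/ I 1 p.
    rewrite /I/= mulrNz; move: hp ht; rewrite -!pmulrn.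
    move: (pi : R) P {Sp mSI mSk mI mS S se fE e1} => Q Q0 hp ht.
    have [h1|h1] := leP (p / 2 - t) 0; first by left; left; lra.
    have [h2|h2] := leP (p / 2 - t) Q; first by left; right; lra.
    by right; lra.
  by case=> [[]|] h; [left|right; left|right; right].
pose J := (S `&` I (-1)) `|` ((S `&` I 0) `|` (S `&` I 1)).
pose J0 := S `&` I 0; pose J1 := S `&` I 1.
have hJ : (mu (J0 `|` J1) <= (8 * e)%:E + (8 * e)%:E)%E.
  apply: (le_trans (measureU2 _ _ _)); [exact: mSI|exact: mSI|by apply: leeD; exact: mSk].
have h : (mu S <= mu J)%E.
  apply: le_measure; rewrite ?inE//.
  by apply: measurableU; [exact: mSI|apply: measurableU; exact: mSI].
apply: (le_trans h); apply: (le_trans (measureU2 _ _ _)).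
- exact: mSI.
- by apply: measurableU; exact: mSI.
have -> : (24 * e)%:E = ((8 * e)%:E + ((8 * e)%:E + (8 * e)%:E))%E :> \bar R.
  by rewrite -!EFinD; congr EFin; ring.
by apply: leeD => //; exact: mSk.
Qed.

(** The velocity at p has absolute value |cos(p / 2)| / 2. *)
Definition slow_set (dl p0 : R) : set R :=
  [set p2 | p2 \in `[0, 2 * pi] /\
     [|| `|cos (p2 / 2)| < dl, `|cos (hres p0 p2 / 2)| < dl |
         `|cos (p3of p0 p2 / 2)| < dl]].

Lemma measurable_slow_set dl p0 : measurable (slow_set dl p0).
Proof.
rewrite (_ : slow_set dl p0 = `[0, 2 * pi]%classic `&` (fun p2 => [|| `|cos (p2 / 2)| < dl, `|cos (hres p0 p2 / 2)| < dl |
         `|cos (p3of p0 p2 / 2)| < dl]) @^-1` [set true]); last first.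
  by apply/seteqP; split => p.
have mc (f : R -> R) : measurable_fun setT f -> measurable_fun setT (fun p => `|cos (f p / 2)| < dl).
  move=> mf; apply: measurable_fun_ltr => //; apply: measurable_fun_norm.
  by apply: measurable_fun_cos; exact: measurable_fun_divc.
have m : measurable_fun setT (fun p2 => [|| `|cos (p2 / 2)| < dl, `|cos (hres p0 p2 / 2)| < dl |
         `|cos (p3of p0 p2 / 2)| < dl]).
  apply: measurable_or; first exact: mc.
  by apply: measurable_or; apply: mc; [exact: measurable_fun_hres|exact: measurable_fun_p3of].
by apply: (measurable_funTS (D := `[0, 2 * pi]%classic) m).
Qed.

(* On the resonant manifold, 4 cos^2((p2 - p0) / 4) cos(p1 / 2) cos(p3 / 2) is the
   product of two trigonometric polynomials of degree one in p2 / 2. *)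
Lemma slow_factor (dl p0 p2 : R) : 0 <= p0 <= 2 * pi -> 0 <= p2 <= 2 * pi ->
  0 < dl ->
  `|cos (hres p0 p2 / 2)| < dl \/ `|cos (p3of p0 p2 / 2)| < dl ->
  `|(1 + sin (p0 / 2) + cos (p0 / 2) * cos (p2 / 2) + (sin (p0 / 2) - 1) * sin (p2 / 2)) *
    (1 - sin (p0 / 2) + cos (p0 / 2) * cos (p2 / 2) + (sin (p0 / 2) + 1) * sin (p2 / 2))| < 4 * dl.
Proof.
move=> h0 h2 d0 hs.
have [[e0 e2 c_ge0 S0] [hsc hSC]] := omega_sum h0 h2.
rewrite !omega_period// in e0 e2.
set s := sin ((p2 - p0) / 4) in e0 e2 c_ge0 hsc; set c := cos ((p2 - p0) / 4) in e0 e2 c_ge0 hsc.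
set S := sin ((p2 + p0) / 4) in e0 e2 S0 hSC; set C := cos ((p2 + p0) / 4) in e0 e2 hSC.
have E : cos (p0 / 2) * cos (p2 / 2) + sin (p0 / 2) * sin (p2 / 2) = 2 * c ^+ 2 - 1.
  rewrite -cosB (_ : p0 / 2 - p2 / 2 = - ((p2 - p0) / 4 *+ 2)); last by rewrite -mulr_natr; field.
  by rewrite cosN cos_mulr2n -/c mulr_natl.
have F : sin (p2 / 2) - sin (p0 / 2) = 2 * s * C by rewrite e0 e2; ring.
have -> : 1 + sin (p0 / 2) + cos (p0 / 2) * cos (p2 / 2) + (sin (p0 / 2) - 1) * sin (p2 / 2) = 2 * c ^+ 2 - 2 * s * C.
  by move: E F; rewrite mulrBl mul1r => E F; lra.
have -> : 1 - sin (p0 / 2) + cos (p0 / 2) * cos (p2 / 2) + (sin (p0 / 2) + 1) * sin (p2 / 2) = 2 * c ^+ 2 + 2 * s * C.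
  by move: E F; rewrite mulrDl mul1r => E F; lra.
have [c0|cN0] := eqVneq c 0.
  have w0 := omega_ge0 p0; have w2 := omega_ge0 p2.
  rewrite !omega_period// e0 e2 c0 in w0 w2.
  have -> : 2 * s * C = 0 by lra.
  by rewrite c0 expr0n/= mulr0 subr0 mul0r normr0 mulr_gt0.
have [[cp huc u1 he hCc] [_ _ _ e1 e3]] := resonance h0 h2 cN0.
rewrite -/s -/c -/S -/C in huc u1 he hCc e1 e3.
set u := tan _ * _ in huc u1 he e1 e3; set e := Num.sqrt _ in he e1 e3.
have -> : (2 * c ^+ 2 - 2 * s * C) * (2 * c ^+ 2 + 2 * s * C) =
  4 * c ^+ 2 * (cos (hres p0 p2 / 2) * cos (p3of p0 p2 / 2)).
  rewrite e1 e3.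
  have -> : (c * e - s * u) * (c * e + s * u) = c ^+ 2 * e ^+ 2 - s ^+ 2 * u ^+ 2 by ring.
  rewrite he; transitivity (4 * (c ^+ 2 * c ^+ 2) - 4 * (s ^+ 2 * C ^+ 2)); first by ring.
  rewrite -huc.
  transitivity (4 * c ^+ 2 * (c ^+ 2 - (s ^+ 2 + c ^+ 2) * u ^+ 2)); last by ring.
  by rewrite hsc; ring.
rewrite normrM ger0_norm ?(mulr_ge0 _ (sqr_ge0 c))// normrM.
have c1 : c ^+ 2 <= 1 by have := sqr_ge0 s; move: hsc; lra.
have cc : `|cos (hres p0 p2 / 2)| * `|cos (p3of p0 p2 / 2)| < dl.
  case: hs => hs; [|rewrite mulrC]; apply: le_lt_trans hs; by rewrite ler_piMr// cos_max.
rewrite -mulrA ltr_pM2l//; apply: le_lt_trans cc.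
by rewrite ler_piMl// mulr_ge0.
Qed.

(** With dl = h^2 / 4, [slow_factor] bounds the product of two trigonometric polynomials by h^2, so
    one factor is below h. The hypothesis of [trig_small_measure] holds uniformly in p0: A = 1 +
    sin(p0 / 2) >= 1 for the first factor, B^2 + C^2 = 2 + 2 sin(p0 / 2) >= 2 for the second. *)
Lemma slow_small eta : 0 < eta -> exists2 dl, 0 < dl &
  forall p0, 0 <= p0 <= 2 * pi -> (mu (slow_set dl p0) <= eta%:E)%E.
Proof.
(* Three sets of measure at most 24 e each; the cap 1/2 keeps e below pi / 2. *)
move=> eta0; pose e := Num.min (eta / 72) 2^-1.
have e0 : 0 < e by rewrite lt_min invr_gt0 divr_gt0//=.
have eh : e <= 2^-1 by rewrite ge_min lexx orbT.
have e72 : 72 * e <= eta.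
  by rewrite mulrC -ler_pdivlMr// ge_min lexx.
have e1 : e < pi / 2 by have := @pihalf_ge1 R; move: (pi / 2) => P; lra.
have se : 0 < sin e.
  by apply: sin_gt0_pi; have := @pi_ge2 R; move: (pi : R) {e1} => P; lra.
pose h := 2^-1 * sin e ^+ 2.
have h0 : 0 < h by rewrite mulr_gt0 ?invr_gt0// exprn_gt0.
have h1 : h <= 2^-1 by rewrite ler_piMr ?invr_ge0// expr_le1// ?sin_le1// ltW.
have dh : h ^+ 2 / 4 <= h by rewrite ler_pdivrMr// expr2; apply: ler_wpM2l; lra.
exists (h ^+ 2 / 4); first by rewrite divr_gt0// exprn_gt0.
move=> p0 hp0.
have s0 : 0 <= sin (p0 / 2) by rewrite -omega_period// omega_ge0.
have s1 := sin_le1 (p0 / 2).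
have cs := cos2Dsin2 (p0 / 2).
pose S1 := trig_small 0 1 0 h.
pose S2 := trig_small (1 + sin (p0 / 2)) (cos (p0 / 2)) (sin (p0 / 2) - 1) h.
pose S3 := trig_small (1 - sin (p0 / 2)) (cos (p0 / 2)) (sin (p0 / 2) + 1) h.
have m1 : (mu S1 <= (24 * e)%:E)%E.
  by apply: trig_small_measure => //; left; rewrite expr1n expr0n/= addr0 expr_le1//; lra.
have m2 : (mu S2 <= (24 * e)%:E)%E.
  by apply: trig_small_measure => //; right; rewrite ger0_norm; lra.
have m3 : (mu S3 <= (24 * e)%:E)%E.
  apply: trig_small_measure => //; left.
  have -> : cos (p0 / 2) ^+ 2 + (sin (p0 / 2) + 1) ^+ 2 = 2 + 2 * sin (p0 / 2).
    by rewrite [(_ + 1) ^+ 2](_ : _ = sin (p0 / 2) ^+ 2 + 2 * sin (p0 / 2) + 1); [move: cs; lra|ring].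
  by rewrite expr2; lra.
have mS i j k : measurable (trig_small i j k h) by exact: measurable_trig_small.
have sub : slow_set (h ^+ 2 / 4) p0 `<=` S1 `|` (S2 `|` S3).
  move=> p2 [hp2 /or3P hs].
  have H2 : 0 <= p2 <= 2 * pi by move: hp2; rewrite in_itv.
  have : `|cos (p2 / 2)| < h ^+ 2 / 4 \/ (`|cos (hres p0 p2 / 2)| < h ^+ 2 / 4 \/ `|cos (p3of p0 p2 / 2)| < h ^+ 2 / 4).
    by case: hs; tauto.
  case=> [hc|hc]; first by left; split => //; rewrite add0r mul1r mul0r addr0 (lt_le_trans hc).
  right; have d0 : 0 < h ^+ 2 / 4 by rewrite divr_gt0// exprn_gt0.
  have := slow_factor hp0 H2 d0 hc; rewrite normrM.
  have -> : 4 * (h ^+ 2 / 4) = h * h by field.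
  set X := `|_ + _ * _ + _|; set Y := `|_|.
  have [hX _|hX hXY] := ltP X h; first by left.
  right; split => //; rewrite -/Y ltNge; apply/negP => hY.
  by move: hXY; rewrite ltNge => /negP; apply; apply: ler_pM => //; exact: ltW.
have hm : (mu (slow_set (h ^+ 2 / 4) p0) <= mu (S1 `|` (S2 `|` S3)))%E.
  apply: le_measure; rewrite ?inE//; first exact: measurable_slow_set.
  by apply: measurableU; [exact: mS|apply: measurableU; exact: mS].
apply: (le_trans hm); apply: (le_trans (measureU2 _ _ _)) => //; [exact: mS|apply: measurableU; exact: mS|].
have m23 : (mu (S2 `|` S3) <= (24 * e)%:E + (24 * e)%:E)%E.
  apply: (le_trans (measureU2 _ _ _)); [exact: mS|exact: mS|exact: leeD].
apply: (le_trans (leeD m1 m23)).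
by rewrite -!EFinD lee_fin; lra.
Qed.

End slow_set.

(* On [R] itself, rather than [measurableTypeR R], the library hint for filters
   of almost-everywhere properties does not unify. *)
#[global] Hint Extern 1 (Filter (nbhs (almost_everywhere _))) =>
  (exact (@ae_filter_ringOfSetsType _ (measurableTypeR _) _ _))
  : typeclass_instances.

(** * Expanding maps pull null sets back to null sets *)

Section null_sets.
Context {R : realType}.
Local Notation mu := (@lebesgue_measure R).

(** The inverse of [phi] on D is Lipschitz with constant 1/c. The preimages of the intervals of a
    cover of N have diameter at most length / c; they are estimated by outer measure. *)
Lemma negligible_expanding (phi : R -> R) (D N : set R) (c : R) : 0 < c ->
  (forall x y, D x -> D y -> c * `|x - y| <= `|phi x - phi y|) ->
  mu.-negligible N -> mu.-negligible [set x | D x /\ N (phi x)].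
Proof.
move=> c0 hphi /negligible_outer_measure N0; apply/negligible_outer_measure.
apply/eqP; rewrite eq_le outer_measure_ge0 andbT.
apply/lee_addgt0Pr => e e0; rewrite add0e.
(* [lebesgue_diam] loses a factor 2, so preimages are at most 2/c times as large as the intervals;
   this choice makes the total e. *)
have ce0 : 0 < c * e / 2 by rewrite divr_gt0// mulr_gt0.
have [F AF Fe] : exists2 F : nat -> set R, open_itv_cover N F &
    (\sum_(0 <= k <oo) wlength idfun (F k) <= (c * e / 2)%:E)%E.
  have fN : ((wlength idfun)^* N)%mu \is a fin_num by rewrite N0.
  move: N0 fN; rewrite outer_measure_open_itv_cover => N0 fN.
  have [_ [F AF <-] Fe] := lb_ereal_inf_adherent ce0 fN.
  by exists F => //; move: Fe; rewrite N0 add0e => /ltW.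
pose J k := [set x | D x /\ F k (phi x)].
have sub : [set x | D x /\ N (phi x)] `<=` \bigcup_k J k.
  move=> x [Dx Nx]; have [_ /(_ _ Nx)[k _ Fk]] := AF.
  by exists k.
have Jk k : (mu (J k) <= (2 / c)%:E * wlength idfun (F k))%E.
  have [/(_ k)[[a b] Fab] _] := AF.
  have h x y : J k x -> J k y -> `|x - y| <= (b - a) / c.
    move=> [Dx Fx] [Dy Fy]; rewrite ler_pdivlMr// mulrC (le_trans (hphi _ _ Dx Dy))//.
    by move: Fx Fy; rewrite Fab /= !in_itv/= ler_norml; lra.
  rewrite Fab wlength_itv/= lte_fin; case: ltP => ab.
    apply: (le_trans (lebesgue_diam _ h)); first by rewrite divr_ge0 ?subr_ge0// ltW.
    by rewrite -EFinD -EFinM lee_fin le_eqVlt; apply/orP; left; apply/eqP; field; rewrite gt_eqF.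
  suff -> : J k = set0 by rewrite measure0 mule0.
  by apply/seteqP; split => // x [_]; rewrite Fab/= in_itv/=; lra.
apply: (@le_trans _ _ ((wlength idfun)^* (\bigcup_k J k))%mu); first exact: le_outer_measure.
apply: (@le_trans _ _ (\sum_(0 <= k <oo) ((wlength idfun)^* (J k))%mu)%E).
  exact: outer_measure_sigma_subadditive.
apply: (@le_trans _ _ (\sum_(0 <= k <oo) ((2 / c)%:E * wlength idfun (F k)))%E).
  by apply: lee_nneseries => [k _ _|k _]; [exact: outer_measure_ge0|exact: Jk].
rewrite nneseriesZl; last by move=> k _; exact: wlength_ge0.
apply: (@le_trans _ _ ((2 / c)%:E * (c * e / 2)%:E)%E).
  by apply: lee_wpmul2l => //; rewrite lee_fin divr_ge0// ltW.
by rewrite -EFinM lee_fin le_eqVlt; apply/orP; left; apply/eqP; field; rewrite gt_eqF.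
Qed.
End null_sets.


(** * Almost everywhere statements on products *)

Section product_null.
Context d1 d2 (T1 : measurableType d1) (T2 : measurableType d2) {R : realType}.
Variables (m1 : {sigma_finite_measure set T1 -> \bar R})
          (m2 : {sigma_finite_measure set T2 -> \bar R}).
Implicit Types (P : set (T1 * T2)).

Lemma negligible_ae d (T : measurableType d) (m : {measure set T -> \bar R}) (P : set T) :
  (\forall x \ae m, P x) -> exists N, [/\ measurable N, m N = 0%E & ~` P `<=` N].
Proof. by []. Qed.

Lemma ge0_integral0_ae d (T : measurableType d) (m : {measure set T -> \bar R})
    (f : T -> \bar R) : measurable_fun setT f -> (forall x, 0 <= f x)%E ->
  (\int[m]_x f x = 0)%E -> \forall x \ae m, f x = 0%E.
Proof.
move=> mf f0 If; have /(ae_eq_integral_abs m measurableT mf) : (\int[m]_x `|f x| = 0)%E.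
  by rewrite -[RHS]If; apply: eq_integral => x _; rewrite gee0_abs.
by apply: filterS => x; exact.
Qed.

Lemma ae0_integral0 d (T : measurableType d) (m : {measure set T -> \bar R})
    (f : T -> \bar R) : measurable_fun setT f -> (forall x, 0 <= f x)%E ->
  (\forall x \ae m, f x = 0%E) -> (\int[m]_x f x = 0)%E.
Proof.
move=> mf f0 H; have /(ae_eq_integral_abs m measurableT mf) <- : ae_eq m setT f (cst 0%E).
  by apply: filterS H.
by apply: eq_integral => x _; rewrite gee0_abs.
Qed.

Lemma ae_prod1 P : (\forall z \ae (m1 \x m2)%E, P z) ->
  \forall x \ae m1, \forall y \ae m2, P (x, y).
Proof.
move=> /negligible_ae[N [mN N0 PN]].
have : \forall x \ae m1, (m2 \o xsection N) x = 0%E.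
  by apply: ge0_integral0_ae => //; exact: measurable_fun_xsection.
apply: filterS => x Nx; exists (xsection N x); split => //.
  exact: measurable_xsection.
by move=> y Py; rewrite /xsection/= inE; exact: PN.
Qed.

(** The product measure is defined through sections at fixed x; Tonelli for an indicator gives the
    other order. *)
Lemma product_measure_ysection (N : set (T1 * T2)) : measurable N ->
  ((m1 \x m2) N = \int[m2]_y (m1 \o ysection N) y)%E.
Proof.
move=> mN; have := @indic_fubini_tonelli _ _ _ _ _ m1 m2 N mN.
rewrite (indic_fubini_tonelli_FE _ mN) (indic_fubini_tonelli_GE _ mN) => <-.
by [].
Qed.

Lemma ae_prod2 P : (\forall z \ae (m1 \x m2)%E, P z) ->
  \forall y \ae m2, \forall x \ae m1, P (x, y).
Proof.
move=> /negligible_ae[N [mN N0 PN]].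
have : \forall y \ae m2, (m1 \o ysection N) y = 0%E.
  apply: ge0_integral0_ae => //; first exact: measurable_fun_ysection.
  by rewrite -product_measure_ysection.
apply: filterS => y Ny; exists (ysection N y); split => //.
  exact: measurable_ysection.
by move=> x Px; rewrite /ysection/= inE; exact: PN.
Qed.

Lemma prod_ae1 P : measurable P ->
  (\forall x \ae m1, \forall y \ae m2, P (x, y)) -> \forall z \ae (m1 \x m2)%E, P z.
Proof.
move=> mP H; exists (~` P); split => //; first exact: measurableC.
apply: ae0_integral0; rewrite //=.
  by apply: measurable_fun_xsection; exact: measurableC.
apply: filterS H => x Hx /=; apply: measure_negligible.
  by apply: measurable_xsection; exact: measurableC.
by apply: negligibleS Hx => y; rewrite /xsection/= inE.
Qed.

Lemma prod_ae2 P : measurable P ->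
  (\forall y \ae m2, \forall x \ae m1, P (x, y)) -> \forall z \ae (m1 \x m2)%E, P z.
Proof.
move=> mP H; exists (~` P); split => //; first exact: measurableC.
rewrite product_measure_ysection; last exact: measurableC.
apply: ae0_integral0; rewrite //=.
  by apply: measurable_fun_ysection; exact: measurableC.
apply: filterS H => y Hy /=; apply: measure_negligible.
  by apply: measurable_ysection; exact: measurableC.
by apply: negligibleS Hy => x; rewrite /ysection/= inE.
Qed.

End product_null.

(** * The resonance map avoids null sets *)

Section resonance_null.
Context {R : realType}.
Local Notation mu := (@lebesgue_measure R).

Lemma ae_torus (P : R -> Prop) : (\forall p \ae (@torus_measure R), P p) <->
  (\forall p \ae mu, 0 <= p <= 2 * pi -> P p).
Proof.
split => [[N [mN N0 PN]]|[N [mN N0 PN]]].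
  exists (N `&` `[0, 2 * pi]%classic); split => //.
    by apply: measurableI => //; exact: measurable_itv.
  move=> p /= /not_implyP[hp nP]; split; first exact: PN.
  by rewrite /= in_itv.
exists (N `|` ~` `[0, 2 * pi]%classic); split.
- by apply: measurableU => //; apply: measurableC; exact: measurable_itv.
- rewrite /torus_measure /mfrestr /mrestr.
  apply/eqP; rewrite -measure_le0 -N0; apply: le_measure; rewrite ?inE//.
    apply: measurableI; last exact: measurable_itv.
    by apply: measurableU => //; apply: measurableC; exact: measurable_itv.
  by move=> p [[]].
- move=> p nP; have [hp|hp] := boolP (0 <= p <= 2 * pi).
    by left; apply: PN => /=; apply/not_implyP; split.
  by right; rewrite /= in_itv/=; exact/negP.
Qed.

Lemma sin_ge_mid (x m : R) : 0 <= x -> x <= m <= pi - x -> sin x <= sin m.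
Proof.
move=> x0 hm.
have [m2|m2] := leP m (pi / 2).
  have [->//|Dm] := eqVneq x m; apply: ltW.
  have Dlt : x < m by rewrite lt_neqAle Dm; case/andP: hm.
  rewrite ltr_sin// in_itv/=; move: (pi : R) m2 hm (@pi_gt0 R) => Q; lra.
rewrite -[sin m](_ : sin (pi - m) = _); last by rewrite sinB sinpi cospi; ring.
have [->//|Dm] := eqVneq x (pi - m); apply: ltW.
have Dlt : x < pi - m by rewrite lt_neqAle Dm; move: hm; move: (pi : R) => Q; lra.
rewrite ltr_sin// in_itv/=; move: (pi : R) m2 hm (@pi_gt0 R) {Dm Dlt} => Q; lra.
Qed.

Lemma sin_lipschitz (x y : R) : `|sin x - sin y| <= `|x - y|.
Proof.
wlog xy : x y / x < y.
  move=> H; have [/H//|/H|->] := ltgtP x y; last by rewrite !subrr.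
  by rewrite distrC (distrC y).
have [c _ e] := @MVT R sin cos x y xy (fun z _ => is_derive_sin z) (continuous_subspaceT (@continuous_sin R)).
rewrite distrC e normrM (distrC x) ler_piMl// ; exact: cos_max.
Qed.

Lemma cos_expanding (t x y : R) : 0 <= t -> t <= x <= pi - t -> t <= y <= pi - t ->
  sin t * `|x - y| <= `|cos x - cos y|.
Proof.
move=> t0.
wlog xy : x y / x < y.
  move=> H hx hy; have [h|h|->] := ltgtP x y; [exact: H| |by rewrite !subrr normr0 mulr0].
  by rewrite distrC (distrC (cos x)); exact: H.
move=> hx hy.
have [c + e] := @MVT R cos (fun z => - sin z) x y xy (fun z _ => is_derive_cos z) (continuous_subspaceT (@continuous_cos R)).
rewrite in_itv/= => hc; rewrite (distrC (cos x)) e normrM normrN (distrC x).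
apply: ler_wpM2r => //; apply: (le_trans _ (ler_norm _)); apply: sin_ge_mid => //.
by move: hx hy hc; move: (pi : R) => Q; lra.
Qed.

(** At fixed difference d only the asin term varies. The arcsine is expanding because the sine is
    1-Lipschitz, and (2 x + d) / 4 stays in [t, pi - t] for t = |d| / 4, where the cosine expands by
    sin t. The factors 2 in [hres] and 1/2 from the argument cancel. *)
Lemma hres_expanding (d x y : R) : 0 < `|d| < 2 * pi ->
  0 <= x <= 2 * pi -> 0 <= x + d <= 2 * pi ->
  0 <= y <= 2 * pi -> 0 <= y + d <= 2 * pi ->
  tan (`|d| / 4) * sin (`|d| / 4) * `|x - y| <= `|hres x (x + d) - hres y (y + d)|.
Proof.
move=> hd hx hxd hy hyd; set t := `|d| / 4.
have ht : 0 < t < pi / 2 by rewrite /t; move: hd; move: (pi : R) `|d| => Q D; lra.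
have st : 0 < sin t by apply: sin_gt0_pi; move: ht; move: (pi : R) => Q; lra.
have ct : 0 < cos t by apply: cos_gt0_pihalf; move: ht; move: (pi : R) => Q; lra.
have tt : 0 < tan t by rewrite divr_gt0.
have ctd : cos (d / 4) = cos t by rewrite -[LHS]cos_norm normrM (gtr0_norm (_ : 0 < 4^-1)).
have zd z : z + d - z = d by ring.
have ub z : 0 <= z <= 2 * pi -> 0 <= z + d <= 2 * pi ->
    -1 <= tan t * cos ((z + d + z) / 4) <= 1.
  move=> hz hzd; have [] := resonance hz hzd; rewrite zd.
    by rewrite ctd gt_eqF.
  by move=> [_ _ + _ _] _.
rewrite /hres !zd.
rewrite -/t.
have -> (a b : R) : d / 2 + 2 * a - (d / 2 + 2 * b) = 2 * (a - b) by ring.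
rewrite normrM (@ger0_norm _ 2)//.
have h1 := sin_lipschitz (asin (tan t * cos ((x + d + x) / 4))) (asin (tan t * cos ((y + d + y) / 4))).
rewrite !asinK ?ub// in h1; last 2 first.
- by rewrite in_itv/= ub.
- by rewrite in_itv/= ub.
rewrite -mulrBr normrM (gtr0_norm tt) in h1.
have h2 : sin t * `|(x + d + x) / 4 - (y + d + y) / 4| <= `|cos ((x + d + x) / 4) - cos ((y + d + y) / 4)|.
  apply: cos_expanding; rewrite /t; move: hx hy hxd hyd {ub h1 hd ht}; move: (pi : R) => Q.
  - by move=> *; apply: divr_ge0.
  - by case: (ger0P d) => ? *; apply/andP; split; lra.
  - by case: (ger0P d) => ? *; apply/andP; split; lra.
rewrite (_ : (x + d + x) / 4 - (y + d + y) / 4 = (x - y) / 2) in h2; last by field.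
rewrite normrM (gtr0_norm (_ : 0 < 2^-1))// in h2.
have h3 : tan t * (sin t * (`|x - y| / 2)) <= tan t * `|cos ((x + d + x) / 4) - cos ((y + d + y) / 4)|.
  by rewrite ler_pM2l.
by move: h1 h3; move: (asin _ - asin _) => ?; rewrite -(mulrA (tan t)); lra.
Qed.

Definition lebesgue2 : {measure set (phase R) -> \bar R} :=
  (@lebesgue_measure R \x @lebesgue_measure R)%E.

(** Expansion is known only along the lines p2 - p0 = d. Fubini in the sheared coordinates (p0, d)
    therefore gives the result for almost every pair (p0, d), and translation at fixed p0 returns to
    (p0, p2). *)
Lemma hres_null (N : set R) : mu.-negligible N ->
  {ae lebesgue2, forall z : phase R, 0 <= z.1 <= 2 * pi -> 0 <= z.2 <= 2 * pi ->
    ~ N (hres z.1 z.2)}.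
Proof.
move=> [M [mM M0 NM]].
suff : {ae lebesgue2, forall z : phase R, (0 <= z.1 <= 2 * pi /\ 0 <= z.2 <= 2 * pi) -> ~ M (hres z.1 z.2)}.
  by apply: filterS => z Hz h1 h2 /NM; apply: Hz.
pose A : set (phase R) :=
  [set z | (0 <= z.1 <= 2 * pi /\ 0 <= z.2 <= 2 * pi) -> ~ M (hres z.1 z.2)].
have mI : measurable (`[0, 2 * pi]%classic : set (measurableTypeR R)) by exact: measurable_itv.
have mA : measurable A.
  rewrite (_ : A = ~` (((fst @^-1` `[0, 2 * pi]%classic) `&` (snd @^-1` `[0, 2 * pi]%classic)) `&`
      (fun z : phase R => hres z.1 z.2) @^-1` M)); last first.
    apply/seteqP; split => z; rewrite /A/= !in_itv/=; tauto.
  apply: measurableC; apply: measurableI; first apply: measurableI.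
  - by rewrite -[X in measurable X]setTI; exact: (@measurable_fst _ _ (measurableTypeR R) (measurableTypeR R)).
  - by rewrite -[X in measurable X]setTI; exact: (@measurable_snd _ _ (measurableTypeR R) (measurableTypeR R)).
  rewrite -[X in measurable X]setTI.
  by apply: (measurable_fun_hres (T := (phase R)) measurable_fst measurable_snd).
pose B : set (phase R) := [set z | A (z.1, z.1 + z.2)].
have mB : measurable B.
  rewrite -[X in measurable X]setTI.
  have : measurable_fun setT (fun z : phase R => (z.1, z.1 + z.2)).
    apply: measurable_fun_pair; first exact: measurable_fst.
    by apply: measurable_funD; [exact: measurable_fst|exact: measurable_snd].
  by apply.
have HB : {ae lebesgue2, forall z : phase R, B z}.
  apply: prod_ae2 => //.
  (* The expansion constant vanishes at d = 0 and the tangent degenerates at |d| = 2 pi; beyond 2 pi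
     the line misses the square. *)
  have : \forall d \ae mu, 0 < `|d| /\ `|d| != 2 * pi.
    have F : mu.-negligible [set 0; 2 * pi; - (2 * pi) ].
      by repeat apply: negligibleU; apply/negligibleP => //; exact: lebesgue_measure_set1.
    apply: negligibleS F => d /= /not_andP[/negP|/negP].
      by rewrite normr_gt0 negbK => /eqP ->; left; left.
    rewrite negbK => /eqP h; case: (ger0P d) h => _ h; first by left; right.
    by right; rewrite -h opprK.
  apply: filterS => d [d0 d2].
  have [dpi|dpi] := ltP `|d| (2 * pi); last first.
    apply: aeW => x; rewrite /B /A/= => -[hx hxd].
    exfalso; have : `|d| <= 2 * pi by rewrite ler_norml; lra.
    by rewrite le_eqVlt (negbTE d2)/= ltNge dpi.
  have c0 : 0 < tan (`|d| / 4) * sin (`|d| / 4).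
    have st : 0 < sin (`|d| / 4).
      by apply: sin_gt0_pi; move: d0 dpi; move: (pi : R) `|d| => Q D; lra.
    rewrite mulr_gt0// divr_gt0//; apply: cos_gt0_pihalf.
    by move: d0 dpi; move: (pi : R) `|d| => Q D; lra.
  pose D := [set x | 0 <= x <= 2 * pi /\ 0 <= x + d <= 2 * pi].
  have H : mu.-negligible [set x | D x /\ M (hres x (x + d))].
    apply: (@negligible_expanding _ (fun x => hres x (x + d)) D M _ c0).
      by move=> x y [? ?] [? ?]; apply: hres_expanding => //; rewrite d0.
    by exists M; split.
  apply: negligibleS H => x /= nB; have /not_implyP[hh /contrapT Mx] := nB.
  by split.
(* Order of the variables exchanged: almost every d for almost every p0, then d = p2 - p0. *)
have H1 := ae_prod1 HB.
apply: prod_ae1 => //.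
apply: filterS H1 => x Hx.
have := negligible_expanding (phi := fun y => y - x) (D := setT) (N := ~` [set y | B (x, y)]) ltr01 _ Hx.
have e : forall y z : R, setT y -> setT z -> 1 * `|y - z| <= `|y - x - (z - x)|.
  by move=> y z _ _; rewrite mul1r; have -> : y - x - (z - x) = y - z by ring.
move=> /(_ e) H; apply: negligibleS H => y/= nA; split => //.
by rewrite /B/= (_ : x + (y - x) = y); last ring.
Qed.

End resonance_null.

(** * Comparison of integrals under almost everywhere bounds *)

Section integral_lemmas.
Context d (T : measurableType d) {R : realType} (m : {measure set T -> \bar R}).
Implicit Types (D : set T) (f g b : T -> R).

Lemma ae_bounded_integrable D f (A : R) : measurable D -> (m D < +oo)%E ->
  measurable_fun D f -> (\forall x \ae m, D x -> `|f x| <= A) ->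
  m.-integrable D (EFin \o f).
Proof.
move=> mD Doo mf fA; apply/integrableP; split; first exact/measurable_EFinP.
apply: (@le_lt_trans _ _ (\int[m]_(x in D) `|A|%:E)%E).
  apply: ae_ge0_le_integral => //=.
    by apply/measurable_EFinP; apply: measurableT_comp mf; exact: normr_measurable.
  by apply: filterS fA => x H Dx; rewrite lee_fin (le_trans (H Dx))// ler_norm.
by rewrite integral_cst// lte_mul_pinfty// lee_fin.
Qed.

Lemma ae_le_Rintegral D f b : measurable D -> measurable_fun D f ->
  m.-integrable D (EFin \o f) -> m.-integrable D (EFin \o b) ->
  (forall x, D x -> 0 <= f x) -> (forall x, D x -> 0 <= b x) ->
  (\forall x \ae m, D x -> f x <= b x) ->
  \int[m]_(x in D) f x <= \int[m]_(x in D) b x.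
Proof.
move=> mD mf fi bi f0 b0 H; apply: fine_le.
- exact: integrable_fin_num.
- exact: integrable_fin_num.
apply: ae_ge0_le_integral => //=.
- exact/measurable_EFinP.
- by case/integrableP: bi.
Qed.

(** The constant [A] secures integrability of f and g, while [b] carries the quantitative bound. *)
Lemma Rintegral_dist D f g b (A : R) : measurable D -> (m D < +oo)%E ->
  measurable_fun D f -> measurable_fun D g -> m.-integrable D (EFin \o b) ->
  (forall x, D x -> 0 <= b x) ->
  (\forall x \ae m, D x -> [/\ `|f x| <= A, `|g x| <= A & `|f x - g x| <= b x]) ->
  `|\int[m]_(x in D) f x - \int[m]_(x in D) g x| <= \int[m]_(x in D) b x.
Proof.
move=> mD Doo mf mg bi b0 H.
have fi : m.-integrable D (EFin \o f).
  by apply: (@ae_bounded_integrable D f A) => //; apply: filterS H => x Hx /Hx[].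
have gi : m.-integrable D (EFin \o g).
  by apply: (@ae_bounded_integrable D g A) => //; apply: filterS H => x Hx /Hx[].
have mfg : measurable_fun D (fun x => f x - g x) by exact: measurable_funB.
have fgi : m.-integrable D (EFin \o (fun x => f x - g x)).
  apply: (@ae_bounded_integrable _ _ (A + A)) => //; apply: filterS H => x Hx /Hx[h1 h2 _].
  by rewrite (le_trans (ler_normB _ _))// lerD.
rewrite -RintegralB//; apply: (le_trans (le_normr_Rintegral mD fgi)).
apply: ae_le_Rintegral => //.
- by apply: measurableT_comp mfg; exact: normr_measurable.
- by have := integrable_norm fgi.
- by apply: filterS H => x Hx /Hx[].
Qed.

End integral_lemmas.

(** * Measurability of integrals depending on parameters *)

Section parametric_measurability.
Context d (T : measurableType d) {R : realType}.

Lemma measurable_fun_Rintegral d2 (T2 : measurableType d2)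
    (m2 : {sigma_finite_measure set T2 -> \bar R}) (f : T * T2 -> R) :
  measurable_fun setT f -> measurable_fun setT (fun x => \int[m2]_y f (x, y)).
Proof.
move=> mf; rewrite /Rintegral.
have mEf : measurable_fun setT (EFin \o f) by exact/measurable_EFinP.
have -> : (fun x => fine (\int[m2]_y (f (x, y))%:E)%E) =
   fine \o (fun x => (\int[m2]_y (EFin \o f)^\+ (x, y) - \int[m2]_y (EFin \o f)^\- (x, y))%E).
  by apply/funext => x; congr fine; rewrite integralE; congr (_ - _)%E; apply: eq_integral => y _; rewrite ?funeposE ?funenegE.
apply: measurableT_comp => //; apply: emeasurable_funB.
- exact: (measurable_fun_fubini_tonelli_F (m2 := m2) ((EFin \o f)^\+)%E (measurable_funepos mEf) (fun=> funepos_ge0 _ _)).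
- exact: (measurable_fun_fubini_tonelli_F (m2 := m2) ((EFin \o f)^\-)%E (measurable_funeneg mEf) (fun=> funeneg_ge0 _ _)).
Qed.

Lemma measurable_fun_Rintegral_itv (f : T * R -> R) (a b : T -> R) :
  measurable_fun setT (f : T * measurableTypeR R -> R) ->
  measurable_fun setT a -> measurable_fun setT b ->
  measurable_fun setT (fun x => \int[lebesgue_measure]_(y in `[a x, b x]) f (x, y)).
Proof.
move=> mf ma mb.
pose g (u : T * measurableTypeR R) := if (a u.1 <= u.2) && (u.2 <= b u.1) then f u else 0.
rewrite (_ : (fun x => _) = fun x => \int[@lebesgue_measure R]_y g (x, y)).
  apply: measurable_fun_Rintegral; apply: measurable_fun_ifT => //.
  have m1 (h : T -> R) : measurable_fun setT h -> measurable_fun setT (fun u : T * measurableTypeR R => h u.1).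
    by move=> mh; apply: (measurableT_comp mh); exact: measurable_fst.
  apply: measurable_and; apply: measurable_fun_ler; rewrite ?m1//; try exact: m1; exact: measurable_snd.
apply/funext => x; rewrite Rintegral_mkcond; congr fine; apply: eq_integral => y _.
by rewrite /patch /g /= mem_setE in_itv.
Qed.

Lemma measurable_fun_collision (G : T * R -> R) (c : T -> R) :
  measurable_fun setT (G : T * measurableTypeR R -> R) -> measurable_fun setT c ->
  measurable_fun setT (fun x => collision (fun q => G (x, q)) (c x)).
Proof.
move=> mG mc.
apply: (@measurable_fun_Rintegral_itv (fun u => cint (fun q => G (u.1, q)) (c u.1) u.2) (fun=> 0) (fun=> 2 * pi)) => //.
apply: (@measurable_fun_cint _ _ (T * measurableTypeR R)%type (fun u => G (u.1.1, u.2))).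
- apply: (measurableT_comp mG); apply: measurable_fun_pair; last exact: measurable_snd.
  by apply: (measurableT_comp measurable_fst); exact: measurable_fst.
- by apply: (measurableT_comp mc); exact: measurable_fst.
- exact: measurable_snd.
Qed.

End parametric_measurability.

(* [phase_measure] has no sigma-finiteness instance, which Fubini's theorem in
   time and phase requires; hence this copy. *)
Definition phase_sf (R : realType) : set (phase R) -> \bar R :=
  (@lebesgue_measure R \x @torus_measure R)%E.

HB.instance Definition _ (R : realType) :=
  Measure.copy (@phase_sf R) (@lebesgue_measure R \x @torus_measure R)%E.

Lemma phase_sigma_finite (R : realType) : sigma_finite setT (@phase_sf R).
Proof.
exists (fun n : nat => `[- n%:R, n%:R]%classic `*` setT).
  apply/seteqP; split => // -[x p] _.
  exists (Num.bound `|x|) => //; split => //=; rewrite in_itv/= -ler_norml.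
  exact/ltW/archi_boundP.
move=> n; split.
  by apply: measurableX => //; exact: measurable_itv.
pose I : set (measurableTypeR R) := `[- n%:R, n%:R]%classic.
have -> : phase_sf (I `*` setT) = (@lebesgue_measure R I * @torus_measure R setT)%E.
  by apply: product_measure1E => //; exact: measurable_itv.
apply: lte_mul_pinfty => //.
- rewrite ge0_fin_numE// /I lebesgue_measure_itv/=; case: ifP => // _.
  by rewrite -EFinD ltry.
- exact: fin_num_fun_lty.
Qed.

HB.instance Definition _ (R : realType) :=
  Measure_isSigmaFinite.Build _ _ _ (@phase_sf R) (@phase_sigma_finite R).

(** * The collision operator under pointwise and almost everywhere bounds *)

Section collision_bounds.
Context {R : realType} (alpha : R).
Hypothesis alpha1 : alpha <= 1.
Local Notation mu := (@lebesgue_measure R).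
Local Notation wt := (wt alpha).
Local Notation K := (kconst alpha).

Definition quad (p0 p2 : R) := [:: p0; hres p0 p2; p2; p3of p0 p2].

Lemma cint0 (p0 p2 : R) : cint (fun=> 0) p0 p2 = 0.
Proof. by rewrite /cint !(mulr0, mul0r, addr0, subr0). Qed.

Lemma collision0 (p0 : R) : collision (fun=> 0) p0 = 0.
Proof.
rewrite collisionE (_ : (fun p2 => cint _ p0 p2) = fun=> 0).
  by rewrite /Rintegral integral0.
by apply/funext => p2; exact: cint0.
Qed.

Lemma mu_period : mu `[0, 2 * pi]%classic = (2 * pi)%:E.
Proof. by rewrite lebesgue_measure_itv/= lte_fin pi2_gt0 oppr0 adde0. Qed.

Lemma Rintegral_period_cst (r : R) : \int[mu]_(_ in `[0, 2 * pi]) r = r * (2 * pi).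
Proof.
rewrite Rintegral_cst; last exact: measurable_itv.
by congr (_ * _); exact: (congr1 fine mu_period).
Qed.

(** The tolerance [dl] depends on p2: a constant gives the Lipschitz estimate, and a function that
    is large on the slow set gives the modulus of continuity. *)
Lemma collision_dist (g g' : R -> R) (M : R) (dl : R -> R) (p0 : R) :
  measurable_fun setT g -> measurable_fun setT g' -> 0 <= M ->
  0 <= p0 <= 2 * pi ->
  mu.-integrable `[0, 2 * pi] (EFin \o dl) -> (forall p2, 0 <= dl p2) ->
  (\forall p2 \ae mu, 0 <= p2 <= 2 * pi -> forall q, q \in quad p0 p2 ->
     [/\ `|g q| <= M * wt q, `|g' q| <= M * wt q & `|g q - g' q| <= dl p2 * wt q]) ->
  `|collision g p0 - collision g' p0| <=
  12 * K * M ^+ 2 * wt p0 * \int[mu]_(p2 in `[0, 2 * pi]) dl p2.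
Proof.
move=> mg mg' M0 h0 dli dl0 H; rewrite !collisionE.
have mI : measurable (`[0, 2 * pi]%classic : set (measurableTypeR R)) by exact: measurable_itv.
have mc (f : R -> R) : measurable_fun setT f ->
    measurable_fun (`[0, 2 * pi]%classic : set (measurableTypeR R)) (cint f p0).
  move=> mf; apply: measurable_funTS.
  apply: (@measurable_fun_cint _ _ (measurableTypeR R) (fun u => f u.2)) => //.
  by apply: (measurableT_comp mf); exact: measurable_snd.
rewrite -RintegralZl//; apply: (@Rintegral_dist _ _ _ _ _ _ _ _ (12 * K * M ^+ 2 * M * wt p0)) => //.
- exact: lebesgue_period_fin.
- exact: mc.
- exact: mc.
- have := integrableZl mI (12 * K * M ^+ 2 * wt p0) dli.
  by congr integrable; apply/funext => p2 /=; rewrite EFinM.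
- move=> p2 _; rewrite !mulr_ge0 ?wt_ge0 ?(ltW (kconst_gt0 _))//.
apply: filterS H => p2 + hp2; have h2 : 0 <= p2 <= 2 * pi by move: hp2; rewrite /= in_itv.
move=> /(_ h2) H; split.
- rewrite -[cint g p0 p2]subr0 -[X in _ - X](cint0 p0 p2); apply: cint_diff => // q /H[h _ _].
  by rewrite normr0 subr0; split => //; rewrite mulr_ge0 ?wt_ge0.
- rewrite -[cint g' p0 p2]subr0 -[X in _ - X](cint0 p0 p2); apply: cint_diff => // q /H[_ h _].
  by rewrite normr0 subr0; split => //; rewrite mulr_ge0 ?wt_ge0.
- rewrite mulrAC; exact: cint_diff.
Qed.

(** [red] is a translation on each of the countably many periods, hence expanding with constant 1
    there. *)
Lemma ae_red (P : R -> Prop) : (\forall p \ae mu, 0 <= p <= 2 * pi -> P p) ->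
  \forall q \ae mu, P (red q).
Proof.
move=> H; pose N := ~` [set p | 0 <= p <= 2 * pi -> P p].
have NN : mu.-negligible N by [].
pose D (k : int) : set R := [set q | Num.floor (q / (2 * pi)) = k].
have Dk k : mu.-negligible [set q | D k q /\ N (red q)].
  apply: (negligible_expanding (c := 1)) NN => // x y Dx Dy.
  by rewrite mul1r (_ : red x - red y = x - y)// /red Dx Dy; ring.
(* An enumeration of the integers, since countable unions of null sets are indexed by [nat]. *)
pose e (n : nat) : int := if odd n then Negz n./2 else Posz n./2.
have := negligible_bigcup (mu := mu) (fun n => Dk (e n)).
apply: negligibleS => q /= nP.
pose k := Num.floor (q / (2 * pi)).
have [n en] : exists n, e n = k.
  case: k => k; first by exists k.*2; rewrite /e odd_double doubleK.
  by exists k.*2.+1; rewrite /e /= odd_double /= uphalf_double.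
exists n => //; split; first by rewrite /D/= en.
move=> h; apply: nP; apply: h.
by have /andP[-> /ltW ->] := red_itv q.
Qed.

(** For almost every (x, p0), the bounds hold at p0 and, for almost every p2, at p1, p2 and p3. The
    factor 24 pi is 12 times the length of the period. *)
Lemma collision_ae (f f' : phase R -> R) (M D : R) : 0 <= M -> 0 <= D ->
  measurable_fun setT f -> measurable_fun setT f' -> periodic_p f -> periodic_p f' ->
  {ae phase_measure, forall z : phase R, [/\ `|f z| <= M * wt z.2, `|f' z| <= M * wt z.2 &
      `|f z - f' z| <= D * wt z.2]} ->
  {ae phase_measure, forall z : phase R,
    `|collision_xp f z - collision_xp f' z| <= 24 * pi * K * M ^+ 2 * D * wt z.2}.
Proof.
move=> M0 D0 mf mf' pf pf' H.
have msec (g : phase R -> R) x : measurable_fun setT g -> measurable_fun setT (fun p : R => g (x, p)).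
  by move=> mg; apply: (measurableT_comp mg); exact: pair1_measurable.
have mcoll (g : phase R -> R) : measurable_fun setT g -> measurable_fun setT (collision_xp g).
  move=> mg.
  apply: (@measurable_fun_collision _ (phase R) R (fun u => g (u.1.1, u.2)) snd); last exact: measurable_snd.
  apply: (measurableT_comp mg); apply: measurable_fun_pair; last exact: measurable_snd.
  by apply: (measurableT_comp measurable_fst); exact: measurable_fst.
apply: (prod_ae1 (m1 := @lebesgue_measure R) (m2 := @torus_measure R)).
  rewrite -[X in measurable X]setTI.
  apply: (measurable_fun_ler (f := fun z : phase R => `|collision_xp f z - collision_xp f' z|)) => //.
    by apply: measurable_fun_norm; apply: measurable_funB; exact: mcoll.
  apply: measurable_funM => //; apply: measurable_fun_wt; exact: measurable_snd.
have {}H := ae_prod1 (m1 := @lebesgue_measure R) (m2 := @torus_measure R) H.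
apply: filterS H => x /ae_torus/ae_red H.
apply/ae_torus.
pose G q := [/\ `|f (x, q)| <= M * wt q, `|f' (x, q)| <= M * wt q & `|f (x, q) - f' (x, q)| <= D * wt q].
(* The momenta p1 and p3 may leave the fundamental period, so the bounds are extended to almost
   every real q. *)
have HG : \forall q \ae mu, G q.
  apply: filterS H => q /=; rewrite wt_red.
  have pr (g : phase R -> R) : periodic_p g -> g (x, red q) = g (x, q).
    by move=> pg; exact: (@periodic_red R (fun q => g (x, q)) q (fun r => pg x r)).
  by rewrite !pr.
have Hh := hres_null HG.
(* Both orders of sections are used: the first for p1 = h(p0, p2), the second for p3 = h(p2, p0). *)
have H1 := ae_prod1 (m1 := @lebesgue_measure R) (m2 := @lebesgue_measure R) Hh.
have H2 := ae_prod2 (m1 := @lebesgue_measure R) (m2 := @lebesgue_measure R) Hh.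
have HG' := HG; apply: filterS3 HG' H1 H2 => p0 G0 Hp1 Hp3 h0.
have := @collision_dist (fun q => f (x, q)) (fun q => f' (x, q)) M (fun=> D) p0 (msec _ _ mf) (msec _ _ mf') M0 h0.
rewrite Rintegral_period_cst.
have -> : 12 * K * M ^+ 2 * wt p0 * (D * (2 * pi)) = 24 * pi * K * M ^+ 2 * D * wt p0 by ring.
apply => //.
  apply: (@ae_bounded_integrable _ _ _ mu _ _ D); [exact: measurable_itv|exact: lebesgue_period_fin|by []|].
  by apply: aeW => ? _; rewrite ger0_norm.
apply: filterS3 HG Hp1 Hp3 => p2 G2 G1 G3 h2 q; rewrite !inE => /or4P[] /eqP -> //.
- by apply: contrapT; apply: G1.
- by rewrite p3of_hres; apply: contrapT; apply: G3.
Qed.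

Lemma ae_shift (P : phase R -> Prop) (t : R) : {ae phase_measure, forall z : phase R, P z} ->
  {ae phase_measure, forall z : phase R, P (z.1 - vel z.2 * t, z.2)}.
Proof.
move=> [N [mN N0 PN]].
suff : {ae phase_measure, forall z : phase R, ~ N (z.1 - vel z.2 * t, z.2)}.
  by apply: filterS => z nN; apply: contrapT => /PN.
have NN : {ae phase_measure, forall z : phase R, ~ N z}.
  by exists N; split => // z /= /contrapT.
have H := ae_prod2 (m1 := @lebesgue_measure R) (m2 := @torus_measure R) NN.
apply: (prod_ae2 (m1 := @lebesgue_measure R) (m2 := @torus_measure R)).
  apply: measurableC; rewrite -[X in measurable X]setTI.
  have : measurable_fun setT (fun z : phase R => ((z.1 - vel z.2 * t, z.2) : phase R)).
    apply: measurable_fun_pair; last exact: measurable_snd.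
    apply: measurable_funB; first exact: measurable_fst.
    by apply: measurable_funM => //; apply: measurable_fun_vel; exact: measurable_snd.
  by apply.
apply: filterS H => p Hp.
have Hp' : mu.-negligible [set x | ~ ~ N (x, p)] by [].
have := negligible_expanding (phi := fun x => x - vel p * t) (D := setT) ltr01 _ Hp'.
have e : forall y z : R, setT y -> setT z -> 1 * `|y - z| <= `|y - vel p * t - (z - vel p * t)|.
  by move=> y z _ _; rewrite mul1r; have -> : y - vel p * t - (z - vel p * t) = y - z by ring.
by move=> /(_ e); apply: negligibleS => x /= h; split.
Qed.

Lemma ae_interior : {ae phase_measure, forall z : phase R, 0 < z.2 < 2 * pi}.
Proof.
apply: (prod_ae2 (m1 := @lebesgue_measure R) (m2 := @torus_measure R)).
  rewrite -[X in measurable X]setTI.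
  apply: (measurable_and (f := fun z : phase R => 0 < z.2) (g := fun z : phase R => z.2 < 2 * pi)) => //.
    by apply: measurable_fun_ltr => //; exact: measurable_snd.
  by apply: measurable_fun_ltr => //; exact: measurable_snd.
suff : \forall p \ae (@torus_measure R), 0 < p < 2 * pi.
  by apply: filterS => p hp; apply: aeW.
apply/ae_torus.
have F : mu.-negligible [set 0; 2 * pi].
  by repeat apply: negligibleU; apply/negligibleP => //; exact: lebesgue_measure_set1.
apply: negligibleS F => p /= /not_implyP[hp np].
have [->|p0] := eqVneq p 0; first by left.
have [->|p2] := eqVneq p (2 * pi); first by right.
by exfalso; apply: np; rewrite !lt_neqAle eq_sym p0 p2.
Qed.

(** The exceptional set at each time may depend on the time; after the exchange, almost every z sees
    a bound valid for almost every time, ready for integration in time. *)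
Lemma ae_time (P : set (measurableTypeR R * phase R)) : measurable P ->
  (\forall s \ae mu, {ae phase_measure, forall z : phase R, P (s, z)}) ->
  {ae phase_measure, forall z : phase R, \forall s \ae mu, P (s, z)}.
Proof.
move=> mP H.
apply: (ae_prod2 (m1 := @lebesgue_measure R) (m2 := @phase_sf R)).
exact: (prod_ae1 (m1 := @lebesgue_measure R) (m2 := @phase_sf R)).
Qed.

End collision_bounds.

(** * Integrals of exponentials and the Gronwall bounds *)

Section exponential_integral.
Context {R : realType}.
Local Notation mu := (@lebesgue_measure R).

Lemma itv_fin (t : R) : (mu `[0%R, t]%classic < +oo)%E.
Proof. by rewrite lebesgue_measure_itv/=; case: ifP; rewrite ?ltry// -EFinD ltry. Qed.

Lemma fine_mu_itv (t : R) : 0 <= t -> fine (mu `[0%R, t]%classic) = t.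
Proof.
move=> t0; rewrite lebesgue_measure_itv/= lte_fin; case: ltP => h.
  by rewrite oppr0 adde0.
by apply/eqP; rewrite eq_le t0.
Qed.

Lemma Rintegral_itv_cst (t r : R) : 0 <= t -> \int[mu]_(_ in `[0, t]) r = r * t.
Proof.
move=> t0; rewrite Rintegral_cst; last exact: measurable_itv.
by congr (_ * _); exact: fine_mu_itv.
Qed.

Lemma continuous_itv_integrable (f : R -> R) (t : R) : continuous f ->
  mu.-integrable `[0, t] (EFin \o f).
Proof.
move=> cf; apply: continuous_compact_integrable; first exact: segment_compact.
exact: continuous_subspaceT.
Qed.

Lemma continuous_exp_lin (a l : R) : continuous (fun s => a * expR (l * s)).
Proof.
move=> s; apply: cvgM; first exact: cvg_cst.
apply: (@continuous_comp _ _ _ (fun s => l * s) expR); last exact: continuous_expR.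
by apply: mulrl_continuous.
Qed.

Lemma Rintegral_exp (a l t : R) : 0 < l -> 0 <= t ->
  \int[mu]_(s in `[0, t]) (a * expR (l * s)) = a / l * (expR (l * t) - 1).
Proof.
move=> l0; rewrite le_eqVlt => /predU1P[<-|t0].
  by rewrite set_itv1 Rintegral_set1 mulr0 expR0 subrr mulr0.
have dF (s : R) : is_derive s 1 (fun s : R => a / l * expR (l * s)) (a * expR (l * s)).
  have h1 : is_derive s 1 (fun s : R => l * s) l.
    by apply: is_derive_eq; rewrite /GRing.scale/=; ring.
  have h2 := is_derive1_comp (is_derive_expR (l * s)) h1.
  have h3 : is_derive s 1 (fun s : R => a / l * expR (l * s)) (a / l * (expR (l * s) * l)).
    exact: is_deriveZ.
  by apply: is_derive_eq; field; rewrite gt_eqF.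
rewrite /Rintegral (@continuous_FTC2 _ (fun s => a * expR (l * s)) (fun s => a / l * expR (l * s))) //.
- by rewrite /= mulr0 expR0; ring.
- exact/continuous_subspaceT/continuous_exp_lin.
- have c := @continuous_exp_lin (a / l) l.
  split => [s _| |]; first by have [] := dF s.
    by apply: cvg_at_right_filter; exact: c.
  by apply: cvg_at_left_filter; exact: c.
- by move=> s _; rewrite derive1E; have [_] := dF s.
Qed.

(* Bounds of an iterated Gronwall argument started from the trivial bound [A]:
   with the rate 2L in place of L, each iteration halves [A]. *)
Definition gronwall_seq (E A L : R) (n : nat) (s : R) : R :=
  (2 * E + A * 2^-1 ^+ n) * expR (2 * L * s).

(** Integrating exp(2 L s) gives a factor 1 / (2 L), so multiplication by L halves the prefactor: 2
    E becomes E, which together with the source E makes 2 E again, and the A part is halved. *)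
Lemma gronwall_seq_step (E A L t : R) (n : nat) : 0 <= E -> 0 <= A -> 0 < L -> 0 <= t ->
  E + L * \int[mu]_(s in `[0, t]) gronwall_seq E A L n s <= gronwall_seq E A L n.+1 t.
Proof.
move=> E0 A0 L0 t0; rewrite Rintegral_exp//; last by rewrite mulr_gt0.
rewrite /gronwall_seq exprS.
have e1 : 1 <= expR (2 * L * t) by rewrite -expR0 ler_expR !mulr_ge0// ltW.
have p0 : 0 <= A * 2^-1 ^+ n by rewrite mulr_ge0// exprn_ge0// invr_ge0.
move: (expR _) (A * _) (mulrCA A 2^-1 (2^-1 ^+ n)) e1 p0 => X Y -> X1 Y0.
have -> : L * ((2 * E + Y) / (2 * L) * (X - 1)) = (E + Y / 2) * (X - 1).
  by field; rewrite gt_eqF.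
nra.
Qed.

Lemma gronwall_seq_limit (E A L t x w : R) : 0 <= w ->
  (forall n, x <= gronwall_seq E A L n t * w) -> x <= 2 * E * expR (2 * L * t) * w.
Proof.
move=> w0 H; apply/ler_addgt0Pr => e e0.
have [n hn] : exists n : nat, `|A| * expR (2 * L * t) * w * 2^-1 ^+ n < e.
  have /cvgrPdist_lt/(_ e e0)[n _ /(_ n (leqnn _))] := @cvg_geometric R (`|A| * expR (2 * L * t) * w) 2^-1 ltac:(by rewrite ger0_norm ?invr_ge0// invf_lt1// ltrDl).
  rewrite /geometric/= sub0r normrN => h; exists n; apply: le_lt_trans h; exact: ler_norm.
apply: (le_trans (H n)); rewrite /gronwall_seq.
have : A * 2^-1 ^+ n * expR (2 * L * t) * w <= `|A| * 2^-1 ^+ n * expR (2 * L * t) * w.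
  by rewrite !ler_wpM2r ?expR_ge0// ?exprn_ge0 ?invr_ge0// ler_norm.
have -> : `|A| * 2^-1 ^+ n * expR (2 * L * t) * w = `|A| * expR (2 * L * t) * w * 2^-1 ^+ n by ring.
move=> h3; rewrite [leLHS](_ : _ = 2 * E * expR (2 * L * t) * w + A * 2^-1 ^+ n * expR (2 * L * t) * w); last by ring.
by move: hn h3; lra.
Qed.

Lemma gronwall_seq_ge0 (E A L : R) n s : 0 <= E -> 0 <= A -> 0 <= gronwall_seq E A L n s.
Proof.
move=> E0 A0; rewrite mulr_ge0 ?expR_ge0// addr_ge0// mulr_ge0// exprn_ge0// invr_ge0//.
Qed.

End exponential_integral.

(** * The Duhamel term and its pointwise estimates *)

Section duhamel.
Context {R : realType} (alpha : R).
Hypothesis alpha1 : alpha <= 1.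
Local Notation mu := (@lebesgue_measure R).
Local Notation wt := (wt alpha).
Implicit Types (f : phase R -> R) (F G : R -> phase R -> R) (z : phase R).

(* Reducing the momentum makes the integrand of the Duhamel term periodic:
   [collision] is only meaningful on [0, 2pi]. *)
Definition along F t z s : R :=
  collision (fun q => F s (z.1 - vel z.2 * (t - s), q)) (red z.2).

Definition duhamel F t z : R := \int[mu]_(s in `[0, t]) along F t z s.

Definition mildmap f F t z : R := f (z.1 - vel z.2 * t, z.2) + duhamel F t z.

Definition joint F :=
  measurable_fun setT (fun u : measurableTypeR R * phase R => F u.1 u.2).

Lemma measurable_section2 d1 d2 d3 (T1 : measurableType d1) (T2 : measurableType d2)
    (T3 : measurableType d3) (h : T1 * T2 -> T3) x :
  measurable_fun setT h -> measurable_fun setT (fun y => h (x, y)).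
Proof. by move=> mh; apply: (measurableT_comp mh); exact: pair1_measurable. Qed.

Lemma joint_comp F d (T : measurableType d) (a b c : T -> R) : joint F ->
  measurable_fun setT a -> measurable_fun setT b -> measurable_fun setT c ->
  measurable_fun setT (fun w => F (a w) (b w, c w)).
Proof.
move=> jF ma mb mc.
have mg : measurable_fun setT (fun w => ((a w, (b w, c w)) : measurableTypeR R * phase R)).
  by apply: measurable_fun_pair => //; exact: measurable_fun_pair.
exact: (measurableT_comp jF mg).
Qed.

Lemma joint_section F t : joint F -> measurable_fun setT (F t).
Proof. by move=> jF; exact: (measurable_section2 (t : measurableTypeR R) jF). Qed.

Lemma joint_slice F t (x : R) : joint F -> measurable_fun setT (fun q : R => F t (x, q)).
Proof.
by move=> jF; exact: (measurable_section2 (x : measurableTypeR R) (joint_section t jF)).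
Qed.

Lemma joint_along F : joint F ->
  measurable_fun setT (fun u : (measurableTypeR R * phase R) * measurableTypeR R => along F u.1.1 u.1.2 u.2).
Proof.
move=> jF; pose T := ((measurableTypeR R * phase R) * measurableTypeR R)%type.
have m1 : measurable_fun setT (fun u : T => u.1) by exact: measurable_fst.
have m2 : measurable_fun setT (fun u : T => u.2) by exact: measurable_snd.
have m11 : measurable_fun setT (fun u : T => u.1.1) by exact: (measurableT_comp measurable_fst m1).
have m12 : measurable_fun setT (fun u : T => u.1.2) by exact: (measurableT_comp measurable_snd m1).
have m121 : measurable_fun setT (fun u : T => u.1.2.1) by exact: (measurableT_comp measurable_fst m12).
have m122 : measurable_fun setT (fun u : T => u.1.2.2) by exact: (measurableT_comp measurable_snd m12).
apply: (@measurable_fun_collision _ T R (fun w => F w.1.2 (w.1.1.2.1 - vel w.1.1.2.2 * (w.1.1.1 - w.1.2), w.2)) (fun u => red u.1.2.2)).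
  have f1 (h : T -> R) : measurable_fun setT h -> measurable_fun setT (fun w : T * measurableTypeR R => h w.1).
    by move=> mh; apply: (measurableT_comp mh); exact: measurable_fst.
  apply: joint_comp => //; first exact: (f1 _ m2).
  apply: measurable_funB; first exact: (f1 _ m121).
  apply: measurable_funM; first exact: (measurable_fun_vel (f1 _ m122)).
  by apply: measurable_funB; [exact: (f1 _ m11)|exact: (f1 _ m2)].
exact: measurable_fun_red.
Qed.

Lemma measurable_along F t z : joint F -> measurable_fun setT (along F t z : measurableTypeR R -> R).
Proof.
by move=> /joint_along; exact: (measurable_section2 ((t, z) : measurableTypeR R * phase R)).
Qed.

Lemma joint_mildmap f F : measurable_fun setT f -> joint F -> joint (mildmap f F).
Proof.
move=> mf jF.
have m1 : measurable_fun setT (fun u : measurableTypeR R * phase R => u.1) by exact: measurable_fst.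
have m2 : measurable_fun setT (fun u : measurableTypeR R * phase R => u.2) by exact: measurable_snd.
have m21 : measurable_fun setT (fun u : measurableTypeR R * phase R => u.2.1) by exact: (measurableT_comp measurable_fst m2).
have m22 : measurable_fun setT (fun u : measurableTypeR R * phase R => u.2.2) by exact: (measurableT_comp measurable_snd m2).
apply: measurable_funD.
  apply: (measurableT_comp mf); apply: measurable_fun_pair => //.
  by apply: measurable_funB => //; apply: measurable_funM => //; exact: (measurable_fun_vel m22).
exact: (@measurable_fun_Rintegral_itv _ (measurableTypeR R * phase R)%type R
  (fun w => along F w.1.1 w.1.2 w.2) (fun=> 0) (fun u => u.1) (joint_along jF)).
Qed.

Lemma mildmap_periodic f F t : periodic_p f -> periodic_p (mildmap f F t).
Proof.
move=> pf x p; rewrite /mildmap/= pf.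
have v : vel (p + 2 * pi) = vel p by rewrite /vel red_period.
rewrite v; apply: (congr1 (+%R _)); apply: eq_Rintegral => s _.
by rewrite /along [(x, _).2]/= v red_period.
Qed.

Lemma duhamel_dist F G t z z' (A : R) (b : R -> R) : 0 <= t -> joint F -> joint G ->
  mu.-integrable `[0, t] (EFin \o b) -> (forall s, 0 <= b s) ->
  (\forall s \ae mu, 0 <= s <= t -> [/\ `|along F t z s| <= A, `|along G t z' s| <= A &
     `|along F t z s - along G t z' s| <= b s]) ->
  `|duhamel F t z - duhamel G t z'| <= \int[mu]_(s in `[0, t]) b s.
Proof.
move=> t0 jF jG bi b0 H.
have mI : measurable (`[0, t]%classic : set (measurableTypeR R)) by exact: measurable_itv.
apply: (@Rintegral_dist _ _ _ _ _ _ _ _ A) => //.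
- exact: itv_fin.
- by apply: measurable_funTS; exact: measurable_along.
- by apply: measurable_funTS; exact: measurable_along.
Qed.

(** Lipschitz constant of the collision operator on |f| <= M [wt]: the factor 12 of [cint_diff]
    times the period 2 pi. *)
Definition lip (M : R) : R := 24 * pi * kconst alpha * M ^+ 2.

Lemma lip_ge0 M : 0 <= lip M.
Proof. by rewrite /lip mulr_ge0 ?sqr_ge0// mulr_ge0 ?(ltW (kconst_gt0 _))// mulr_ge0 ?pi_ge0. Qed.

Lemma collision_dist_cst (g g' : R -> R) (M D p : R) :
  measurable_fun setT g -> measurable_fun setT g' -> 0 <= M -> 0 <= D ->
  (forall q, [/\ `|g q| <= M * wt q, `|g' q| <= M * wt q & `|g q - g' q| <= D * wt q]) ->
  `|collision g (red p) - collision g' (red p)| <= lip M * D * wt p.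
Proof.
move=> mg mg' M0 D0 H.
have h0 : 0 <= red p <= 2 * pi by have /andP[-> /ltW ->] := red_itv p.
have := @collision_dist _ _ alpha1 g g' M (fun=> D) (red p) mg mg' M0 h0.
rewrite Rintegral_period_cst wt_red /lip.
have -> : 12 * kconst alpha * M ^+ 2 * wt p * (D * (2 * pi)) = 24 * pi * kconst alpha * M ^+ 2 * D * wt p by ring.
apply => //; last by apply: aeW => p2 _ q _.
apply: (@ae_bounded_integrable _ _ _ mu _ _ D); [exact: measurable_itv|exact: lebesgue_period_fin|by []|].
by apply: aeW => ? _; rewrite ger0_norm.
Qed.

Lemma collision_bound (g : R -> R) (M p : R) :
  measurable_fun setT g -> 0 <= M -> (forall q, `|g q| <= M * wt q) ->
  `|collision g (red p)| <= lip M * M * wt p.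
Proof.
move=> mg M0 H; rewrite -[collision _ _]subr0 -(collision0 (red p)).
apply: collision_dist_cst => // q; rewrite normr0 subr0.
by split => //; rewrite mulr_ge0 ?wt_ge0.
Qed.

Definition bounded_on F (T M : R) :=
  forall s, 0 <= s <= T -> forall z, `|F s z| <= M * wt z.2.

Lemma along_bound F T M t z s : joint F -> 0 <= M -> bounded_on F T M ->
  0 <= s <= T -> `|along F t z s| <= lip M * M * wt z.2.
Proof.
move=> jF M0 bF hs; apply: collision_bound => //; first exact: joint_slice.
by move=> q; exact: bF.
Qed.

Lemma duhamel_dist_unif F G T M D t z : joint F -> joint G -> 0 <= M -> 0 <= D ->
  bounded_on F T M -> bounded_on G T M ->
  (forall s, 0 <= s <= T -> forall z, `|F s z - G s z| <= D * wt z.2) ->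
  0 <= t <= T -> `|duhamel F t z - duhamel G t z| <= t * lip M * D * wt z.2.
Proof.
move=> jF jG M0 D0 bF bG H /andP[t0 tT].
have w0 := wt_ge0 alpha z.2.
have -> : t * lip M * D * wt z.2 = lip M * D * wt z.2 * t by ring.
rewrite -Rintegral_itv_cst//; apply: (@duhamel_dist _ _ _ _ _ (lip M * M * wt z.2)) => //.
- by apply: continuous_itv_integrable; exact: cst_continuous.
- by move=> _; exact: (mulr_ge0 (mulr_ge0 (lip_ge0 M) D0) w0).
apply: aeW => s /andP[s0 st].
have hs : 0 <= s <= T by rewrite s0 (le_trans st).
split; [exact: (along_bound _ _ jF M0 bF)|exact: (along_bound _ _ jG M0 bG)|].
by apply: collision_dist_cst => //; [exact: joint_slice|exact: joint_slice|move=> q; split; [exact: bF|exact: bG|exact: H]].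
Qed.

Lemma joint0 : joint (fun _ _ => 0). Proof. exact: measurable_cst. Qed.

Lemma along0 t z s : along (fun _ _ => 0) t z s = 0.
Proof. exact: collision0. Qed.

Lemma duhamel0 t z : duhamel (fun _ _ => 0) t z = 0.
Proof.
rewrite /duhamel (_ : (fun s => along _ t z s) = fun=> 0).
  by rewrite /Rintegral integral0.
by apply/funext => s; exact: along0.
Qed.

Lemma duhamel_bound F T M t z : joint F -> 0 <= M -> bounded_on F T M ->
  0 <= t <= T -> `|duhamel F t z| <= t * lip M * M * wt z.2.
Proof.
move=> jF M0 bF ht; rewrite -[duhamel _ _ _]subr0 -(duhamel0 t z).
apply: (@duhamel_dist_unif _ _ T) => //; first exact: joint0.
  by move=> s hs y; rewrite normr0 mulr_ge0 ?wt_ge0.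
by move=> s hs y; rewrite subr0; exact: bF.
Qed.

End duhamel.

(** * Existence by Picard iteration *)

Section picard.
Context {R : realType} (alpha : R).
Hypothesis alpha1 : alpha <= 1.
Local Notation mu := (@lebesgue_measure R).
Local Notation wt := (wt alpha).
Local Notation lip := (lip alpha).
Implicit Types (f : phase R -> R) (F G : R -> phase R -> R) (z : phase R).

(** Bound and equation hold at every point, so that the iteration has no exceptional sets to follow
    through the collision. *)
Definition mild_everywhere f (T M : R) F :=
  [/\ joint F, forall t, periodic_p (F t), bounded_on alpha F T M &
      forall t, 0 <= t <= T -> forall z, F t z = mildmap f F t z].

Section iteration.
Variables (f : phase R -> R) (T M : R).
Hypotheses (mf : measurable_fun setT f) (pf : periodic_p f).
Hypotheses (M0 : 0 <= M) (T0 : 0 <= T) (bf : forall z, `|f z| <= M * wt z.2).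
Hypothesis (small : T * lip (2 * M) <= 2^-1).

Let M20 : 0 <= 2 * M. Proof. by rewrite mulr_ge0. Qed.

Let small_t t : 0 <= t <= T -> 0 <= t * lip (2 * M) <= 2^-1.
Proof.
move=> /andP[t0 tT]; rewrite mulr_ge0 ?lip_ge0//=.
by rewrite (le_trans _ small)// ler_wpM2r// lip_ge0.
Qed.

Definition picard n : R -> phase R -> R := iter n (mildmap f) (fun _ _ => 0).

Lemma picard_joint n : joint (picard n).
Proof. by elim: n => [|n IH]; [exact: joint0|exact: joint_mildmap]. Qed.

Lemma picard_periodic n t : periodic_p (picard n t).
Proof. by case: n => [x p|n]; [|exact: (mildmap_periodic (picard n) t pf)]. Qed.

(** The datum contributes M and, by [small], the Duhamel term at most half of 2 M. *)
Lemma mildmap_bounded F : joint F -> bounded_on alpha F T (2 * M) ->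
  bounded_on alpha (mildmap f F) T (2 * M).
Proof.
move=> jF bF t ht z; have w0 := wt_ge0 alpha z.2.
have /andP[s0 s1] := small_t ht.
apply: (le_trans (ler_normD _ _)).
have h1 := bf (z.1 - vel z.2 * t, z.2); rewrite /= in h1.
have h2 := @duhamel_bound _ _ alpha1 F T (2 * M) t z jF M20 bF ht.
have h3 : t * lip (2 * M) * (2 * M) * wt z.2 <= 2^-1 * (2 * M) * wt z.2.
  by apply: ler_wpM2r => //; apply: ler_wpM2r => //; exact: M20.
by move: h1 h2 h3; move: (wt z.2) (lip _) => *; lra.
Qed.

Lemma picard_bounded n : bounded_on alpha (picard n) T (2 * M).
Proof.
elim: n => [|n IH]; first by move=> s hs z; rewrite normr0 !mulr_ge0// wt_ge0.
by apply: mildmap_bounded => //; exact: picard_joint.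
Qed.

Lemma picard_step n t z : 0 <= t <= T ->
  `|picard n.+1 t z - picard n t z| <= 2 * M * 2^-1 ^+ n * wt z.2.
Proof.
elim: n t z => [|n IH] t z ht.
  by rewrite subr0 expr0 mulr1; exact: (@picard_bounded 1).
have w0 := wt_ge0 alpha z.2; have /andP[s0 s1] := small_t ht.
rewrite [picard n.+2]/(mildmap f (picard n.+1)) [X in _ - X t z]/(mildmap f (picard n)).
rewrite /mildmap opprD addrACA subrr add0r.
have D0 : 0 <= 2 * M * 2^-1 ^+ n by apply: mulr_ge0 => //; rewrite exprn_ge0// invr_ge0.
have := @duhamel_dist_unif _ _ alpha1 (picard n.+1) (picard n) T (2 * M) _ t z (picard_joint _) (picard_joint _) M20 D0 (@picard_bounded _) (@picard_bounded _) (fun s hs y => IH s y hs) ht.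
move=> /le_trans; apply; rewrite ler_wpM2r// exprS.
have -> : 2 * M * (2^-1 * 2^-1 ^+ n) = 2^-1 * (2 * M * 2^-1 ^+ n) by ring.
by rewrite ler_wpM2r.
Qed.

Lemma picard_dist n m t z : 0 <= t <= T ->
  `|picard (n + m) t z - picard n t z| <= 4 * M * 2^-1 ^+ n * wt z.2.
Proof.
move=> ht; have w0 := wt_ge0 alpha z.2.
suff : `|picard (n + m) t z - picard n t z| <= 4 * M * (2^-1 ^+ n - 2^-1 ^+ (n + m)) * wt z.2.
  move=> /le_trans; apply; rewrite ler_wpM2r// ler_wpM2l ?mulr_ge0//.
  by rewrite lerBlDr lerDl exprn_ge0// invr_ge0.
elim: m => [|m IH]; first by rewrite addn0 !subrr normr0 mulr0 mul0r.
rewrite addnS -(subrKA (picard (n + m) t z)).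
apply: (le_trans (ler_normD _ _)); apply: (le_trans (lerD (picard_step _ _ ht) IH)).
rewrite -mulrDl ler_wpM2r// exprS le_eqVlt; apply/orP; left; apply/eqP.
by field.
Qed.

Lemma geometric_small (C e : R) : 0 < e -> exists n : nat, C * 2^-1 ^+ n < e.
Proof.
move=> e0.
have /cvgrPdist_lt/(_ e e0)[n _ /(_ n (leqnn _))] := @cvg_geometric R C 2^-1 ltac:(by rewrite ger0_norm ?invr_ge0// invf_lt1// ltrDl).
rewrite /geometric/= sub0r normrN => h; exists n; apply: le_lt_trans h; exact: ler_norm.
Qed.

Lemma picard_cvg t z : 0 <= t <= T -> cvgn (fun n => picard n t z).
Proof.
move=> ht; apply: cauchy_cvg; apply: cauchy_exP => e e0.
have [n hn] := geometric_small (4 * M * wt z.2) e0.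
exists (picard n t z); exists n => // m /= nm.
rewrite /ball/= distrC -(subnKC nm); apply: (le_lt_trans (picard_dist _ _ _ ht)).
by rewrite mulrAC.
Qed.

(** Convergence is established on [0, T]; the value 0 elsewhere makes the limit jointly measurable
    over all times. *)
Definition picard_limit t z : R :=
  if (0 <= t) && (t <= T) then limn (fun n => picard n t z) else 0.

Lemma picard_limit_dist n t z : 0 <= t <= T ->
  `|picard_limit t z - picard n t z| <= 4 * M * 2^-1 ^+ n * wt z.2.
Proof.
move=> ht; rewrite /picard_limit ht.
have cv : (fun m => `|picard m t z - picard n t z|) @ \oo --> `|limn (fun n => picard n t z) - picard n t z|.
  by apply: cvg_norm; apply: cvgB; [exact: picard_cvg|exact: cvg_cst].
rewrite -(cvg_lim _ cv)//; apply: limr_le; first by apply/cvg_ex; eexists; exact: cv.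
exists n => // m /= nm; rewrite -(subnKC nm); exact: picard_dist.
Qed.

Lemma picard_limit_joint : joint picard_limit.
Proof.
pose h n (u : measurableTypeR R * phase R) := if (0 <= u.1) && (u.1 <= T) then picard n u.1 u.2 else 0.
apply: (@measurable_fun_cvg _ _ _ _ h) => [n|[t z] _].
  apply: measurable_fun_ifT => //; last exact: picard_joint.
  by apply: measurable_and; apply: measurable_fun_ler => //; exact: measurable_fst.
rewrite /h /picard_limit/=; case: ifP => ht; last exact: cvg_cst.
exact: picard_cvg.
Qed.

Lemma picard_limit_bounded : bounded_on alpha picard_limit T (2 * M).
Proof.
move=> t ht z; have w0 := wt_ge0 alpha z.2; apply/ler_addgt0Pr => e e0.
have [n hn] := geometric_small (4 * M * wt z.2) e0.
have h1 := picard_limit_dist n z ht; have h2 := @picard_bounded n t ht z.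
rewrite -(subrK (picard n t z) (picard_limit t z)); apply: (le_trans (ler_normD _ _)).
rewrite mulrAC in h1; lra.
Qed.

Lemma picard_limit_mild : mild_everywhere f T (2 * M) picard_limit.
Proof.
split.
- exact: picard_limit_joint.
- move=> t x p; rewrite /picard_limit; case: ifP => // _; congr (lim _).
  by apply/funext => A/=; congr (nbhs _ _); apply/funext => n; rewrite /= picard_periodic.
- exact: picard_limit_bounded.
move=> t ht z; apply/eqP; rewrite -subr_eq0 -normr_le0; apply/ler_addgt0Pr => e e0; rewrite add0r.
have w0 := wt_ge0 alpha z.2; have /andP[s0 s1] := small_t ht.
have e2 : 0 < e / 2 by rewrite divr_gt0.
have [n hn] := geometric_small (4 * M * wt z.2) e2.
have h1 := picard_limit_dist n.+1 z ht.
have D0 : 0 <= 4 * M * 2^-1 ^+ n by rewrite !mulr_ge0// exprn_ge0// invr_ge0.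
have h2 := @duhamel_dist_unif _ _ alpha1 (picard n) picard_limit T (2 * M) _ t z (picard_joint _) picard_limit_joint M20 D0 (@picard_bounded _) picard_limit_bounded (fun s hs y => ltac:(rewrite distrC; exact: picard_limit_dist)) ht.
have h3 : t * lip (2 * M) * (4 * M * 2^-1 ^+ n) * wt z.2 <= 2^-1 * (4 * M * 2^-1 ^+ n) * wt z.2.
  by rewrite ler_wpM2r// ler_wpM2r.
rewrite -(subrKA (picard n.+1 t z)); apply: (le_trans (ler_normD _ _)).
have -> : picard n.+1 t z - mildmap f picard_limit t z = duhamel (picard n) t z - duhamel picard_limit t z.
  by rewrite [picard n.+1 t z]/(mildmap f (picard n) t z) /mildmap opprD addrACA subrr add0r.
have h4 : 2^-1 ^+ n.+1 = 2^-1 * 2^-1 ^+ n :> R by rewrite exprS.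
rewrite h4 in h1.
have := le_trans h2 h3; move: h1 hn; rewrite mulrAC; move: (2^-1 ^+ n) (wt z.2) => X W.
set A := `|_ - _|; set B := `|_ - _|; lra.
Qed.

End iteration.

Lemma mild_everywhere_exists f (T M : R) : measurable_fun setT f -> periodic_p f ->
  0 <= M -> 0 <= T -> (forall z, `|f z| <= M * wt z.2) ->
  T * lip (2 * M) <= 2^-1 -> exists F, mild_everywhere f T (2 * M) F.
Proof.
by move=> mf pf M0 T0 bf sm; exists (picard_limit f T); exact: picard_limit_mild.
Qed.

End picard.

Lemma measurable_pred d (T : measurableType d) (b : T -> bool) :
  measurable_fun setT b -> measurable [set x | b x].
Proof.
move=> mb; rewrite -[X in measurable X]setTI.
by have := mb measurableT [set true]; apply.
Qed.

Lemma ae_all d (T : measurableType d) (R : realType) (m : {measure set T -> \bar R})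
    (P : nat -> T -> Prop) :
  (forall n, \forall x \ae m, P n x) -> \forall x \ae m, forall n, P n x.
Proof.
move=> H; apply: negligibleS (negligible_bigcup (mu := m) (F := fun n => ~` [set x | P n x]) H).
by move=> x /= /existsNP[n nP]; exists n.
Qed.

(** * Almost everywhere mild solutions and their stability *)

Section stability.
Context {R : realType} (alpha : R).
Hypothesis alpha1 : alpha <= 1.
Local Notation mu := (@lebesgue_measure R).
Local Notation wt := (wt alpha).
Local Notation lip := (lip alpha).
Implicit Types (f g : phase R -> R) (F G : R -> phase R -> R) (z : phase R).

Lemma along_ae F G (M D t s : R) : 0 <= M -> 0 <= D -> joint F -> joint G ->
  periodic_p (F s) -> periodic_p (G s) ->
  {ae phase_measure, forall z, [/\ `|F s z| <= M * wt z.2, `|G s z| <= M * wt z.2 &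
     `|F s z - G s z| <= D * wt z.2]} ->
  {ae phase_measure, forall z, `|along F t z s - along G t z s| <= lip M * D * wt z.2}.
Proof.
move=> M0 D0 jF jG pF pG H.
have := collision_ae alpha1 M0 D0 (joint_section s jF) (joint_section s jG) pF pG H.
move=> /(ae_shift (t - s)); apply: filterS2 ae_interior => z /andP[z0 z1] /=.
by rewrite /along red_id// (ltW z0).
Qed.

(** What any competing mild solution satisfies, once extended by 0 in time. *)
Definition mild_ae f (T M : R) G :=
  [/\ joint G, forall t, periodic_p (G t),
      forall t, 0 <= t <= T -> {ae phase_measure, forall z, `|G t z| <= M * wt z.2} &
      forall t, 0 <= t <= T -> {ae phase_measure, forall z, G t z = mildmap f G t z}].

Lemma mild_everywhere_ae f T M F : mild_everywhere alpha f T M F -> mild_ae f T M F.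
Proof. by move=> [jF pF bF eF]; split => // t ht; apply: aeW => z; [exact: bF|exact: eF]. Qed.

(** At each s the estimate comes from [along_ae], outside a null set depending on s; [ae_time] makes
    it available for almost every s at almost every z. *)
Lemma duhamel_ae_dist F G (M T t : R) (D : R -> R) : 0 <= M -> joint F -> joint G ->
  (forall t, periodic_p (F t)) -> (forall t, periodic_p (G t)) ->
  (forall s, 0 <= s <= T -> {ae phase_measure, forall z, `|F s z| <= M * wt z.2}) ->
  (forall s, 0 <= s <= T -> {ae phase_measure, forall z, `|G s z| <= M * wt z.2}) ->
  continuous D -> (forall s, 0 <= D s) ->
  (forall s, 0 <= s <= T -> {ae phase_measure, forall z, `|F s z - G s z| <= D s * wt z.2}) ->
  0 <= t <= T ->
  {ae phase_measure, forall z, `|duhamel F t z - duhamel G t z| <=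
     lip M * \int[mu]_(s in `[0, t]) D s * wt z.2}.
Proof.
move=> M0 jF jG pF pG bF bG cD D0 H /andP[t0 tT].
pose b0 (u : measurableTypeR R * phase R) := (0 <= u.1) && (u.1 <= t).
pose b1 (u : measurableTypeR R * phase R) := `|along F t u.2 u.1| <= lip M * M * wt u.2.2.
pose b2 (u : measurableTypeR R * phase R) := `|along G t u.2 u.1| <= lip M * M * wt u.2.2.
pose b3 (u : measurableTypeR R * phase R) := `|along F t u.2 u.1 - along G t u.2 u.1| <= lip M * D u.1 * wt u.2.2.
(* The condition is stated as a measurable set of (s, z), vacuous outside [0, t], so that Fubini
   applies. *)
pose P := [set u | ~~ b0 u || [&& b1 u, b2 u & b3 u]].
have m1 : measurable_fun setT (fun u : measurableTypeR R * phase R => u.1) by exact: measurable_fst.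
have m2 : measurable_fun setT (fun u : measurableTypeR R * phase R => u.2) by exact: measurable_snd.
have m22 : measurable_fun setT (fun u : measurableTypeR R * phase R => u.2.2) by exact: (measurableT_comp measurable_snd m2).
have mw : measurable_fun setT (fun u : measurableTypeR R * phase R => wt u.2.2) by exact: (measurable_fun_wt _ m22).
have mal K : joint K -> measurable_fun setT (fun u : measurableTypeR R * phase R => along K t u.2 u.1).
  move=> jK.
  have mg : measurable_fun setT (fun u => (((t : measurableTypeR R), u.2), u.1) : (measurableTypeR R * phase R) * measurableTypeR R).
    by apply: measurable_fun_pair => //; exact: measurable_fun_pair.
  exact: (measurableT_comp (joint_along jK) mg).
have mP : measurable P.
  apply: measurable_pred; apply: measurable_or.
    apply: (measurableT_comp (f := negb)) => //.
    by apply: measurable_and; apply: measurable_fun_ler.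
  apply: measurable_and; [|apply: measurable_and]; apply: measurable_fun_ler.
  - by apply: measurable_fun_norm; exact: mal.
  - exact: measurable_funM.
  - by apply: measurable_fun_norm; exact: mal.
  - exact: measurable_funM.
  - by apply: measurable_fun_norm; apply: measurable_funB; exact: mal.
  - apply: measurable_funM => //; apply: measurable_funM => //.
    by apply: (measurable_fun_comp (h := D)) => //; exact: continuous_measurable_fun.
have HP : \forall s \ae mu, {ae phase_measure, forall z, P (s, z)}.
  apply: aeW => s; have [hs|hs] := boolP ((0 <= s) && (s <= t)); last first.
    by apply: aeW => z; rewrite /P /b0/= hs.
  have hs' : 0 <= s <= T by case/andP: hs => -> h; exact: le_trans h tT.
  have Z : {ae phase_measure, forall z, `|(fun _ _ => 0 : R) s z| <= M * wt z.2}.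
    by apply: aeW => z; rewrite normr0 mulr_ge0 ?wt_ge0.
  have a1 := @along_ae F (fun _ _ => 0) M M t s M0 M0 jF joint0 (pF s) (fun _ _ => erefl) ltac:(by apply: filterS2 (bF s hs') Z => z h1 h2; split => //; rewrite subr0).
  have a2 := @along_ae G (fun _ _ => 0) M M t s M0 M0 jG joint0 (pG s) (fun _ _ => erefl) ltac:(by apply: filterS2 (bG s hs') Z => z h1 h2; split => //; rewrite subr0).
  have a3 := @along_ae F G M (D s) t s M0 (D0 s) jF jG (pF s) (pG s) ltac:(by apply: filterS3 (bF s hs') (bG s hs') (H s hs') => z h1 h2 h3; split).
  apply: filterS3 a1 a2 a3 => z; rewrite along0 subr0 /P /b1 /b2 /b3/= => -> + ->.
  by rewrite subr0 => ->; rewrite orbT.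
apply: filterS (ae_time mP HP) => z Hz.
have w0 := wt_ge0 alpha z.2.
have iD := continuous_itv_integrable t cD.
have mI : measurable (`[0, t]%classic : set (measurableTypeR R)) by exact: measurable_itv.
have -> : lip M * \int[mu]_(s in `[0, t]) D s * wt z.2 = \int[mu]_(s in `[0, t]) (lip M * wt z.2 * D s).
  by rewrite RintegralZl// mulrAC.
apply: (duhamel_dist (A := lip M * M * wt z.2)) => //.
- apply: continuous_itv_integrable => s; apply: cvgM; [exact: cvg_cst|exact: cD].
- by move=> s; exact: (mulr_ge0 (mulr_ge0 (lip_ge0 _ M) w0) (D0 s)).
apply: filterS Hz => s; rewrite /P /b0 /b1 /b2 /b3/= => + hs; rewrite hs/= => /and3P[h1 h2 h3].
by split => //; rewrite mulrAC.
Qed.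

(** A direct Gronwall argument would integrate the essential norm of F s - G s in time. Instead, the
    trivial bound 2 M is improved repeatedly through explicit continuous majorants. There is no
    smallness condition on T. *)
Lemma mild_ae_stability f g (T M E : R) F G : 0 <= M -> 0 <= E ->
  mild_ae f T M F -> mild_ae g T M G ->
  {ae phase_measure, forall z, `|f z - g z| <= E * wt z.2} ->
  forall t, 0 <= t <= T -> {ae phase_measure, forall z,
    `|F t z - G t z| <= 2 * E * expR (2 * (lip M + 1) * t) * wt z.2}.
Proof.
move=> M0 E0 [jF pF bF eF] [jG pG bG eG] fg.
(* The added 1 keeps the rate positive when M = 0. *)
set L := lip M + 1; have L0 : 0 < L by rewrite ltr_wpDl// lip_ge0.
have M20 : 0 <= 2 * M by rewrite mulr_ge0.
suff H n t : 0 <= t <= T -> {ae phase_measure, forall z, `|F t z - G t z| <= gronwall_seq E (2 * M) L n t * wt z.2}.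
  move=> t ht; apply: filterS (ae_all (fun n => H n t ht)) => z Hz.
  by apply: gronwall_seq_limit => //; exact: wt_ge0.
elim: n t => [|n IH] t ht.
  apply: filterS2 (bF t ht) (bG t ht) => z h1 h2; have w0 := wt_ge0 alpha z.2.
  apply: (le_trans (ler_normB _ _)); apply: (le_trans (lerD h1 h2)).
  rewrite -mulrDl ler_wpM2r// /gronwall_seq expr0 mulr1.
  have t0 : 0 <= t by case/andP: ht.
  have e1 : 1 <= expR (2 * L * t) by rewrite -expR0 ler_expR !mulr_ge0// ltW.
  by move: (expR _) e1 => X X1; nra.
have cD : continuous (gronwall_seq E (2 * M) L n) by exact: continuous_exp_lin.
have D0 s : 0 <= gronwall_seq E (2 * M) L n s by exact: gronwall_seq_ge0.
have Hd := @duhamel_ae_dist F G M T t _ M0 jF jG pF pG bF bG cD D0 IH ht.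
have Hs := ae_shift t fg.
have He : {ae phase_measure, forall z, F t z = mildmap f F t z /\ G t z = mildmap g G t z}.
  by apply: filterS2 (eF t ht) (eG t ht) => z h1 h2; split.
apply: filterS3 Hd Hs He => z h1 h2 [-> ->].
have w0 := wt_ge0 alpha z.2; rewrite /= in h2.
rewrite /mildmap opprD addrACA; apply: (le_trans (ler_normD _ _)).
apply: (le_trans (lerD h2 h1)); rewrite -mulrDl ler_wpM2r//.
have t0 : 0 <= t by case/andP: ht.
apply: le_trans (gronwall_seq_step n E0 M20 L0 t0); rewrite lerD2l ler_wpM2r//.
  by apply: Rintegral_ge0 => s _; exact: D0.
by rewrite /L lerDl.
Qed.

End stability.

(** * Continuity along the free flow and modulus of continuity in x *)

Section flow_continuity.
Context {R : realType} (alpha : R).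
Hypothesis alpha1 : alpha <= 1.
Local Notation mu := (@lebesgue_measure R).
Local Notation wt := (wt alpha).
Local Notation lip := (lip alpha).
Implicit Types (f g : phase R -> R) (F G : R -> phase R -> R) (z : phase R).

Lemma itv0_cat (h : R -> R) (s t A : R) : 0 <= s -> s <= t ->
  measurable_fun setT (h : measurableTypeR R -> R) ->
  (forall r, 0 <= r <= t -> `|h r| <= A) ->
  `|\int[mu]_(r in `[0, t]) h r - \int[mu]_(r in `[0, s]) h r| <= A * (t - s).
Proof.
move=> s0 st mh hA.
have t0 := le_trans s0 st.
have A0 : 0 <= A by apply: le_trans (normr_ge0 _) (hA 0 _); rewrite lexx.
pose hs r := if r <= s then h r else 0.
have mI : measurable (`[0, t]%classic : set (measurableTypeR R)) by exact: measurable_itv.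
have -> : \int[mu]_(r in `[0, s]) h r = \int[mu]_(r in `[0, t]) hs r.
  rewrite Rintegral_mkcond [RHS]Rintegral_mkcond; apply: eq_Rintegral => r _.
  rewrite /patch /hs !mem_setE !in_itv/=; case: (leP 0 r) => //= r0.
  by case: (leP r s) => [rs|_]; [rewrite (le_trans rs st)|case: ifP].
pose b r := if r <= s then 0 else A.
have mb : measurable_fun setT (b : measurableTypeR R -> R).
  by apply: measurable_fun_ifT => //; exact: measurable_fun_ler.
have bi : mu.-integrable `[0, t] (EFin \o b).
  apply: (@ae_bounded_integrable _ _ _ mu _ _ A) => //; first exact: itv_fin.
    exact: measurable_funTS.
  by apply: aeW => r _; rewrite /b; case: ifP; rewrite ?normr0// ger0_norm.
have -> : A * (t - s) = \int[mu]_(r in `[0, t]) b r.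
  have -> : \int[mu]_(r in `[0, t]) b r = \int[mu]_(r in `[0, t]) (A - (if r <= s then A else 0)).
    by apply: eq_Rintegral => r _; rewrite /b; case: ifP; rewrite ?subrr ?subr0.
  have mc : measurable_fun setT (fun r : measurableTypeR R => if r <= s then A else 0).
    by apply: measurable_fun_ifT => //; exact: measurable_fun_ler.
  rewrite RintegralB//; last 2 first.
  - by apply: continuous_itv_integrable; exact: cst_continuous.
  - apply: (@ae_bounded_integrable _ _ _ mu _ _ A) => //; first exact: itv_fin.
      exact: measurable_funTS.
    by apply: aeW => r _; case: ifP; rewrite ?normr0// ger0_norm.
  have -> : \int[mu]_(r in `[0, t]) (if r <= s then A else 0) = \int[mu]_(r in `[0, s]) A.
    rewrite Rintegral_mkcond [RHS]Rintegral_mkcond; apply: eq_Rintegral => r _.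
    rewrite /patch !mem_setE !in_itv/=; case: (leP 0 r) => //= r0.
    by case: (leP r s) => [rs|_]; [rewrite (le_trans rs st)|case: ifP].
  by rewrite !Rintegral_itv_cst// mulrBr.
apply: (@Rintegral_dist _ _ _ _ _ _ _ _ A) => //.
- exact: itv_fin.
- exact: measurable_funTS.
- apply: measurable_funTS; apply: measurable_fun_ifT => //; exact: measurable_fun_ler.
- by move=> r _; rewrite /b; case: ifP.
apply: aeW => r; rewrite /= in_itv/= => hr; rewrite /hs /b; have := hA r hr.
by case: ifP => _ hh; split; rewrite ?subrr ?normr0 ?subr0.
Qed.

(** The datum is evaluated at the same point on both sides and the Duhamel integrands coincide up to
    time s, leaving an integral over [s, t]. For t < s, the estimate is applied at the transported
    point with the times exchanged. *)
Lemma mild_flow f T M F s t z : 0 <= M -> mild_everywhere alpha f T M F ->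
  0 <= s <= T -> 0 <= t <= T ->
  `|F t z - F s (z.1 - vel z.2 * (t - s), z.2)| <= lip M * M * `|t - s| * wt z.2.
Proof.
move=> M0 [jF pF bF eF].
have main (s' t' : R) y : 0 <= s' -> s' <= t' -> t' <= T ->
    `|F t' y - F s' (y.1 - vel y.2 * (t' - s'), y.2)| <= lip M * M * (t' - s') * wt y.2.
  move=> s0 st tT.
  rewrite !eF ?s0 ?(le_trans st)// ?(le_trans s0 st)//; rewrite /mildmap/=.
  rewrite (_ : y.1 - vel y.2 * (t' - s') - vel y.2 * s' = y.1 - vel y.2 * t'); last by ring.
  rewrite opprD addrACA subrr add0r.
  have -> : duhamel F s' (y.1 - vel y.2 * (t' - s'), y.2) = \int[mu]_(r in `[0, s']) along F t' y r.
    apply: eq_Rintegral => r _; rewrite /along/=; congr (collision _ _); apply/funext => q.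
    by congr (F _ (_, _)); ring.
  have -> : lip M * M * (t' - s') * wt y.2 = lip M * M * wt y.2 * (t' - s') by ring.
  apply: itv0_cat => //; first exact: measurable_along.
  move=> r /andP[r0 rt]; apply: (along_bound alpha1 _ _ jF M0 bF).
  by rewrite r0 (le_trans rt).
move=> /andP[s0 sT] /andP[t0 tT]; have [st|ts] := leP s t.
  by rewrite (ger0_norm (_ : 0 <= t - s)) ?subr_ge0//; exact: main.
have := main t s (z.1 - vel z.2 * (t - s), z.2) t0 (ltW ts) sT.
rewrite /= (_ : z.1 - vel z.2 * (t - s) - vel z.2 * (s - t) = z.1); last by ring.
rewrite -surjective_pairing (ltr0_norm (_ : t - s < 0)) ?subr_lt0// opprB.
by rewrite distrC.
Qed.

(* The displacement [y] is achieved by the free flow at momentum [p] in time at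
   most [rho]. Outside a set of small measure of momenta p2, a displacement
   admissible at p0 is admissible at p1, p2 and p3 as well. *)
Definition admissible (r rho p y : R) :=
  `|y| <= r /\ exists2 h, `|h| <= rho & y = vel p * h.

Lemma norm_vel (p : R) : `|vel p| = `|cos (p / 2)| / 2.
Proof.
rewrite /vel normrM (@ger0_norm _ 2^-1)// ?invr_ge0//; congr (_ / 2).
apply: (@periodic_red _ (fun q => `|cos (q / 2)|)) => q.
rewrite (_ : (q + 2 * pi) / 2 = q / 2 + pi); last by field.
by rewrite cosDpi normrN.
Qed.

(** Since |vel p| >= dl / 2, the travel time y / vel p is at most rho. *)
Lemma admissible_fast (dl rho p y : R) : 0 < dl -> dl <= `|cos (p / 2)| ->
  `|y| <= rho * dl / 2 -> admissible (rho * dl / 2) rho p y.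
Proof.
move=> d0 hd hy; split => //.
have v0 : 0 < `|vel p| by rewrite norm_vel divr_gt0// (lt_le_trans d0).
have vN : vel p != 0 by rewrite -normr_gt0.
exists (y / vel p); last by rewrite mulrC divfK.
rewrite normrM normfV ler_pdivrMr// (le_trans hy)// norm_vel mulrA.
have r0 : 0 <= rho.
  have : 0 <= rho * dl / 2 by apply: le_trans hy.
  by rewrite -mulrA pmulr_lge0// divr_gt0.
by rewrite ler_wpM2r// ?invr_ge0// ler_wpM2l.
Qed.

Lemma vel_red (p : R) : vel (red p) = vel p.
Proof. by rewrite /vel; apply: (@periodic_red _ (fun q => cos (red q / 2) / 2)) => q; rewrite red_period. Qed.

Section modulus.
Variables (g : phase R -> R) (T M B : R) (F : R -> phase R -> R).
Hypotheses (M0 : 0 <= M) (T0 : 0 <= T) (B0 : 0 <= B).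
Hypothesis (mF : mild_everywhere alpha g T M F).
Hypothesis (gB : forall x p h, `|g (x - vel p * h, p) - g (x, p)| <= B * `|h| * wt p).

Lemma slow_indicator_integral (dl p0 eta D : R) : 0 <= eta -> 0 <= D ->
  (mu (slow_set dl p0) <= eta%:E)%E ->
  let b p2 := D + 2 * M * \1_(slow_set dl p0) p2 in
  mu.-integrable `[0, 2 * pi] (EFin \o b) /\
  \int[mu]_(p2 in `[0, 2 * pi]) b p2 <= 2 * pi * D + 2 * M * eta.
Proof.
move=> eta0 D0 hs b.
have mS := @measurable_slow_set R dl p0.
have mI : measurable (`[0, 2 * pi]%classic : set (measurableTypeR R)) by exact: measurable_itv.
have mi : measurable_fun setT (\1_(slow_set dl p0) : measurableTypeR R -> R) by exact: measurable_indic.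
have i1 : mu.-integrable `[0, 2 * pi] (EFin \o (fun=> D)).
  by apply: (@ae_bounded_integrable _ _ _ mu _ _ D) => //; [exact: lebesgue_period_fin|apply: aeW => ? _; rewrite ger0_norm].
have i3 : mu.-integrable `[0, 2 * pi] (EFin \o (\1_(slow_set dl p0) : R -> R)).
  apply: (@ae_bounded_integrable _ _ _ mu _ _ 1) => //; first exact: lebesgue_period_fin.
  by apply: aeW => ? _; rewrite indicE ger0_norm// lern1 leq_b1.
have i2 : mu.-integrable `[0, 2 * pi] (EFin \o (fun p2 => 2 * M * \1_(slow_set dl p0) p2)).
  apply: (@ae_bounded_integrable _ _ _ mu _ _ (2 * M)) => //; first exact: lebesgue_period_fin.
    by apply: measurable_funTS; exact: measurable_funM.
  by apply: aeW => ? _; rewrite normrM ger0_norm ?mulr_ge0// ler_piMr ?mulr_ge0// indicE ger0_norm// lern1 leq_b1.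
split.
  have := integrableD mI i1 i2; congr integrable.
rewrite RintegralD// Rintegral_period_cst RintegralZl//.
rewrite (mulrC D) lerD2l ler_wpM2l ?mulr_ge0//.
rewrite -lee_fin /Rintegral fineK; last exact: (integrable_fin_num mI i3).
rewrite integral_indic//; apply: le_trans hs.
by apply: le_measure; rewrite ?inE//; exact: measurableI.
Qed.

(** Induction on n, simultaneous over all momenta and admissible displacements. Off the slow set the
    induction hypothesis applies at p0, p1, p2 and p3; on it, the trivial bound 2 M costs 12
    [kconst] M^2 times 2 M eta per unit time, whence the term in M^3. The datum contributes B
    rho. *)
Lemma modulus_iter (dl rho eta : R) n : 0 < dl -> 0 <= rho -> 0 <= eta ->
  (forall p0, 0 <= p0 <= 2 * pi -> (mu (slow_set dl p0) <= eta%:E)%E) ->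
  forall t p y x, 0 <= t <= T -> admissible (rho * dl / 2) rho p y ->
  `|F t (x - y, p) - F t (x, p)| <=
  gronwall_seq (B * rho + T * (24 * kconst alpha * M ^+ 3 * eta)) (2 * M) (lip M + 1) n t * wt p.
Proof.
move=> d0 rho0 eta0 hs; have [jF pF bF eF] := mF.
set L := lip M + 1; have L0 : 0 < L by rewrite ltr_wpDl// lip_ge0.
set E := B * rho + _.
have K0 : 0 <= kconst alpha by exact/ltW/kconst_gt0.
have c0 : 0 <= 24 * kconst alpha * M ^+ 3 * eta by rewrite mulr_ge0// mulr_ge0// ?exprn_ge0// mulr_ge0.
have E0 : 0 <= E by rewrite addr_ge0// mulr_ge0.
have M20 : 0 <= 2 * M by rewrite mulr_ge0.
have triv t x x' p : 0 <= t <= T -> `|F t (x', p) - F t (x, p)| <= 2 * M * wt p.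
  move=> ht; apply: (le_trans (ler_normB _ _)).
  have := lerD (bF t ht (x', p)) (bF t ht (x, p)); rewrite /= => /le_trans; apply.
  by rewrite -mulrDl ler_wpM2r ?wt_ge0//; lra.
elim: n => [|n IH] t p y x ht [hy1 hy2].
  have t0 : 0 <= t by case/andP: ht.
  apply: (le_trans (triv _ _ _ _ ht)); rewrite ler_wpM2r ?wt_ge0// /gronwall_seq expr0 mulr1.
  have e1 : 1 <= expR (2 * L * t) by rewrite -expR0 ler_expR !mulr_ge0// ltW.
  by move: (expR _) e1 => X X1; nra.
have /andP[t0 tT] := ht.
(* The displacement is frozen at y while the collision runs over other momenta: translation in x by
   a constant commutes with the collision. *)
pose Fy s z := F s (z.1 - y, z.2).
have jFy : joint Fy.
  have m2 : measurable_fun setT (fun u : measurableTypeR R * phase R => u.2) by exact: measurable_snd.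
  apply: (joint_comp jF); [exact: measurable_fst| |exact: (measurableT_comp measurable_snd m2)].
  by apply: measurable_funB => //; exact: (measurableT_comp measurable_fst m2).
have bFy : bounded_on alpha Fy T M by move=> s hs' z; exact: (bF s hs' (z.1 - y, z.2)).
have w0 := wt_ge0 alpha p.
rewrite !eF// /mildmap/= opprD addrACA.
have -> : duhamel F t (x - y, p) = duhamel Fy t (x, p).
  apply: eq_Rintegral => s _; rewrite /along/=; congr (collision _ _); apply/funext => q.
  by rewrite /Fy/=; congr (F _ (_, _)); ring.
have [h hh ey] := hy2.
have G1 : `|g (x - y - vel p * t, p) - g (x - vel p * t, p)| <= B * rho * wt p.
  rewrite ey (_ : x - vel p * h - vel p * t = x - vel p * t - vel p * h); last by ring.
  by apply: (le_trans (gB _ _ _)); rewrite ler_wpM2r// ler_wpM2l.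
set D := gronwall_seq E (2 * M) L n.
have cD : continuous D by exact: continuous_exp_lin.
have D0 s : 0 <= D s by exact: gronwall_seq_ge0.
pose c := 24 * kconst alpha * M ^+ 3 * eta.
have mI : measurable (`[0, t]%classic : set (measurableTypeR R)) by exact: measurable_itv.
have i1 : mu.-integrable `[0, t] (EFin \o D) by exact: continuous_itv_integrable.
have cb : continuous (fun s => wt p * (lip M * D s + c)).
  move=> s; apply: cvgM; first exact: cvg_cst.
  by apply: cvgD; [apply: cvgM; [exact: cvg_cst|exact: cD]|exact: cvg_cst].
have G2 : `|duhamel Fy t (x, p) - duhamel F t (x, p)| <= \int[mu]_(s in `[0, t]) (wt p * (lip M * D s + c)).
  apply: (@duhamel_dist _ _ _ _ _ _ (lip M * M * wt p)) => //.
  - exact: continuous_itv_integrable.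
  - by move=> s; apply: mulr_ge0 => //; apply: addr_ge0 => //; apply: mulr_ge0 => //; exact: lip_ge0.
  apply: aeW => s /andP[s0 st].
  have hs' : 0 <= s <= T by rewrite s0 (le_trans st).
  split; [exact: (along_bound alpha1 _ _ jFy M0 bFy)|exact: (along_bound alpha1 _ _ jF M0 bF)|].
  rewrite /along /Fy/=; set xi := x - vel p * (t - s).
  have h0 : 0 <= red p <= 2 * pi by have /andP[-> /ltW ->] := red_itv p.
  have [bi bI] := slow_indicator_integral eta0 (D0 s) (hs _ h0).
  apply: (le_trans (@collision_dist _ _ alpha1 _ _ M (fun p2 => D s + 2 * M * \1_(slow_set dl (red p)) p2) (red p) (joint_slice s xi jFy) (joint_slice s xi jF) M0 h0 bi _ _)).
  - by move=> p2; rewrite addr_ge0// mulr_ge0// indicE.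
  - apply: aeW => p2 h2 q hq; split; [exact: (bF s hs' (xi - y, q))|exact: (bF s hs' (xi, q))|].
    rewrite indicE; have [hin|hout] := boolP (p2 \in slow_set dl (red p)).
      rewrite mulr1 /Fy/=; apply: (le_trans (triv _ _ _ _ hs')).
      by rewrite ler_wpM2r ?wt_ge0// lerDr.
    rewrite mulr0 addr0 /Fy/=.
    (* At p0 the same travel time h works; the other three momenta are fast off the slow set. *)
    apply: IH => //; have : q = red p \/ dl <= `|cos (q / 2)|.
      move: hout; rewrite notin_setE => /not_andP[|/negP]; first by rewrite in_itv/= h2.
      rewrite !negb_or -!leNgt => /and3P[k2 k1 k3].
      by move: hq; rewrite /quad !inE => /or4P[] /eqP ->; [left|right|right|right].
    case=> [->|hd]; last by apply: admissible_fast.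
    by split => //; exists h => //; rewrite vel_red.
  rewrite wt_red.
  have := ler_wpM2l (_ : 0 <= 12 * kconst alpha * M ^+ 2 * wt p) bI.
  rewrite !mulr_ge0 ?sqr_ge0// => /(_ isT) /le_trans; apply.
  by rewrite /lip /c le_eqVlt; apply/orP; left; apply/eqP; ring.
apply: (le_trans (ler_normD _ _)); apply: (le_trans (lerD G1 G2)).
rewrite RintegralZl//; last first.
  apply: continuous_itv_integrable => s.
  by apply: cvgD; [apply: cvgM; [exact: cvg_cst|exact: cD]|exact: cvg_cst].
rewrite RintegralD//; last 2 first.
- by apply: continuous_itv_integrable => s; apply: cvgM; [exact: cvg_cst|exact: cD].
- by apply: continuous_itv_integrable; exact: cst_continuous.
rewrite RintegralZl// Rintegral_itv_cst// mulrC -mulrDr mulrC ler_wpM2r//.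
apply: le_trans (gronwall_seq_step n E0 M20 L0 t0); rewrite -/D /E.
have ID : 0 <= \int[mu]_(s in `[0, t]) D s by apply: Rintegral_ge0.
have : c * t <= T * c by rewrite mulrC ler_wpM2r.
rewrite -/c /L; move: (\int[mu]_(_ in _) _) ID (lip M) => X X0 l; lra.
Qed.

(** The parameters are chosen in the order eta, dl, rho, r: the slow set determines dl from eta, and
    the admissible size r depends on both dl and rho. *)
Lemma modulus_small (e : R) : 0 < e -> exists2 r, 0 < r & forall t h x p,
  0 <= t <= T -> `|h| <= r -> `|F t (x - vel p * h, p) - F t (x, p)| <= e * wt p.
Proof.
move=> e0.
set L := lip M + 1; have L0 : 0 < L by rewrite ltr_wpDl// lip_ge0.
pose X := expR (2 * L * T).
have X0 : 0 < X by exact: expR_gt0.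
pose C := 24 * kconst alpha * M ^+ 3.
have C0 : 0 <= C by rewrite /C mulr_ge0 ?exprn_ge0// mulr_ge0// ltW// kconst_gt0.
(* Each of the two sources, T C eta and B rho, is to stay below e / (4 X); Gronwall then doubles
   their sum and multiplies it by at most X. The added 1 avoids a division by zero. *)
pose eta := e / (4 * X * (T * C + 1)).
have TC : 0 < T * C + 1 by rewrite ltr_wpDl// mulr_ge0.
have eta0 : 0 < eta by rewrite divr_gt0// mulr_gt0// mulr_gt0.
have [dl d0 hs] := slow_small eta0.
pose rho := e / (4 * X * (B + 1)).
have B1 : 0 < B + 1 by rewrite ltr_wpDl.
have rho0 : 0 < rho by rewrite divr_gt0// mulr_gt0// mulr_gt0.
pose r := Num.min rho (rho * dl / 2).
exists r; first by rewrite lt_min rho0 divr_gt0// mulr_gt0.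
move=> t h x p ht; rewrite le_min => /andP[h1 h2].
have adm : admissible (rho * dl / 2) rho p (vel p * h).
  split; last by exists h.
  by rewrite normrM (le_trans _ h2)// ler_piMl// vel_le1.
have w0 := wt_ge0 alpha p.
have /andP[t0 tT] := ht.
have := gronwall_seq_limit w0 (fun n => @modulus_iter dl rho eta n d0 (ltW rho0) (ltW eta0) hs t p _ x ht adm).
rewrite -/C -/L => /le_trans; apply; apply: ler_wpM2r => //.
have e1 : B * rho <= e / (4 * X).
  have -> : B * rho = e / (4 * X) * ((B) / (B + 1)).
    by rewrite /rho; field; rewrite !gt_eqF.
  rewrite ler_piMr ?divr_ge0 ?mulr_ge0 ?(ltW e0) ?(ltW X0)//.
  by rewrite ler_pdivrMr// mul1r lerDl.
have e2 : T * (C * eta) <= e / (4 * X).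
  have -> : T * (C * eta) = e / (4 * X) * ((T * C) / (T * C + 1)).
    by rewrite /eta; field; rewrite !gt_eqF.
  rewrite ler_piMr ?divr_ge0 ?mulr_ge0 ?(ltW e0) ?(ltW X0)//.
  by rewrite ler_pdivrMr// mul1r lerDl.
have e3 : expR (2 * L * t) <= X by rewrite ler_expR ler_wpM2l// mulr_ge0// ltW.
have e4 : 2 * (B * rho + T * (C * eta)) <= e / X.
  have -> : e / X = 4 * (e / (4 * X)) by field; rewrite gt_eqF.
  lra.
have -> : e = e / X * X by rewrite divfK// gt_eqF.
apply: ler_pM => //.
by rewrite mulr_ge0// addr_ge0// mulr_ge0 ?(ltW rho0)// mulr_ge0// ltW.
Qed.

(** F t - F s splits into the deviation from the free flow, controlled by [mild_flow], and a
    displacement of F s along the flow, controlled by [modulus_small]. *)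
Lemma flow_lipschitz_continuous (e : R) : 0 < e -> exists2 r, 0 < r &
  forall s t z, 0 <= s <= T -> 0 <= t <= T -> `|t - s| <= r ->
  `|F t z - F s z| <= e * wt z.2.
Proof.
move=> e0; have e2 : 0 < e / 2 by rewrite divr_gt0.
have [r r0 Hr] := modulus_small e2.
pose L := lip M * M + 1; have L0 : 0 < L by rewrite ltr_wpDl// mulr_ge0// lip_ge0.
exists (Num.min r (e / 2 / L)); first by rewrite lt_min r0 divr_gt0.
move=> s t [x p] hs ht; rewrite le_min => /andP[h1 h2].
have w0 := wt_ge0 alpha p.
have f1 := mild_flow (x, p) M0 mF hs ht; rewrite /= in f1.
have f2 := Hr s (t - s) x p hs h1.
rewrite -(subrKA (F s (x - vel p * (t - s), p))); apply: (le_trans (ler_normD _ _)).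
apply: (le_trans (lerD f1 f2)); rewrite -mulrDl ler_wpM2r//.
have : lip M * M * `|t - s| <= e / 2; last lra.
have : `|t - s| * L <= e / 2 by rewrite -ler_pdivlMr.
by rewrite /L mulrDr mulr1; have := normr_ge0 (t - s); rewrite (mulrC `|t - s|); lra.
Qed.

End modulus.

End flow_continuity.

(** * Translation invariance of the Lebesgue integral *)

Section translation.
Context {R : realType}.
Local Notation mu := (@lebesgue_measure R).

Definition shiftr (c : R) (x : measurableTypeR R) : measurableTypeR R := x + c.

Lemma measurable_shiftr c : measurable_fun setT (shiftr c).
Proof. exact: (measurable_funD (f := fun x : measurableTypeR R => x : R) (g := fun=> c)). Qed.

HB.instance Definition _ c := isMeasurableFun.Build _ _ _ _ (shiftr c) (measurable_shiftr c).

Lemma lebesgue_measure_shift c (A : set (measurableTypeR R)) : measurable A ->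
  pushforward mu (shiftr c) A = mu A.
Proof.
move=> mA; apply/esym/lebesgue_measure_unique => //= _ [[a b]] _ <-.
rewrite /pushforward (_ : shiftr c @^-1` _ = `]a - c, b - c]%classic).
  rewrite !lebesgue_measure_itv/= !lte_fin ltrD2r; case: ifP => // _.
  by rewrite -!EFinD; congr EFin; ring.
by apply/seteqP; split => x; rewrite /shiftr/= !in_itv/= => /andP[h1 h2]; apply/andP; split; lra.
Qed.

Lemma ge0_integral_translation c (g : R -> \bar R) : measurable_fun setT g ->
  (forall x, 0 <= g x)%E -> (\int[mu]_x g (x + c)%R = \int[mu]_x g x)%E.
Proof.
move=> mg g0.
have H := @ge0_integral_pushforward _ _ _ _ _ (shiftr c) (measurable_shiftr c) mu setT g measurableT mg (fun y _ => g0 y).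
rewrite preimage_setT in H; apply: (eq_trans (esym H)).
by apply: eq_measure_integral => A mA _; exact: lebesgue_measure_shift.
Qed.

Lemma integral_translation c (g : R -> \bar R) : measurable_fun setT g ->
  (\int[mu]_x g (x + c)%R = \int[mu]_x g x)%E.
Proof.
move=> mg; rewrite [LHS]integralE [RHS]integralE; congr (_ - _)%E.
- rewrite -[RHS](ge0_integral_translation c (measurable_funepos mg) (fun=> funepos_ge0 _ _)).
  by apply: eq_integral => x _; rewrite !funeposE.
- rewrite -[RHS](ge0_integral_translation c (measurable_funeneg mg) (fun=> funeneg_ge0 _ _)).
  by apply: eq_integral => x _; rewrite !funenegE.
Qed.

Lemma Rintegral_translation c (g : R -> R) : measurable_fun setT g ->
  \int[mu]_x g (x + c) = \int[mu]_x g x.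
Proof. by move=> mg; congr fine; apply: (integral_translation c (g := EFin \o g)); exact/measurable_EFinP. Qed.

Lemma bounded_itv_integrable (k : R -> R) (i : interval R) (A : R) :
  measurable_fun setT k -> (mu [set` i] < +oo)%E -> (forall x, `|k x| <= A) ->
  mu.-integrable [set` i] (EFin \o k).
Proof.
move=> mk fi kA; apply: (@ae_bounded_integrable _ _ _ mu _ _ A) => //.
  exact: measurable_funTS.
by apply: aeW.
Qed.

(** The intervals of integration [c, e + c] and [0, e] differ by two intervals of length c. *)
Lemma average_shift (k : R -> R) (e c A : R) : 0 <= e -> 0 <= c ->
  measurable_fun setT k -> (forall x, `|k x| <= A) ->
  `|\int[mu]_(h in `[0, e]) k (h + c) - \int[mu]_(h in `[0, e]) k h| <= 2 * A * c.
Proof.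
move=> e0 c0 mk kA.
have A0 : 0 <= A by apply: le_trans (kA 0).
have mkc : measurable_fun setT (fun h : R => k (h + c)).
  by apply: (measurable_fun_comp (h := k)) => //; exact: measurable_funD.
have cec : 0 <= e + c by exact: addr_ge0.
have e1 : \int[mu]_(h in `[0, e]) k (h + c) = \int[mu]_(r in `]c, e + c]) k r.
  rewrite -Rintegral_itv_obnd_cbnd; last first.
    apply: (bounded_itv_integrable (A := A)) => //.
    by rewrite lebesgue_measure_itv/=; case: ifP; rewrite ?ltry// -EFinD ltry.
  rewrite Rintegral_mkcond [RHS]Rintegral_mkcond.
  rewrite -[RHS](Rintegral_translation c); last first.
    apply/(measurable_restrictT _ _).1 => //; exact: measurable_funTS.
  apply: eq_Rintegral => h _; rewrite /patch !mem_setE !in_itv/=.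
  by rewrite -ltrBlDr subrr lerD2r.
have e2 : \int[mu]_(r in `]c, e + c]) k r = \int[mu]_(r in `[0, e + c]) k r - \int[mu]_(r in `[0, c]) k r.
  rewrite Rintegral_itvB//; last first.
    by rewrite bnd_simp lerDr.
  apply: (bounded_itv_integrable (A := A)) => //; exact: itv_fin.
rewrite e1 e2 addrAC.
have b1 := @itv0_cat _ k e (e + c) A e0 (_ : e <= e + c) mk (fun r _ => kA r).
have b2 := @itv0_cat _ k 0 c A (lexx 0) c0 mk (fun r _ => kA r).
rewrite set_itv1 Rintegral_set1 !subr0 in b2.
apply: (le_trans (ler_normB _ _)); apply: (le_trans (lerD (b1 _) b2)); first by rewrite lerDl.
by rewrite (_ : e + c - e = c); [lra|ring].
Qed.

End translation.

(** * Averages of the datum along the free flow *)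

Section flow_average.
Context {R : realType} (alpha : R).
Local Notation mu := (@lebesgue_measure R).
Local Notation wt := (wt alpha).
Variables (f : phase R -> R) (M e : R).
Hypotheses (mf : measurable_fun setT f) (pf : periodic_p f).
Hypotheses (M0 : 0 <= M) (bf : forall z, `|f z| <= M * wt z.2) (e0 : 0 < e).

Definition flow_average (z : phase R) : R :=
  e^-1 * \int[mu]_(h in `[0, e]) f (z.1 - vel z.2 * h, z.2).

Lemma measurable_flow_shift d (T : measurableType d) (a b c : T -> R) :
  measurable_fun setT a -> measurable_fun setT b -> measurable_fun setT c ->
  measurable_fun setT (fun u => f (a u - vel (b u) * c u, b u)).
Proof.
move=> ma mb mc.
have mg : measurable_fun setT (fun u => ((a u - vel (b u) * c u, b u) : phase R)).
  apply: measurable_fun_pair => //; apply: measurable_funB => //.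
  by apply: measurable_funM => //; exact: measurable_fun_vel.
exact: (measurableT_comp mf mg).
Qed.

Lemma measurable_flow_average : measurable_fun setT flow_average.
Proof.
apply: measurable_funM => //.
apply: (@measurable_fun_Rintegral_itv _ (phase R) R (fun w => f (w.1.1 - vel w.1.2 * w.2, w.1.2)) (fun=> 0) (fun=> e)) => //.
have m1 : measurable_fun setT (fun w : phase R * measurableTypeR R => w.1) by exact: measurable_fst.
apply: measurable_flow_shift; last exact: measurable_snd.
- exact: (measurableT_comp measurable_fst m1).
- exact: (measurableT_comp measurable_snd m1).
Qed.

Lemma flow_average_periodic : periodic_p flow_average.
Proof.
move=> x p; congr (_ * _); apply: eq_Rintegral => h _ /=.
by rewrite pf (_ : vel (p + 2 * pi) = vel p)// /vel red_period.
Qed.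

Lemma measurable_flow_line z : measurable_fun setT (fun h : R => f (z.1 - vel z.2 * h, z.2)).
Proof. exact: measurable_flow_shift. Qed.

Lemma flow_average_bounded z : `|flow_average z| <= M * wt z.2.
Proof.
rewrite /flow_average normrM gtr0_norm ?invr_gt0// mulrC ler_pdivrMr//.
rewrite -(Rintegral_itv_cst (M * wt z.2) (ltW e0)).
have mI : measurable (`[0, e]%classic : set (measurableTypeR R)) by exact: measurable_itv.
have := @Rintegral_dist _ _ _ mu `[0, e]%classic (fun h => f (z.1 - vel z.2 * h, z.2)) (fun=> 0) (fun=> M * wt z.2) (M * wt z.2).
rewrite (_ : \int[mu]_(x in `[0, e]) 0 = 0) ?subr0; last by rewrite Rintegral_itv_cst ?(ltW e0)// mul0r.
have w0 : 0 <= M * wt z.2 by rewrite mulr_ge0// wt_ge0.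
apply => //.
- exact: itv_fin.
- by apply: measurable_funTS; exact: measurable_flow_line.
- by apply: continuous_itv_integrable; exact: cst_continuous.
by apply: aeW => h _; rewrite subr0 normr0; split => //; exact: (bf (z.1 - vel z.2 * h, z.2)).
Qed.

(** Moving along the flow shifts the averaging window, so [average_shift] applies on each flow line.
    Negative h is reduced to positive h by exchanging the endpoints. *)
Lemma flow_average_lipschitz x p h :
  `|flow_average (x - vel p * h, p) - flow_average (x, p)| <= 2 * M / e * `|h| * wt p.
Proof.
wlog h0 : x h / 0 <= h.
  move=> H; have [/H//|h0] := leP 0 h.
  have := H (x - vel p * h) (- h); rewrite oppr_ge0 (ltW h0) => /(_ isT).
  rewrite normrN (_ : x - vel p * h - vel p * - h = x); last by ring.
  by rewrite distrC.
rewrite (ger0_norm h0) /flow_average/= -mulrBr normrM gtr0_norm ?invr_gt0//.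
have := @average_shift _ (fun r => f (x - vel p * r, p)) e h (M * wt p) (ltW e0) h0 (measurable_flow_line (x, p)) (fun r => bf (x - vel p * r, p)).
rewrite (_ : \int[mu]_(h0 in `[0, e]) f (x - vel p * h - vel p * h0, p) =
   \int[mu]_(h0 in `[0, e]) f (x - vel p * (h0 + h), p)); last first.
  by apply: eq_Rintegral => r _; congr (f (_, _)); ring.
move=> /(ler_wpM2l (_ : 0 <= e^-1)); rewrite invr_ge0 (ltW e0) => /(_ isT) /le_trans; apply.
by rewrite le_eqVlt; apply/orP; left; apply/eqP; ring.
Qed.

(** The hypothesis has an exceptional set for each h; [ae_time], with h in the role of time, allows
    averaging over h at almost every z. *)
Lemma flow_average_close (E : R) : 0 <= E ->
  (forall h, 0 <= h <= e -> {ae phase_measure, forall z : phase R,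
     `|f (z.1 - vel z.2 * h, z.2) - f z| <= E * wt z.2}) ->
  {ae phase_measure, forall z : phase R, `|f z - flow_average z| <= E * wt z.2}.
Proof.
move=> E0 H.
pose P := [set u : measurableTypeR R * phase R | ~~ ((0 <= u.1) && (u.1 <= e)) || (`|f (u.2.1 - vel u.2.2 * u.1, u.2.2) - f u.2| <= E * wt u.2.2)].
have m1 : measurable_fun setT (fun u : measurableTypeR R * phase R => u.1) by exact: measurable_fst.
have m2 : measurable_fun setT (fun u : measurableTypeR R * phase R => u.2) by exact: measurable_snd.
have m21 : measurable_fun setT (fun u : measurableTypeR R * phase R => u.2.1) by exact: (measurableT_comp measurable_fst m2).
have m22 : measurable_fun setT (fun u : measurableTypeR R * phase R => u.2.2) by exact: (measurableT_comp measurable_snd m2).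
have mP : measurable P.
  apply: measurable_pred; apply: measurable_or.
    apply: (measurableT_comp (f := negb)) => //.
    by apply: measurable_and; apply: measurable_fun_ler.
  apply: measurable_fun_ler.
    apply: measurable_fun_norm; apply: measurable_funB; first exact: measurable_flow_shift.
    exact: (measurableT_comp mf m2).
  by apply: measurable_funM => //; exact: measurable_fun_wt.
have HP : \forall s \ae mu, {ae phase_measure, forall z, P (s, z)}.
  apply: aeW => s; have [hs|hs] := boolP ((0 <= s) && (s <= e)); last first.
    by apply: aeW => z; rewrite /P/= hs.
  by apply: filterS (H s hs) => z hz; rewrite /P/= hz orbT.
apply: filterS (ae_time mP HP) => z Hz.
have w0 : 0 <= E * wt z.2 by rewrite mulr_ge0// wt_ge0.
have mI : measurable (`[0, e]%classic : set (measurableTypeR R)) by exact: measurable_itv.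
have D := @Rintegral_dist _ _ _ mu `[0, e]%classic (fun h => f (z.1 - vel z.2 * h, z.2)) (fun=> f z) (fun=> E * wt z.2) (M * wt z.2).
have : `|\int[mu]_(h in `[0, e]) f (z.1 - vel z.2 * h, z.2) - \int[mu]_(h in `[0, e]) f z| <= \int[mu]_(h in `[0, e]) (E * wt z.2).
  apply: D => //.
  - exact: itv_fin.
  - by apply: measurable_funTS; exact: measurable_flow_line.
  - by apply: continuous_itv_integrable; exact: cst_continuous.
  apply: filterS Hz => h; rewrite /P/= in_itv/= => + hh; rewrite hh/= => h1.
  by split => //; exact: (bf (z.1 - vel z.2 * h, z.2)).
rewrite !Rintegral_itv_cst ?(ltW e0)// => h1.
rewrite distrC -(ler_pM2r e0) -[X in _ * X <= _](gtr0_norm e0) -normrM mulrBl /flow_average.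
by rewrite mulrAC mulVf ?gt_eqF// mul1r.
Qed.

End flow_average.

(** * Continuity of translations tested against integrable functions on the line *)

Section shift_continuity.
Context {R : realType}.
Local Notation mu := (@lebesgue_measure R).

Lemma cvge0_lt (u : nat -> \bar R) (e : R) : u @ \oo --> 0%E -> 0 < e ->
  exists n, (u n < e%:E)%E.
Proof.
move=> /(@fine_cvgP _ _ _ _ u 0)[[n1 _ h1] /cvgrPdist_lt h2] e0.
have [n2 _ {}h2] := h2 e e0.
exists (maxn n1 n2); have f1 := h1 (maxn n1 n2) (leq_maxl _ _).
have := h2 (maxn n1 n2) (leq_maxr _ _); rewrite /= sub0r normrN => h.
by rewrite -(fineK f1) lte_fin (le_lt_trans (ler_norm _)).
Qed.

(** The tail of psi beyond n has integral below e / 2, and psi is approximated by a continuous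
    function on [-N, N], N = n + 1, within e / 2. The plateau function [th], equal to 1 on [-n, n]
    and 0 outside [-N, N], makes the approximation continuous on the whole line; in between, the
    error is a convex combination of psi - g and psi. *)
Lemma L1_continuous_approx (psi : R -> R) (e : R) : mu.-integrable setT (EFin \o psi) ->
  0 < e -> exists chi B C, [/\ continuous chi, forall x, B < `|x| -> chi x = 0,
    forall x, `|chi x| <= C & (\int[mu]_x `|psi x - chi x|%:E <= e%:E)%E].
Proof.
move=> ipsi e0; have e2 : 0 < e / 2 by rewrite divr_gt0.
have mpsi : measurable_fun setT psi by case/integrableP: ipsi => /measurable_EFinP.
have mapsi : measurable_fun setT (fun x => `|psi x|) by exact: measurable_fun_norm.
pose h (n : nat) (x : R) := if `|x| <= n%:R then 0 else `|psi x|.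
have mh n : measurable_fun setT (h n).
  apply: measurable_fun_ifT => //; apply: measurable_fun_ler => //.
have [n hn] : exists n, (\int[mu]_x (h n x)%:E < (e / 2)%:E)%E.
  apply: cvge0_lt => //.
  have [| | | | |_ _] := @dominated_convergence _ _ _ mu setT measurableT (fun n => EFin \o h n) (cst 0%E) (fun x => `|psi x|%:E).
  - by move=> n; apply/measurable_EFinP; exact: mh.
  - exact: measurable_cst.
  - apply: aeW => x _; apply: cvg_near_cst.
    exists (Num.bound `|x|) => // m /= hm; rewrite /h.
    have -> // : `|x| <= m%:R.
    by rewrite (le_trans (ltW (archi_boundP _)))// ler_nat.
  - exact: (integrable_norm ipsi).
  - by apply: aeW => x m _; rewrite /h/=; case: ifP; rewrite lee_fin ?normr0// normr_id.
  by rewrite integral0.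
pose N : R := n%:R + 1.
pose E : set (measurableTypeR R) := `[- N, N]%classic.
have mE : measurable E by exact: measurable_itv.
have fE : (mu E < +oo)%E by rewrite /E lebesgue_measure_itv/=; case: ifP; rewrite ?ltry// -EFinD ltry.
have iE : mu.-integrable E (EFin \o psi) by apply: integrableS ipsi.
have [g_ [cg ig gcvg]] := approximation_continuous_integrable mE fE iE.
have [m hm] := cvge0_lt gcvg e2.
pose th (x : R) : R := Num.max 0 (Num.min 1 (N - `|x|)).
have th0 x : 0 <= th x by rewrite /th le_max lexx.
have th1 x : th x <= 1 by rewrite /th ge_max ler01/= ge_min lexx.
have thE x : `|x| <= n%:R -> th x = 1.
  move=> hx; have hN : 1 <= N - `|x| by rewrite /N; lra.
  by rewrite /th (min_l hN) max_r.
have thO x : N < `|x| -> th x = 0.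
  by move=> hx; rewrite /th max_l// ge_min; apply/orP; right; lra.
have thc : continuous th.
  (* Minimum and maximum are expressed by absolute values, from which continuity is immediate. *)
  have e1 : th = fun x => (1 + (N - `|x|) - `|1 - (N - `|x|)| + `| 1 + (N - `|x|) - `|1 - (N - `|x|)| |) / 4.
    apply/funext => x; rewrite /th; move: (N - `|x|) => y.
    rewrite /Num.max /Num.min; case: (ltP 1 y) => h1.
      rewrite ltr01 (ltr0_norm (_ : 1 - y < 0)) ?subr_lt0// ger0_norm; lra.
    rewrite (ger0_norm (_ : 0 <= 1 - y)) ?subr_ge0//; case: (ltP 0 y) => h2.
      by rewrite ger0_norm; lra.
    by rewrite ler0_norm; lra.
  rewrite e1 => x; have cn : {for x, continuous (fun x : R => N - `|x|)}.
    by apply: cvgB; [exact: cvg_cst|exact: norm_continuous].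
  have cb : {for x, continuous (fun x : R => 1 + (N - `|x|) - `|1 - (N - `|x|)|)}.
    apply: cvgB; first by apply: cvgD; [exact: cvg_cst|exact: cn].
    by apply: cvg_norm; apply: cvgB; [exact: cvg_cst|exact: cn].
  apply: cvgM; last exact: cvg_cst.
  by apply: cvgD; [exact: cb|exact: cvg_norm].
have [C hC] : exists C : R, forall x, `|x| <= N -> `|g_ m x| <= C.
  have cE : compact (`[- N, N]%classic : set R) by exact: segment_compact.
  have [C [_ hC]] := compact_bounded (continuous_compact (continuous_subspaceT (cg m)) cE).
  exists (C + 1) => x hx; apply: (hC (C + 1)); first by rewrite ltrDl.
  by exists x => //=; rewrite in_itv/= -ler_norml.
exists (fun x => g_ m x * th x), N, C; split.
- by move=> x; apply: cvgM; [exact: cg|exact: thc].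
- by move=> x /thO ->; rewrite mulr0.
- move=> x; have [hx|hx] := leP `|x| N.
    by rewrite normrM (ger0_norm (th0 x)) (le_trans _ (hC x hx))// ler_piMr.
  rewrite thO// mulr0 normr0; apply: le_trans (normr_ge0 _) (hC 0 _).
  by rewrite normr0 /N addr_ge0.
have mg : measurable_fun setT (g_ m) by apply: continuous_measurable_fun; exact: cg.
have mth : measurable_fun setT th by exact: continuous_measurable_fun.
have mpg : measurable_fun setT (fun x => `|psi x - g_ m x|) by apply: measurable_fun_norm; exact: measurable_funB.
pose k (x : R) : \bar R := ((fun x => `|psi x - g_ m x|%:E) \_ E) x.
have mk : measurable_fun setT k.
  apply/(measurable_restrictT _ _).1 => //; apply: measurable_funTS; exact/measurable_EFinP.
have k0 x : (0 <= k x)%E by rewrite /k/patch; case: ifP => // _; rewrite lee_fin.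
have h0 i x : 0 <= h i x by rewrite /h; case: ifP.
apply: (@le_trans _ _ (\int[mu]_x (k x + (h n x)%:E))%E).
  apply: ge0_le_integral => //.
  - by apply/measurable_EFinP; apply: measurable_fun_norm; apply: measurable_funB => //; exact: measurable_funM.
  - by apply: emeasurable_funD => //; apply/measurable_EFinP; exact: mh.
  move=> x _; rewrite /k /patch mem_setE in_itv/= -ler_norml.
  case: ifPn => hx; last first.
    rewrite -ltNge in hx; rewrite thO// mulr0 subr0 add0e /h.
    by rewrite ifF// ; apply/negbTE; rewrite -ltNge (lt_trans _ hx)// /N ltrDl.
  rewrite -EFinD lee_fin /h; case: ifPn => hx2; first by rewrite thE// mulr1 addr0.
  have -> : psi x - g_ m x * th x = th x * (psi x - g_ m x) + (1 - th x) * psi x by ring.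
  apply: (le_trans (ler_normD _ _)); rewrite !normrM (ger0_norm (th0 x)) (@ger0_norm _ (1 - th x)) ?subr_ge0//.
  by apply: lerD; [rewrite ler_piMl|rewrite ler_piMl// gerBl].
rewrite ge0_integralD//; last 2 first.
- by move=> x _; rewrite lee_fin.
- by apply/measurable_EFinP; exact: mh.
have -> : e%:E = ((e / 2)%:E + (e / 2)%:E)%E by rewrite -EFinD; congr EFin; field.
apply: leeD; last exact: ltW.
by rewrite /k -integral_mkcond; apply/ltW.
Qed.

Lemma L1_bounded_mul d (T : measurableType d) (m : {measure set T -> \bar R})
    (a psi : T -> R) (A : R) : measurable_fun setT a -> (forall x, `|a x| <= A) ->
  m.-integrable setT (EFin \o psi) -> m.-integrable setT (EFin \o (fun x => a x * psi x)).
Proof.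
move=> ma aA ipsi.
have mpsi : measurable_fun setT psi by case/integrableP: ipsi => /measurable_EFinP.
have i2 : m.-integrable setT (EFin \o (fun x => A * psi x)).
  have := integrableZl measurableT A ipsi.
  by congr integrable; apply/funext => x /=; rewrite EFinM.
apply: le_integrable i2 => //.
  by apply/measurable_EFinP; exact: measurable_funM.
move=> x _ /=; rewrite lee_fin !normrM ler_wpM2r//.
by rewrite (le_trans (aA x))// ler_norm.
Qed.

Lemma L1_dist d (T : measurableType d) (m : {measure set T -> \bar R})
    (a psi chi : T -> R) (A e : R) : measurable_fun setT a -> (forall x, `|a x| <= A) ->
  m.-integrable setT (EFin \o psi) -> m.-integrable setT (EFin \o chi) ->
  (\int[m]_x `|psi x - chi x|%:E <= e%:E)%E ->
  `|\int[m]_x (a x * psi x) - \int[m]_x (a x * chi x)| <= A * e.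
Proof.
move=> ma aA ipsi ichi he.
have ip := L1_bounded_mul ma aA ipsi; have ic := L1_bounded_mul ma aA ichi.
have A0 : 0 <= A by apply: le_trans (aA point).
rewrite -RintegralB//.
have id : m.-integrable setT (EFin \o (fun x => psi x - chi x)).
  by have := integrableB measurableT ipsi ichi; congr integrable.
have iad : m.-integrable setT (EFin \o (fun x => a x * psi x - a x * chi x)).
  by have := integrableB measurableT ip ic; congr integrable.
apply: (le_trans (le_normr_Rintegral _ iad)) => //.
have ind := integrable_norm id.
apply: (@le_trans _ _ (\int[m]_x (A * `|psi x - chi x|))).
  apply: le_Rintegral => //; first exact: (integrable_norm iad).
    have := integrableZl measurableT A ind.
    by congr integrable; apply/funext => x /=; rewrite EFinM.
  by move=> x _; rewrite -mulrBr normrM ler_wpM2r.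
rewrite RintegralZl// ler_wpM2l// -lee_fin /Rintegral fineK//.
exact: (integrable_fin_num _ ind).
Qed.

(** The function a is only measurable and bounded, so the shift is moved to the test function by
    translation invariance. Once psi is replaced by a continuous chi of bounded support, dominated
    convergence applies. *)
Lemma shift_continuity (a psi : R -> R) (A : R) (tau : nat -> R) :
  measurable_fun setT a -> (forall x, `|a x| <= A) ->
  mu.-integrable setT (EFin \o psi) -> tau @ \oo --> 0 ->
  (fun n => \int[mu]_x (a (x - tau n) * psi x)) @ \oo --> \int[mu]_x (a x * psi x).
Proof.
move=> ma aA ipsi tau0; apply/cvgrPdist_le => e e0.
have A0 : 0 <= A by apply: le_trans (aA 0).
have A1 : 0 < A + 1 by rewrite ltr_wpDl.
pose e' := e / 3 / (A + 1).
have e'0 : 0 < e' by rewrite !divr_gt0.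
have e'A : A * e' <= e / 3.
  have -> : A * e' = e / 3 * (A / (A + 1)) by rewrite /e'; field; rewrite gt_eqF.
  by rewrite ler_piMr ?divr_ge0 ?(ltW e0)// ler_pdivrMr// mul1r lerDl.
have [chi [B [C [cc chiB chiC hchi]]]] := L1_continuous_approx ipsi e'0.
have mchi : measurable_fun setT chi by exact: continuous_measurable_fun.
have C0 : 0 <= C by apply: le_trans (chiC 0).
have mas s : measurable_fun setT (fun x : R => a (x - s)).
  by apply: (measurable_fun_comp (h := a)) => //; exact: measurable_funB.
have dom (D : R) : mu.-integrable setT (fun y : R => (C * \1_(`[- D, D]%classic) y)%:E).
  have mI : measurable (`[- D, D]%classic : set (measurableTypeR R)) by exact: measurable_itv.
  pose I : set R := `[- D, D]%classic.
  have fI : (mu I < +oo)%E.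
    by rewrite /I lebesgue_measure_itv/=; case: ifP; rewrite ?ltry// -EFinD ltry.
  apply/integrableP; split.
    by apply/measurable_EFinP; apply: measurable_funM => //; exact: measurable_indic.
  under eq_integral => y _ do rewrite /= ger0_norm ?mulr_ge0// EFinM.
  rewrite ge0_integralZl_EFin//; last by apply/measurable_EFinP; exact: measurable_indic.
  rewrite integral_indic// setIT lte_mul_pinfty//.
have ichi : mu.-integrable setT (EFin \o chi).
  apply: le_integrable (dom B) => //; first exact/measurable_EFinP.
  move=> y _ /=; rewrite lee_fin indicE mem_setE in_itv/= -ler_norml.
  have [hy|hy] := leP `|y| B; first by rewrite mulr1 (le_trans (chiC y))// ler_norm.
  by rewrite chiB// normr0 mulr0 normr0.
(* From rank N1 on, the shifted supports lie in a common interval, which gives an integrable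
   majorant; the sequence is restarted at N1. *)
have [N1 _ hN1] : \forall n \near \oo, `|tau n| <= 1.
  by have /cvgrPdist_le/(_ 1 ltr01) := tau0; apply: filterS => n; rewrite sub0r normrN.
have mid : (fun n => \int[mu]_x (a (x - tau n) * chi x)) @ \oo --> \int[mu]_x (a x * chi x).
  have e1 n : \int[mu]_x (a (x - tau n) * chi x) = \int[mu]_y (a y * chi (y + tau n)).
    rewrite -(Rintegral_translation (tau n)); last by apply: measurable_funM.
    by apply: eq_Rintegral => y _; rewrite addrK.
  have mf n : measurable_fun setT (fun y : R => a y * chi (y + tau n)).
    apply: measurable_funM => //; apply: (measurable_fun_comp (h := chi)) => //.
    exact: measurable_funD.
  rewrite (_ : (fun n => _) = fun n => \int[mu]_y (a y * chi (y + tau n))); last exact/funext.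
  have sh := @cvg_shiftn N1 R (fun n => \int[mu]_y (a y * chi (y + tau n))) (nbhs (\int[mu]_x (a x * chi x))).
  rewrite -sh.
  have [| | | | |_ _] := @dominated_convergence _ _ _ mu setT measurableT (fun n y => (a y * chi (y + tau (n + N1)%N))%:E) (fun y => (a y * chi y)%:E) (fun y => (A * (C * \1_(`[- (`|B| + 1), `|B| + 1]%classic) y))%:E).
  - by move=> n; apply/measurable_EFinP; exact: mf.
  - by apply/measurable_EFinP; exact: measurable_funM.
  - apply: aeW => y _; apply: cvg_EFin; first exact: nearW.
    apply: cvgM; first exact: cvg_cst.
    have ct : (fun n => y + tau (n + N1)%N) @ \oo --> y.
      rewrite -[X in _ --> X]addr0; apply: cvgD; first exact: cvg_cst.
      by rewrite (@cvg_shiftn N1 R tau (nbhs (0 : R))).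
    exact: (@cvg_comp _ _ _ (fun n => y + tau (n + N1)%N : R) chi _ (nbhs (y : R)) _ ct (cc y)).
  - have := integrableZl measurableT A (dom (`|B| + 1)).
    by congr integrable; apply/funext => y /=; rewrite EFinM.
  - apply: aeW => y n _ /=; rewrite lee_fin normrM.
    apply: ler_pM => //.
    rewrite indicE mem_setE in_itv/= -ler_norml.
    have [hy|hy] := leP `|y| (`|B| + 1); first by rewrite mulr1 chiC.
    rewrite chiB ?normr0 ?mulr0//.
    have ht : `|tau (n + N1)%N| <= 1 by apply: hN1; rewrite /= leq_addl.
    have := lerB_normD y (tau (n + N1)%N); have := ler_norm B.
    by move: hy ht; set Y := `|y|; lra.
  move=> cv; apply: (fine_cvg (a := \int[mu]_x (a x * chi x))).
  rewrite /Rintegral fineK; first exact: cv.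
  by apply: integrable_fin_num => //; exact: (@L1_bounded_mul _ (measurableTypeR R) mu a chi A ma aA ichi).
have /cvgrPdist_le/(_ (e / 3)) := mid; rewrite divr_gt0// => /(_ isT).
apply: filterS => n hn.
have k1 := @L1_dist _ (measurableTypeR R) mu a psi chi A _ ma aA ipsi ichi hchi.
have k2 := @L1_dist _ (measurableTypeR R) mu _ psi chi A _ (mas (tau n)) (fun x => aA _) ipsi ichi hchi.
rewrite -(subrKA (\int[mu]_x (a x * chi x))).
apply: (le_trans (ler_normD _ _)).
rewrite -(subrKA (\int[mu]_x (a (x - tau n) * chi x)) (\int[mu]_x (a x * chi x))).
apply: (le_trans (lerD (lexx _) (ler_normD _ _))).
rewrite [X in _ + (_ + X)]distrC.
apply: (le_trans (lerD k1 (lerD hn k2))); lra.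
Qed.

End shift_continuity.

(** * Weak continuity of the free flow on phase space *)

Section phase_shift.
Context {R : realType}.
Local Notation mu := (@lebesgue_measure R).
Implicit Types a psi : phase R -> R.

Lemma measurable_phase_shift a (s : R) : measurable_fun setT a ->
  measurable_fun setT (fun z : phase R => a (z.1 - vel z.2 * s, z.2)).
Proof.
by move=> ma; apply: measurable_flow_shift.
Qed.

(** At fixed momentum the flow is a translation by vel y times [delta n], handled by
    [shift_continuity]. The integral over momenta then converges by domination, with majorant A
    times the x-integral of |psi|. *)
Lemma phase_shift_cvg a psi (A : R) (delta : nat -> R) :
  measurable_fun setT a -> (forall z, `|a z| <= A) ->
  phase_measure.-integrable setT (EFin \o psi) -> delta @ \oo --> 0 ->
  (fun n => \int[phase_measure]_z (a (z.1 - vel z.2 * delta n, z.2) * psi z)) @ \oo -->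
  \int[phase_measure]_z (a z * psi z).
Proof.
move=> ma aA ipsi d0; have A0 : 0 <= A by apply: le_trans (aA (0, 0)).
pose phi s (z : phase R) := (a (z.1 - vel z.2 * s, z.2) * psi z)%:E.
have ip s : phase_measure.-integrable setT (phi s).
  apply: (@L1_bounded_mul _ _ (phase R) phase_measure (fun z => a (z.1 - vel z.2 * s, z.2)) psi A) => //.
  exact: measurable_phase_shift.
pose G s y := fubini_G mu (phi s) y.
have GE s : (\int[torus_measure]_y G s y = \int[phase_measure]_z phi s z)%E.
  exact: (integral21_prod_meas1 (ip s)).
have mG s : measurable_fun setT (G s) by exact: (measurable_fubini_G (ip s)).
have inpsi : phase_measure.-integrable setT (fun z => `|psi z|%:E) by exact: (integrable_norm ipsi).
pose H y := fubini_G mu (fun z : phase R => `|psi z|%:E) y.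
have mpsi : measurable_fun setT psi by case/integrableP: ipsi => /measurable_EFinP.
have H0 y : (0 <= H y)%E by apply: integral_ge0 => x _; rewrite lee_fin.
have iH : torus_measure.-integrable setT H.
  apply/integrableP; split; first exact: (measurable_fubini_G inpsi).
  under eq_integral do rewrite gee0_abs//.
  have mEpsi : measurable_fun setT (EFin \o psi) by exact/measurable_EFinP.
  exact: ((integrable21ltyP mu torus_measure mEpsi).1 ipsi).
have mapsi : measurable_fun setT (fun z : phase R => `|psi z|) by exact: measurable_fun_norm.
have e0 : (fun z : phase R => (a z * psi z)%:E) = phi 0.
  by apply/funext => -[x y]; rewrite /phi/= mulr0 subr0.
have aeq y : mu.-integrable setT (fun x => (psi (x, y))%:E) ->
    G (delta n) y @[n --> \oo] --> G 0 y.
  move=> iy.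
  have ma1 : measurable_fun setT (fun x : measurableTypeR R => a (x, y)).
    by apply: (measurableT_comp ma); exact: pair2_measurable.
  have t0 : (fun n => vel y * delta n) @ \oo --> 0.
    by rewrite -[X in _ --> X](mulr0 (vel y)); apply: cvgM => //; exact: cvg_cst.
  have := @shift_continuity R (fun x => a (x, y)) (fun x => psi (x, y)) A _ ma1 (fun x => aA _) iy t0.
  have gE s : G s y = (\int[mu]_x (a (x - vel y * s, y) * psi (x, y)))%:E.
    rewrite /G /fubini_G /Rintegral fineK//; apply: integrable_fin_num => //.
    apply: (@L1_bounded_mul _ _ (measurableTypeR R) mu (fun x => a (x - vel y * s, y)) (fun x => psi (x, y)) A) => //.
    apply: (measurable_fun_comp (h := fun x => a (x, y))) => //.
    exact: measurable_funB.
  move=> cv; rewrite (_ : (fun n => G (delta n) y) = fun n => (\int[mu]_x (a (x - vel y * delta n, y) * psi (x, y)))%:E); last exact/funext.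
  rewrite gE; apply: cvg_EFin; first exact: nearW.
  by under [X in _ --> X]eq_Rintegral do rewrite mulr0 subr0.
have [| | | | |_ _] := @dominated_convergence _ _ _ torus_measure setT measurableT (fun n y => G (delta n) y) (G 0) (fun y => (A%:E * H y)%E).
- by move=> n; exact: mG.
- exact: mG.
- have := ae_integrable2 ipsi; apply: filterS => y iy _.
  exact: aeq.
- exact: integrableZl.
- apply: aeW => y n _; rewrite /G /H /fubini_G.
  have ms s : measurable_fun setT (fun x : measurableTypeR R => phi s (x, y)).
    have := measurable_int _ (ip s) => mphi.
    by apply: (measurableT_comp mphi); exact: pair2_measurable.
  have mp : measurable_fun setT (fun x : measurableTypeR R => `|psi (x, y)|%:E).
    by apply/measurable_EFinP; apply: (measurableT_comp mapsi); exact: pair2_measurable.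
  apply: (le_trans (le_abse_integral _ _ (ms _))) => //.
  rewrite -ge0_integralZl_EFin//.
  apply: ge0_le_integral => //.
  + by apply: measurableT_comp => //; exact: ms.
  + exact: measurable_funeM.
  + by move=> x _; rewrite /phi/= -EFinM lee_fin normrM ler_wpM2r.
have -> : (fun n => (\int[torus_measure]_y G (delta n) y)%E) = fun n => (\int[phase_measure]_z phi (delta n) z)%E by exact/funext.
rewrite GE => cv; apply: fine_cvg.
rewrite /Rintegral fineK; last first.
  by rewrite e0; apply: integrable_fin_num => //; exact: ip.
by rewrite e0; exact: cv.
Qed.

End phase_shift.

(** * Weak-* continuity of mild solutions *)

Section weak_star.
Context {R : realType} (alpha : R).
Hypothesis alpha1 : alpha <= 1.
Local Notation mu := (@lebesgue_measure R).
Local Notation wt := (wt alpha).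
Implicit Types (f g : phase R -> R) (F G : R -> phase R -> R) (z : phase R).

Lemma powR_wt p : 0 < omega p -> omega p `^ alpha * wt p = 1.
Proof.
move=> o0; rewrite /wt gt_eqF// -powRD ?subrr ?powRr0//.
by rewrite (gt_eqF o0) implybT.
Qed.

Lemma weighted_wt_le f z (M : R) : 0 <= M -> `|f z| <= M * wt z.2 -> `|weighted alpha f z| <= M.
Proof.
move=> M0 hf; rewrite /weighted normrM (ger0_norm (powR_ge0 _ _)).
have [ w0|w0] := eqVneq (omega z.2) 0.
  have -> : f z = 0.
    by apply/eqP; rewrite -normr_le0 (le_trans hf)// /wt w0 eqxx mulr0.
  by rewrite normr0 mulr0.
have w1 : 0 < omega z.2 by rewrite lt_def w0 omega_ge0.
apply: (@le_trans _ _ (omega z.2 `^ alpha * (M * wt z.2))).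
  by rewrite ler_wpM2l// powR_ge0.
by rewrite mulrCA powR_wt// mulr1.
Qed.

Lemma measurable_weighted f : measurable_fun setT f -> measurable_fun setT (weighted alpha f).
Proof.
move=> mf; apply: measurable_funM => //.
apply: measurable_fun_powR; apply: measurable_fun_omega.
exact: measurable_snd.
Qed.

(** F t is compared with F t0 carried by the free flow for the time t - t0: the difference is O(|t -
    t0|) in the weighted norm by [mild_flow], and the carried function converges weakly by
    [phase_shift_cvg]. *)
Lemma mild_weak_star_continuous f T M F : 0 <= M -> mild_everywhere alpha f T M F ->
  weak_star_continuous alpha T F.
Proof.
move=> M0 mF psi ipsi; have [jF pF bF eF] := mF.
apply/subspace_continuousP => t0; rewrite /= in_itv/= => ht0.
set I := fun t : R => \int[phase_measure]_z (weighted alpha (F t) z * psi z).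
pose a := weighted alpha (F t0).
pose J (s : R) := \int[phase_measure]_z (a (z.1 - vel z.2 * s, z.2) * psi z).
have ma : measurable_fun setT a by apply: measurable_weighted; exact: joint_section.
have aA z : `|a z| <= M by apply: weighted_wt_le => //; exact: bF.
have cJ : J s @[s --> (0 : R)] --> (I t0 : R).
  apply/(@cvg_nbhsP _ R^o) => u u0; exact: (phase_shift_cvg ma aA ipsi u0).
have cJ' : J (t - t0) @[t --> t0] --> (I t0 : R).
  have cs : t - t0 @[t --> t0] --> (0 : R).
    by rewrite -(subrr t0); apply: cvgB; [exact: cvg_id|exact: cvg_cst].
  exact: (@cvg_comp _ _ _ (fun t : R => t - t0) J _ (nbhs (0 : R)) _ cs cJ).
have mpsi : measurable_fun setT psi by case/integrableP: ipsi => /measurable_EFinP.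
have inpsi : phase_measure.-integrable setT (EFin \o (fun z => `|psi z|)) by exact: (integrable_norm ipsi).
set P := \int[phase_measure]_z `|psi z|.
have P0 : 0 <= P by apply: Rintegral_ge0.
have L0 : 0 <= lip alpha M * M by rewrite mulr_ge0 ?lip_ge0.
have dist t : 0 <= t <= T -> `|J (t - t0) - I t| <= lip alpha M * M * `|t - t0| * P.
  move=> ht.
  have mt : measurable_fun setT (weighted alpha (F t)).
    by apply: measurable_weighted; exact: joint_section.
  have tA z : `|weighted alpha (F t) z| <= M by apply: weighted_wt_le => //; exact: bF.
  have mas := measurable_phase_shift (t - t0) ma.
  have i1 := @L1_bounded_mul _ _ (phase R) phase_measure _ psi M mas (fun z => aA _) ipsi.
  have i2 := @L1_bounded_mul _ _ (phase R) phase_measure _ psi M mt tA ipsi.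
  rewrite /J /I -RintegralB//.
  have iB : phase_measure.-integrable setT (EFin \o (fun z =>
     a (z.1 - vel z.2 * (t - t0), z.2) * psi z - weighted alpha (F t) z * psi z)).
    by have := integrableB measurableT i1 i2; congr integrable.
  apply: (le_trans (le_normr_Rintegral _ iB)) => //.
  have iZ : phase_measure.-integrable setT (EFin \o (fun z => lip alpha M * M * `|t - t0| * `|psi z|)).
    have := integrableZl measurableT (lip alpha M * M * `|t - t0|) inpsi.
    by congr integrable; apply/funext => y /=; rewrite EFinM.
  rewrite -RintegralZl//; apply: le_Rintegral => //; first exact: (integrable_norm iB).
  move=> z _; rewrite -mulrBl normrM ler_wpM2r//.
  have hz : `|F t z - F t0 (z.1 - vel z.2 * (t - t0), z.2)| <= lip alpha M * M * `|t - t0| * wt z.2.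
    exact: (mild_flow alpha1 z M0 mF).
  have := @weighted_wt_le (fun z => F t0 (z.1 - vel z.2 * (t - t0), z.2) - F t z) z (lip alpha M * M * `|t - t0|).
  rewrite [X in X <= _]distrC in hz.
  rewrite /a /weighted/= -mulrBr; apply; last exact: hz.
  by rewrite mulr_ge0.
apply/cvgrPdist_le => e e0; have e2 : 0 < e / 2 by rewrite divr_gt0.
have /cvgrPdist_le/(_ _ e2) h1 := cJ'.
pose c := lip alpha M * M * P + 1; have c0 : 0 < c by rewrite ltr_wpDl// mulr_ge0.
have h2 : \forall t \near t0, `|t0 - t| <= e / 2 / c.
  have /cvgrPdist_le := @cvg_id _ (nbhs t0); apply; by rewrite divr_gt0.
rewrite near_withinE; move: h1 h2; apply: filterS2 => t h1 h2.
rewrite /= in_itv/= => ht.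
rewrite -(subrKA (J (t - t0))); apply: (le_trans (ler_normD _ _)).
have h3 : lip alpha M * M * `|t - t0| * P <= e / 2.
  rewrite mulrAC distrC; apply: (@le_trans _ _ (c * (e / 2 / c))).
    by apply: ler_pM => //; [exact: mulr_ge0|rewrite /c lerDl].
  by rewrite mulrC divfK ?gt_eqF.
by have := lerD h1 (le_trans (dist t ht) h3); rewrite -splitr.
Qed.

End weak_star.

Lemma ereal_cvg0P (R : realType) (I : Type) (F : set_system I) (FF : Filter F) (u : I -> \bar R) :
  (forall i, 0 <= u i)%E ->
  u @ F --> 0%E <-> forall e : R, 0 < e -> \forall i \near F, (u i <= e%:E)%E.
Proof.
move=> u0; split => [/(@fine_cvgP _ _ _ FF u 0)[h1 /cvgrPdist_le h2] e e0|H].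
  apply: filterS2 h1 (h2 e e0) => i fi; rewrite sub0r normrN /= => hi.
  by rewrite -(fineK fi) lee_fin (le_trans (ler_norm _)).
apply/fine_cvgP; split.
  by apply: filterS (H 1 ltr01) => i hi; rewrite ge0_fin_numE// (le_lt_trans hi)// ltry.
apply/cvgrPdist_le => e e0; apply: filterS (H e e0) => i hi.
have fi : u i \is a fin_num by rewrite ge0_fin_numE// (le_lt_trans hi)// ltry.
by rewrite sub0r normrN/= ger0_norm ?fine_ge0// -lee_fin fineK.
Qed.

(** * The weighted essential norm as an almost everywhere bound *)

Section Linfty.
Context {R : realType} (alpha : R).
Local Notation wt := (wt alpha).
Implicit Types (f g : phase R -> R) (z : phase R).

Lemma omega_gt0 (p : R) : 0 < p < 2 * pi -> 0 < omega p.
Proof.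
move=> /andP[p0 p1]; rewrite omega_period; last by rewrite (ltW p0) ltW.
by apply: sin_gt0_pi; move: p0 p1; move: (pi : R) => P; lra.
Qed.

(** Momenta 0 and 2 pi are negligible, and at all others omega^alpha and [wt] are inverse to each
    other. *)
Lemma Linfty_norm_leP f (e : R) : 0 <= e -> (Linfty_norm alpha f <= e%:E)%E <->
  {ae phase_measure, forall z, `|f z| <= e * wt z.2}.
Proof.
move=> e0.
have pw z : 0 < z.2 < 2 * pi -> (`|weighted alpha f z| <= e) = (`|f z| <= e * wt z.2).
  move=> /omega_gt0 w0; have p0 : 0 < omega z.2 `^ alpha by exact: powR_gt0.
  rewrite /weighted normrM (gtr0_norm p0) -(ler_pM2l p0 `|f z|).
  by rewrite mulrCA powR_wt// mulr1.
rewrite /Linfty_norm unlock; case: ifPn => m0.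
  split => [/ess_sup_inf.ess_supP|] h; last apply/ess_sup_inf.ess_supP; apply: filterS2 (@ae_interior R) h => z /pw hz /=;
  by rewrite lee_fin hz.
split => // _; apply: measure0_ae; apply/eqP; rewrite -measure_le0 leNgt//.
Qed.

Lemma Linfty_norm_ge0 f : (0 <= Linfty_norm alpha f)%E.
Proof. exact: Lnorm_ge0. Qed.

End Linfty.

(** * From pointwise solutions to solutions in the sense of the theorem, and back *)

Section mild_solutions.
Context {R : realType} (alpha : R).
Hypothesis alpha1 : alpha <= 1.
Local Notation mu := (@lebesgue_measure R).
Local Notation wt := (wt alpha).
Local Notation lip := (lip alpha).
Implicit Types (f g : phase R -> R) (F G : R -> phase R -> R) (z : phase R).

(** A competing solution is measurable only over [0, T]; its extension by 0 is jointly measurable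
    over all times, as [joint] demands. *)
Definition cutoff (T : R) G (t : R) : phase R -> R := if 0 <= t <= T then G t else fun=> 0.

Lemma mild_solution_mildmap f0 f F (t : R) :
  {ae phase_measure, forall z, f0 z = f z} ->
  {ae phase_measure, forall z,
    transport t f0 z + \int[mu]_(s in `[0, t]) transport (t - s) (collision_xp (F s)) z =
    mildmap f F t z}.
Proof.
move=> /(ae_shift t) h; apply: filterS2 (@ae_interior R) h => z hz h.
have vE := velocity_vel hz; apply: (f_equal2 +%R).
  by rewrite -h /transport vE.
apply: eq_Rintegral => s _; rewrite /along /transport /collision_xp vE red_id//.
by case/andP: hz => /ltW -> ->.
Qed.

Lemma mildmap_cutoff f G (T t : R) z : t <= T -> mildmap f (cutoff T G) t z = mildmap f G t z.
Proof.
move=> tT; apply: (congr1 (+%R _)); apply: eq_Rintegral => s; rewrite inE/= in_itv/= => /andP[s0 st].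
by rewrite /along /cutoff s0 (le_trans st tT).
Qed.

Lemma mild_solution_ae f0 f T M G : 0 <= M -> C_Linfty alpha T G -> mild_solution f0 T G ->
  {ae phase_measure, forall z, f0 z = f z} ->
  (forall t, 0 <= t <= T -> (Linfty_norm alpha (G t) <= M%:E)%E) ->
  mild_ae alpha f T M (cutoff T G).
Proof.
move=> M0 [mG LG _ _] eG f0f bG; split.
- have mD : measurable ((`[0, T]%classic : set (measurableTypeR R)) `*` [set: phase R]).
    by apply: measurableX => //; exact: measurable_itv.
  have := (measurable_restrictT _ mD).1 mG; rewrite /joint; congr measurable_fun.
  apply/funext => -[t z]; rewrite /patch /cutoff/= in_setX in_setT andbT mem_setE in_itv/=.
  by case: ifP.
- move=> t; rewrite /cutoff; case: ifP => // ht.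
  by have [|_ pG _] := LG t; rewrite ?in_itv.
- by move=> t ht; rewrite /cutoff ht; apply/Linfty_norm_leP => //; exact: bG.
- move=> t ht; have tI : t \in `[0, T] by rewrite in_itv.
  apply: filterS2 (eG t tI) (@mild_solution_mildmap f0 f G t f0f) => z h1 h2.
  rewrite mildmap_cutoff; last by case/andP: ht.
  rewrite (_ : cutoff T G t z = G t z); last by rewrite /cutoff ht.
  by rewrite h1; exact: h2.
Qed.

Lemma mild_everywhere_solution f0 f T M F : 0 <= M -> mild_everywhere alpha f T M F ->
  {ae phase_measure, forall z, f0 z = f z} -> C_Linfty alpha T F /\ mild_solution f0 T F.
Proof.
move=> M0 mF f0f; have [jF pF bF eF] := mF.
have nF t : 0 <= t <= T -> (Linfty_norm alpha (F t) <= M%:E)%E.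
  by move=> ht; apply/Linfty_norm_leP => //; apply: aeW => z; exact: bF.
split; last first.
  move=> t; rewrite in_itv/= => ht; have := @mild_solution_mildmap f0 f F t f0f.
  by apply: filterS => z ->; exact: eF.
split.
- exact: measurable_funTS.
- move=> t; rewrite in_itv/= => ht; split; [exact: joint_section|exact: pF|].
  by rewrite (le_lt_trans (nF t ht))// ltry.
- by exists M => t; rewrite in_itv/=; exact: nF.
- exact: mild_weak_star_continuous mF.
Qed.

Lemma mild_norm_continuous f T M F : 0 <= M -> 0 < T -> measurable_fun setT f -> periodic_p f ->
  (forall z, `|f z| <= M * wt z.2) -> T * lip (2 * M) <= 2^-1 ->
  (forall E, 0 < E -> exists2 e, 0 < e & forall h, 0 <= h <= e ->
    {ae phase_measure, forall z, `|f (z.1 - vel z.2 * h, z.2) - f z| <= E * wt z.2}) ->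
  mild_everywhere alpha f T (2 * M) F -> Linfty_norm_continuous alpha T F.
Proof.
move=> M0 T0 mf pf bf small H mF t; rewrite in_itv/= => ht.
have M20 : 0 <= 2 * M by rewrite mulr_ge0.
apply/ereal_cvg0P => [s|eps eps0]; first exact: Linfty_norm_ge0.
pose X := expR (2 * (lip (2 * M) + 1) * T); have X0 : 0 < X by exact: expR_gt0.
(* Stability turns this into 2 (eps / 8 / X) X = eps / 4, counted at s and at t; the averaged
   solution contributes eps / 2. *)
have E0 : 0 < eps / 8 / X by rewrite !divr_gt0.
have [e e0 He] := H _ E0.
pose g := flow_average f e.
have mg : measurable_fun setT g by exact: measurable_flow_average.
have pg : periodic_p g by exact: flow_average_periodic.
have bg z : `|g z| <= M * wt z.2 by exact: flow_average_bounded.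
have fg := flow_average_close mf bf e0 (ltW E0) He.
have [G mG] := mild_everywhere_exists alpha1 mg pg M0 (ltW T0) bg small.
have eps2 : 0 < eps / 2 by rewrite divr_gt0.
have B0 : 0 <= 2 * M / e by rewrite divr_ge0// ltW.
have lg x p h : `|g (x - vel p * h, p) - g (x, p)| <= 2 * M / e * `|h| * wt p.
  exact: flow_average_lipschitz.
have [r r0 hr] := flow_lipschitz_continuous alpha1 M20 (ltW T0) B0 mG lg eps2.
have close s : 0 <= s <= T -> {ae phase_measure, forall z, `|F s z - G s z| <= eps / 4 * wt z.2}.
  move=> hs.
  have := mild_ae_stability alpha1 M20 (ltW E0) (mild_everywhere_ae mF) (mild_everywhere_ae mG) fg hs.
  apply: filterS => z hz; apply: (le_trans hz); rewrite ler_wpM2r ?wt_ge0//.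
  apply: (@le_trans _ _ (2 * (eps / 8 / X) * X)).
    apply: ler_wpM2l; first by rewrite mulr_ge0// ltW.
    rewrite /X ler_expR ler_wpM2l//.
      by rewrite mulr_ge0// addr_ge0// lip_ge0.
    by case/andP: hs.
  by rewrite -mulrA divfK ?gt_eqF//; lra.
have near_t : \forall s \near t, `|t - s| <= r.
  by have /cvgrPdist_le := @cvg_id _ (nbhs t); apply.
rewrite near_withinE; apply: filterS near_t => s hs; rewrite /= in_itv/= => sT.
apply/Linfty_norm_leP; first exact: ltW.
apply: filterS2 (close s sT) (close t ht) => z h1 h2 /=.
have h3 := hr s t z sT ht hs.
have -> : F s z - F t z = (F s z - G s z) - (G t z - G s z) - (F t z - G t z) by ring.
apply: (le_trans (ler_normB _ _)).
have := lerD (le_trans (ler_normB _ _) (lerD h1 h3)) h2; rewrite -!mulrDl.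
by move=> h; apply: (le_trans h); rewrite ler_wpM2r ?wt_ge0//; lra.
Qed.

Lemma transport_continuous_ae f0 f T : 0 < T -> {ae phase_measure, forall z, f0 z = f z} ->
  Linfty_norm_continuous alpha T (fun t => transport t f0) ->
  forall E, 0 < E -> exists2 e, 0 < e & forall h, 0 <= h <= e ->
    {ae phase_measure, forall z, `|f (z.1 - vel z.2 * h, z.2) - f z| <= E * wt z.2}.
Proof.
move=> T0 f0f H E E0.
have h0 : 0 \in `[0, T] by rewrite in_itv/= lexx ltW.
have u0 s : (0 <= Linfty_norm alpha (transport s f0 \- transport 0 f0)%R)%E by exact: Linfty_norm_ge0.
have FF : Filter (within `[0, T] (nbhs (0 : R))) by exact: within_filter.
have near0 := (ereal_cvg0P FF u0).1 (H 0 h0) E E0.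
rewrite near_withinE in near0; have /nbhs_norm0P[r /= r0 hr] := near0.
exists (Num.min (r / 2) T); first by rewrite lt_min divr_gt0.
move=> h /andP[h1]; rewrite le_min => /andP[h2 h3].
have /(Linfty_norm_leP _ _ (ltW E0)) : (Linfty_norm alpha (transport h f0 \- transport 0 f0)%R <= E%:E)%E.
  apply: hr; last by rewrite /= in_itv/= h1.
  by rewrite /= ger0_norm//; lra.
move=> hE.
have hs : {ae phase_measure, forall z, 0 < z.2 < 2 * pi /\ f0 (z.1 - vel z.2 * h, z.2) = f (z.1 - vel z.2 * h, z.2)}.
  by apply: filterS2 (@ae_interior R) (ae_shift h f0f) => z; split.
apply: filterS3 hs f0f hE => z [hz e1] e2 /=.
by rewrite /transport (velocity_vel hz) e1 mulr0 subr0 -surjective_pairing e2.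
Qed.

End mild_solutions.

(** * Well-posedness and the time of existence *)

Section wellposedness.
Context {R : realType} (alpha : R).
Hypothesis alpha1 : alpha <= 1.
Local Notation wt := (wt alpha).
Local Notation lip := (lip alpha).
Implicit Types (f : phase R -> R) (z : phase R).

(** Replacing f0 by 0 where the bound fails alters it on a null set only. Periodicity survives
    because the condition itself is periodic in p. *)
Lemma in_Linfty_representative f0 (M : R) : 0 <= M -> in_Linfty alpha f0 ->
  (Linfty_norm alpha f0 <= M%:E)%E ->
  exists f, [/\ measurable_fun setT f, periodic_p f, forall z, `|f z| <= M * wt z.2 &
    {ae phase_measure, forall z, f0 z = f z}].
Proof.
move=> M0 [mf0 pf0 _] /(Linfty_norm_leP _ _ M0) h.
have m2 : measurable_fun setT (fun z : phase R => z.2) by exact: measurable_snd.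
exists (fun z => if `|f0 z| <= M * wt z.2 then f0 z else 0); split.
- apply: measurable_fun_ifT => //; apply: measurable_fun_ler.
    exact: measurable_fun_norm.
  by apply: measurable_funM => //; exact: measurable_fun_wt.
- move=> x p /=; rewrite pf0; congr (if _ <= _ * _ then _ else _).
  exact: wt_periodic.
- by move=> z; case: ifP => // _; rewrite normr0 mulr_ge0// wt_ge0.
- by apply: filterS h => z /= ->.
Qed.

Lemma mild_well_posed f0 (T M : R) : 0 <= M -> 0 < T -> in_Linfty alpha f0 ->
  (Linfty_norm alpha f0 <= M%:E)%E -> T * lip (2 * M) <= 2^-1 ->
  unique_mild_solution alpha f0 T.
Proof.
move=> M0 T0 Lf0 hM small.
have [f [mf pf bf f0f]] := in_Linfty_representative M0 Lf0 hM.
have [F mF] := mild_everywhere_exists alpha1 mf pf M0 (ltW T0) bf small.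
have M20 : 0 <= 2 * M by rewrite mulr_ge0.
have [CF sF] := mild_everywhere_solution alpha1 M20 mF f0f.
exists F; split => //; last first.
  move=> H; apply: (mild_norm_continuous alpha1 M0 T0 mf pf bf small _ mF).
  exact: transport_continuous_ae T0 f0f H.
move=> G CG sG t; rewrite in_itv/= => ht.
have [_ _ [M' hM'] _] := CG; have [jF pF bF eF] := mF.
(* The bound M' of the competing solution may exceed 2 M; stability is therefore applied with a
   common bound for both. *)
pose K := Num.max (2 * M) M'; have K0 : 0 <= K by rewrite le_max M20.
have mG : mild_ae alpha f T K (cutoff T G).
  apply: (mild_solution_ae K0 CG sG f0f) => s hs.
  by rewrite (le_trans (hM' s _)) ?in_itv// lee_fin le_max lexx orbT.
have mF' : mild_ae alpha f T K F.
  apply: mild_everywhere_ae; split => // s hs z; apply: (le_trans (bF s hs z)).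
  by rewrite ler_wpM2r ?wt_ge0// le_max lexx.
have e0 : {ae phase_measure, forall z, `|f z - f z| <= 0 * wt z.2}.
  by apply: aeW => z; rewrite subrr normr0 mul0r.
have := mild_ae_stability alpha1 K0 (lexx 0) mG mF' e0 ht.
apply: filterS => z; rewrite mulr0 !mul0r normr_le0 subr_eq0 /cutoff ht.
exact/eqP.
Qed.

End wellposedness.

Unset Implicit Arguments.

Theorem theorem1p1 (R : realType) (alpha : R) (halpha : alpha <= 1) :
  exists c C : R,
    [/\ 0 < c, 0 < C &
      forall f0 : phase R -> R, in_Linfty alpha f0 ->
        let N := fine (Linfty_norm alpha f0) in
        (0 < N -> exists T : R,
           c * N ^- 2 <= T <= C * N ^- 2 /\ unique_mild_solution alpha f0 T) /\
        (N = 0 -> forall T : R, 0 < T -> unique_mild_solution alpha f0 T)].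
Proof.
(* Chosen so that [lip alpha (2 * M)] = K M^2 / 2: the smallness condition then reads T K M^2 <= 1,
   and T = 1 / (K N^2) saturates it, so one constant serves as c and C. *)
pose K := 192 * pi * kconst alpha.
have K0 : 0 < K by rewrite !mulr_gt0 ?pi_gt0 ?kconst_gt0.
have lipE M : lip alpha (2 * M) = K * M ^+ 2 / 2 by rewrite /lip /K; field.
exists K^-1, K^-1; split; rewrite ?invr_gt0// => f0 Lf0 N.
have fN : Linfty_norm alpha f0 \is a fin_num.
  by case: Lf0 => _ _ hN; rewrite ge0_fin_numE// Linfty_norm_ge0.
have hN : Linfty_norm alpha f0 = N%:E by rewrite /N fineK.
split=> [N0|N0 T T0].
  exists (K^-1 * N ^- 2); split; first by rewrite lexx.
  apply: (mild_well_posed halpha (ltW N0)) => //; last 2 first.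
  - by rewrite hN.
  - by rewrite lipE le_eqVlt; apply/orP; left; apply/eqP; field; rewrite !gt_eqF.
  by rewrite mulr_gt0 ?invr_gt0 ?exprn_gt0.
(* A zero datum is bounded by every M >= 0; this one satisfies T K M^2 = 1, so any T is reached. *)
pose M := Num.sqrt (T * K)^-1.
have TK0 : 0 < T * K by exact: mulr_gt0.
have M0 : 0 <= M by exact: sqrtr_ge0.
apply: (mild_well_posed halpha M0) => //; first by rewrite hN N0 lee_fin.
rewrite lipE sqr_sqrtr ?invr_ge0 ?(ltW TK0)//.
by rewrite le_eqVlt; apply/orP; left; apply/eqP; field; rewrite !gt_eqF.
Qed.
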